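(* There is a unique function $\mathrm{lk}$ from the set of oriented 2-component links to $\mathbb{Z}$ such that (i) $\mathrm{lk}$ is an isotopy invariant, i.e. it takes equal values on isotopic oriented links; (ii) $\mathrm{lk}$ assumes value $0$ on the trivial link; (iii) for any oriented 2-component links $K_+$ and $K_-$ having plane diagrams that differ only by a crossing change of a crossing $A$, where $A$ is a positive crossing in the diagram of $K_+$ and a negative crossing in the diagram of $K_-$, $$\mathrm{lk} K_+-\mathrm{lk} K_- =\begin{cases}1 & \text{if } A \text{ is a crossing of different components,}\\ 0 & \text{if } A \text{ is a self-crossing of one component.}\end{cases}$$
   Context: A knot is a closed non-self-intersecting polygonal line in $\mathbb{R}^3$. A link is an ordered collection of pairwise disjoint knots, called its components; it is oriented if every component is an oriented polygonal line. The trivial link is a link formed by triangles in parallel planes (with any orientations). Elementary move: suppose that two sides $AC$ and $CB$ of a triangle $ABC$ are edges of a component of a link and that the link and the (filled) triangle $ABC$ do not intersect at any other points. The elementary move $ACB\to AB$ replaces the edges $AC$, $CB$ by $AB$; the inverse operation is also an elementary move; if $ABC$ is degenerate, an elementary move is subdivision of an edge or its inverse. Two oriented links are isotopic if one is obtained from the other by a finite sequence of elementary moves through oriented links, preserving the order and the orientations of components. A plane diagram of an oriented link is its generic projection onto a plane, together with the orientation and the information which part goes under and which part goes over at every crossing. (A union of polygonal lines in the plane is generic if there are polygonal lines $L$ with the same union of edges such that no 3 vertices of $L$ belong to a line and no 3 segments joining some vertices of $L$ have a common interior point.) A crossing change is the change of overcrossing to undercrossing, or vice versa, at one crossing. Sign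 of a crossing: let $\overrightarrow{AB}$ be the oriented edge of the diagram passing over and $\overrightarrow{CD}$ the oriented edge passing under at the crossing. The crossing is positive (sign $+1$) if the triangle $ABC$ is oriented clockwise, and negative (sign $-1$) otherwise. *)

(* Defs.v *)
From HB Require Import structures.
From mathcomp Require Import all_boot all_order all_algebra.
From mathcomp Require Import all_classical reals.
From Stdlib Require Relation_Operators.

Set Implicit Arguments.
Unset Strict Implicit.
Unset Printing Implicit Defensive.

Import Order.TTheory GRing.Theory Num.Theory.

Local Open Scope classical_set_scope.
Local Open Scope ring_scope.

Section Polygons.
Variables (R : realType) (V : lmodType R).
Implicit Types (A B C : V) (s : seq V).

Definition segment A B : set V :=
  [set x | exists t : R, 0 <= t <= 1 /\ x = (1 - t) *: A + t *: B].

Definition half_open_segment A B : set V :=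
  [set x | exists t : R, 0 <= t < 1 /\ x = (1 - t) *: A + t *: B].

(* Interior points of a segment; meaningful for A != B only. *)
Definition open_segment A B : set V :=
  [set x | exists t : R, 0 < t < 1 /\ x = (1 - t) *: A + t *: B].

Definition triangle A B C : set V :=
  [set x | exists a b c : R, [/\ 0 <= a, 0 <= b, 0 <= c, a + b + c = 1 &
     x = a *: A + b *: B + c *: C]].

(* An oriented closed polygonal line is given by the cyclic sequence of its    *)
(* vertices: two sequences describe the same oriented line when they differ    *)
(* by a rotation.  The last vertex is joined to the first one.                 *)
Definition edges s : seq (V * V) := zip s (rot 1 s).

Definition carrier s : set V :=
  [set x | exists2 e, e \in edges s & segment e.1 e.2 x].

(* The half-open edges [A, B[ partition a closed polygonal line exactly when   *)
(* it does not intersect itself.  Straight angles at vertices are allowed.     *)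
Definition is_knot s : Prop :=
  [/\ (2 < size s)%N, uniq s &
      forall e f, e \in edges s -> f \in edges s ->
        half_open_segment e.1 e.2 `&` half_open_segment f.1 f.2 !=set0 ->
        e = f].

(* [s] is obtained from [L] by repeatedly subdividing edges. *)
Inductive subdivides (L : seq V) : seq V -> Prop :=
| subdivides_refl : subdivides L L
| subdivides_rot n s : subdivides L s -> subdivides L (rot n s)
| subdivides_edge A C B s : A != B -> open_segment A B C ->
    subdivides L [:: A, B & s] -> subdivides L [:: A, C, B & s].

End Polygons.

Section Links.
Variable R : realType.

Notation space := 'rV[R]_3.
Notation plane := 'rV[R]_2.

(* An oriented 2-component link (ordered components), together with a choice   *)
(* of a starting vertex on each component.                                     *)
Record link2 := Link2 {
  comp1 : seq space;
  comp2 : seq space;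
  comp1_knot : is_knot comp1;
  comp2_knot : is_knot comp2;
  comp_disjoint : carrier comp1 `&` carrier comp2 = set0 }.

Definition same_link (K K' : link2) : Prop :=
  exists m n, comp1 K' = rot m (comp1 K) /\ comp2 K' = rot n (comp2 K).

(* ACB -> AB on the component [s], the other component of the link being [o].  *)
(* If A, C, B are collinear then, [s] being a knot, C is an interior point of  *)
(* AB; the last condition then always holds and the move is the inverse of a   *)
(* subdivision.                                                                *)
Definition triangle_move (s s' o : seq space) : Prop :=
  exists A C B t,
    [/\ s = [:: A, C, B & t], s' = [:: A, B & t] &
        (carrier s `|` carrier o) `&` triangle A B C =
        segment A C `|` segment C B].

Definition elementary_move (K K' : link2) : Prop :=
  (triangle_move (comp1 K) (comp1 K') (comp2 K) /\ comp2 K' = comp2 K) \/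
  (triangle_move (comp2 K) (comp2 K') (comp1 K) /\ comp1 K' = comp1 K).

Definition isotopic : link2 -> link2 -> Prop :=
  Relation_Operators.clos_refl_sym_trans link2
    (fun K K' => same_link K K' \/ elementary_move K K').

Definition dot (u v : space) : R := \sum_i u 0 i * v 0 i.

(* The triangles lie in two distinct parallel planes, of normal vector [n]. *)
Definition trivial_link (K : link2) : Prop :=
  [/\ size (comp1 K) = 3%N, size (comp2 K) = 3%N &
      exists (n : space) (h1 h2 : R),
        [/\ n != 0, h1 != h2,
            (forall v, v \in comp1 K -> dot n v = h1) &
            (forall v, v \in comp2 K -> dot n v = h2)]].

(* Orthogonal projection onto a plane, in coordinates: the first two columns   *)
(* of [M] are an orthonormal basis of the plane, positively oriented for an    *)
(* observer placed in the direction of the third column.                       *)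
Definition is_frame (M : 'M[R]_3) : Prop := M^T *m M = 1%:M /\ \det M = 1.

Definition project (M : 'M[R]_3) (v : space) : plane := @lsubmx R 1 2 1 (v *m M).

Definition height (M : 'M[R]_3) (v : space) : R := (v *m M) 0 ord_max.

(* Twice the signed area of ABC, positive if ABC is counterclockwise. *)
Definition orient (A B C : plane) : R :=
  (B 0 0 - A 0 0) * (C 0 1 - A 0 1) - (B 0 1 - A 0 1) * (C 0 0 - A 0 0).

Definition clockwise (A B C : plane) : bool := orient A B C < 0.

Definition general_position (L1 L2 : seq plane) : Prop :=
  let vs := L1 ++ L2 in
  [/\ (2 < size L1)%N, (2 < size L2)%N, uniq vs,
      (forall A B C, A \in vs -> B \in vs -> C \in vs ->
         uniq [:: A; B; C] -> orient A B C != 0) &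
      (forall A1 B1 A2 B2 A3 B3,
         {subset [:: A1; B1; A2; B2; A3; B3] <= vs} ->
         A1 != B1 -> A2 != B2 -> A3 != B3 ->
         segment A1 B1 <> segment A2 B2 ->
         segment A1 B1 <> segment A3 B3 ->
         segment A2 B2 <> segment A3 B3 ->
         open_segment A1 B1 `&` open_segment A2 B2 `&` open_segment A3 B3
           = set0)].

Definition edge : Type := plane * plane.

(* The polygonal lines of a diagram are those without superfluous vertices,    *)
(* so that their oriented edges do not depend on subdivisions of the link.     *)
(* [over D e f] is only significant when e and f cross, and means that e       *)
(* passes over f at their crossing.                                            *)
Record diagram := Diagram {
  line1 : seq plane;
  line2 : seq plane;
  over : edge -> edge -> bool }.

Definition diagram_edges (D : diagram) : seq edge :=
  edges (line1 D) ++ edges (line2 D).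

Definition crossing (D : diagram) (e f : edge) : Prop :=
  [/\ e \in diagram_edges D, f \in diagram_edges D, e != f &
      open_segment e.1 e.2 `&` open_segment f.1 f.2 !=set0].

(* Some edges [p], [q] of the link projecting into the crossing edges [e], [f] *)
(* of a diagram contain points [P], [Q] above the crossing, P being higher.    *)
Definition passes_over (M : 'M[R]_3) (K : link2) (e f : edge) : Prop :=
  exists p q P Q,
    [/\ p \in edges (comp1 K) ++ edges (comp2 K),
        q \in edges (comp1 K) ++ edges (comp2 K),
        (project M @` segment p.1 p.2 `<=` segment e.1 e.2),
        (project M @` segment q.1 q.2 `<=` segment f.1 f.2) &
        [/\ segment p.1 p.2 P, segment q.1 q.2 Q, project M P = project M Q &
            height M Q < height M P]].

Definition diagram_of (K : link2) (D : diagram) : Prop :=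
  general_position (line1 D) (line2 D) /\
  exists M, [/\ is_frame M,
    subdivides (line1 D) (map (project M) (comp1 K)),
    subdivides (line2 D) (map (project M) (comp2 K)) &
    forall e f, crossing D e f -> (over D e f <-> passes_over M K e f)].

Definition crossing_change (D D' : diagram) (e f : edge) : Prop :=
  [/\ crossing D e f, line1 D' = line1 D, line2 D' = line2 D,
      over D' e f = ~~ over D e f /\ over D' f e = ~~ over D f e &
      forall g h, crossing D g h -> (g, h) != (e, f) -> (g, h) != (f, e) ->
        over D' g h = over D g h].

Definition crossing_sign (D : diagram) (e f : edge) : int :=
  let: (AB, CD) := if over D e f then (e, f) else (f, e) in
  if clockwise AB.1 AB.2 CD.1 then 1 else -1.

Definition different_components (D : diagram) (e f : edge) : bool :=
  (e \in edges (line1 D)) (+) (f \in edges (line1 D)).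

End Links.

(* Main.v *)
(** Existence.  For an edge [e] of the first component and an edge [f] of the
second one, the differences of a point of [e] and a point of [f] fill a
quadrilateral; counting with signs the quadrilaterals which meet the ray in a
generic direction [u] gives the degree of the Gauss map over [u].  Passing from
[u] to [v] changes the count by a function of the sides, which cancel in the sum
over the closed torus; hence the choice of [u] does not matter.  A triangle move
does not matter either: the prism over the triangle ABC minus [f] does not meet
the origin, so it is separated from it by a plane, and one may count in a
direction pointing away from the prism.  Taking [u] close to the line of sight of
a diagram turns the count into a sum over crossings, which shows the effect of a
crossing change.

Uniqueness.  The difference [g] of two solutions is isotopy invariant, vanishes
on the trivial link and does not change under crossing changes.  Move a vertex
of a link in spatially general position by a generic vector [d].  The
projection along [d] is constant, and the diagram changes one crossing at a time
(when the moving vertex crosses the plane of three other vertices), so [g] does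
not change.  Hence [g] is the same on a generic link and on any link with the
same numbers of vertices: send the vertices of the former, one after the other,
close to those of the latter.  Comparing with a trivial link to which vertices
have been added, [g] is zero. *)

From HB Require Import structures.
From mathcomp Require Import all_boot all_order all_algebra.
From mathcomp Require Import all_classical reals.
From mathcomp Require Import ring lra zify.
From Stdlib Require Relation_Operators.
Require Import Defs.

Set Implicit Arguments.
Unset Strict Implicit.
Unset Printing Implicit Defensive.

Import Order.TTheory GRing.Theory Num.Theory.

Local Open Scope classical_set_scope.
Local Open Scope ring_scope.

(** * Vectors in space and separation by planes *)

Section Vectors.
Variable R : realType.
Notation space := 'rV[R]_3.
Implicit Types (u v w n m X Y Z : space) (L : seq space).

(** Counting in space instead of in a diagram spares Reidemeister moves: an elementary move is
    treated directly, whether or not a projection stays generic. Disjointness enters the count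
    through a separating plane, given by Gordan's alternative, and limits become finite systems of
    strict inequalities that survive a small perturbation. A crossing is counted only when the first
    component passes over the second, so no factor 1/2 appears. In the uniqueness part a coplanarity
    of four vertices need not be visible in the diagram: of the three pairings of four points at
    most one gives crossing segments, and these may fail to be edges. Then no edge is swept, and the
    move is an isotopy made of two elementary moves. A given link may be in bad position, so it is
    only adjusted by arbitrarily small isotopies; the long moves are left to the generic link. A
    generic point is one where a function polynomial on lines does not vanish: such conditions
    combine, and are met arbitrarily close to any point, so both links can be given the same
    vertex. *)

Definition det3 u v w : R :=
  u 0 0 * (v 0 1 * w 0 ord_max - v 0 ord_max * w 0 1)
  - u 0 1 * (v 0 0 * w 0 ord_max - v 0 ord_max * w 0 0)
  + u 0 ord_max * (v 0 0 * w 0 1 - v 0 1 * w 0 0).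

Definition cross u v : space :=
  \row_i (if i == 0 then u 0 1 * v 0 ord_max - u 0 ord_max * v 0 1
          else if i == 1 then u 0 ord_max * v 0 0 - u 0 0 * v 0 ord_max
          else u 0 0 * v 0 1 - u 0 1 * v 0 0).

Lemma big3 (F : 'I_3 -> R) : \sum_i F i = F 0 + F 1 + F ord_max.
Proof.
rewrite !big_ord_recl big_ord0 addr0 addrA.
by congr (F _ + F _ + F _); apply/val_inj.
Qed.

Lemma dotE u v :
  dot u v = u 0 0 * v 0 0 + u 0 1 * v 0 1 + u 0 ord_max * v 0 ord_max.
Proof. by rewrite /dot big3. Qed.

Lemma ord3P (P : 'I_3 -> Prop) : P 0 -> P 1 -> P ord_max -> forall i, P i.
Proof.
move=> P0 P1 P2 [[|[|[|//]]] i].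
- by rewrite (_ : Ordinal i = 0) //; apply/val_inj.
- by rewrite (_ : Ordinal i = 1) //; apply/val_inj.
- by rewrite (_ : Ordinal i = ord_max) //; apply/val_inj.
Qed.

Lemma dot_cross u v w : dot (cross u v) w = det3 u v w.
Proof. rewrite dotE !mxE /= /det3; ring. Qed.

Lemma dotDr n u v : dot n (u + v) = dot n u + dot n v.
Proof. rewrite !dotE !mxE; ring. Qed.
Lemma dotBr n u v : dot n (u - v) = dot n u - dot n v.
Proof. rewrite !dotE !mxE; ring. Qed.
Lemma dotZr n k u : dot n (k *: u) = k * dot n u.
Proof. rewrite !dotE !mxE; ring. Qed.
Lemma dotNr n u : dot n (- u) = - dot n u.
Proof. rewrite !dotE !mxE; ring. Qed.
Lemma dotDl n m u : dot (n + m) u = dot n u + dot m u.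
Proof. rewrite !dotE !mxE; ring. Qed.
Lemma dotZl n k u : dot (k *: n) u = k * dot n u.
Proof. rewrite !dotE !mxE; ring. Qed.
Lemma dot0r n : dot n 0 = 0.
Proof. rewrite !dotE !mxE; ring. Qed.
Lemma dotC u v : dot u v = dot v u.
Proof. rewrite !dotE; ring. Qed.

Lemma dot_gt0 u : u != 0 -> 0 < dot u u.
Proof.
move=> u0; rewrite lt_neqAle dotE -!expr2 !addr_ge0 ?sqr_ge0 // andbT eq_sym.
apply: contra u0 => h; apply/eqP/rowP.
have sq0 (x y z : R) : x ^+ 2 + y ^+ 2 + z ^+ 2 == 0 -> [/\ x = 0, y = 0 & z = 0].
  rewrite paddr_eq0 ?addr_ge0 ?sqr_ge0 // paddr_eq0 ?sqr_ge0 //.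
  by rewrite !sqrf_eq0 => /andP[/andP[/eqP-> /eqP->] /eqP->].
by have [? ? ?] := sq0 _ _ _ h; apply: ord3P; rewrite mxE.
Qed.

(** Finitely many strict inequalities survive a small perturbation; this takes the place of
    continuity arguments. *)
Lemma small_pos (T : eqType) (s : seq T) (f g : T -> R) :
  (forall x, x \in s -> 0 < f x) ->
  exists2 e0, 0 < e0 & forall e x, 0 <= e < e0 -> x \in s -> 0 < f x + e * g x.
Proof.
elim: s => [|a s IH] h; first by exists 1.
have [|e0 e0_gt0 he0] := IH; first by move=> x xs; apply: h; rewrite inE xs orbT.
have fa : 0 < f a by apply: h; rewrite mem_head.
pose e1 := f a / (`|g a| + 1).
have g1 : 0 < `|g a| + 1 by rewrite ltr_wpDl.
have e1_gt0 : 0 < e1 by rewrite divr_gt0.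
exists (Num.min e0 e1); first by rewrite lt_min e0_gt0.
move=> e x /andP[e_ge0]; rewrite lt_min => /andP[ee0 ee1].
rewrite inE => /orP[/eqP->|xs]; last by apply: he0; rewrite ?e_ge0.
have : e * (`|g a| + 1) < f a by rewrite -ltr_pdivlMr.
have : - (e * `|g a|) <= e * g a.
  rewrite -mulrN; apply: ler_wpM2l => //.
  by rewrite lerNl -normrN ler_norm.
by rewrite mulrDr mulr1; lra.
Qed.

Definition halfspace L : Prop := exists n, forall X, X \in L -> 0 < dot n X.

Lemma halfspaceS L L' : {subset L <= L'} -> halfspace L' -> halfspace L.
Proof. by move=> LL' [n hn]; exists n => X /LL'; exact: hn. Qed.

(* [x] is a combination of the elements of [L], with nonnegative coefficients  *)
(* of sum [k].                                                                 *)
Fixpoint comb L x (k : R) : Prop :=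
  if L is a :: L' then exists2 c, 0 <= c & comb L' (x - c *: a) (k - c)
  else x = 0 /\ k = 0.

Lemma comb0 L : comb L 0 0.
Proof.
by elim: L => //= a L IH; exists 0; rewrite ?lexx // scale0r !subr0.
Qed.

(** Undoes the projection along [a] made in [gordan]: the shifts add up to a nonnegative multiple of
    [a], which becomes the coefficient of [a]. *)
Lemma comb_shift (a : space) (l : space -> R) L x k :
  (forall X, X \in L -> 0 <= l X) ->
  comb (map (fun X => X + l X *: a) L) x k ->
  exists2 m, 0 <= m & comb L (x - m *: a) k.
Proof.
elim: L x k => [|b L IH] x k h /=.
  by move=> [-> ->]; exists 0; rewrite ?scale0r ?subr0.
case=> c c0 /IH[|m m0 hm]; first by move=> X XL; apply: h; rewrite inE XL orbT.
exists (m + c * l b); first by rewrite addr_ge0 ?mulr_ge0 // h ?mem_head.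
exists c => //; move: hm; congr comb.
by apply/rowP => i; rewrite !mxE; ring.
Qed.

(** Gordan's theorem of the alternative. The induction is on the size because the hard case, [a]
    behind the plane orthogonal to [y], applies the hypothesis to the vectors of [L] projected along
    [a] onto that plane. *)
Lemma gordan L : halfspace L \/ exists2 k, 0 < k & comb L 0 k.
Proof.
have [n] := ubnP (size L); elim: n L => // n IH [|a L] /= sL.
  by left; exists 0.
have [[y hy]|[k k0 hk]] := IH L sL; last first.
  by right; exists k => //; exists 0; rewrite ?lexx // scale0r !subr0.
have [ya|ya|ya] := ltgtP (dot y a) 0; last 1 first.
- have [a0|a0] := eqVneq a 0.
    right; exists 1; rewrite ?ltr01 //; exists 1; rewrite ?ler01 //.
    by rewrite a0 scaler0 !subrr; exact: comb0.
  left; have [e0 e0_gt0 he] := @small_pos _ L (dot y) (dot a) hy.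
  exists (y + (e0 / 2) *: a) => X; rewrite inE dotDl dotZl => /orP[/eqP->|XL].
    by rewrite ya add0r mulr_gt0 ?dot_gt0 ?divr_gt0.
  by apply: he => //; lra.
- pose l X := - (dot y X / dot y a).
  have l0 X : X \in L -> 0 <= l X.
    move=> XL; rewrite /l oppr_ge0 nmulr_lle0 ?invr_lt0 //.
    exact/ltW/hy.
  have [|[z hz]|[k k0]] := IH (map (fun X => X + l X *: a) L); first by rewrite size_map.
    have hz' X : X \in L -> 0 < dot z X + l X * dot z a.
      by move=> XL; rewrite -dotZr -dotDr; apply: hz; apply: (map_f (fun X => X + l X *: a)).
    left; have [e0 e0_gt0 he] := small_pos (fun X => - l X) hz'.
    (* The multiple of [y] makes the product with [a] equal to [e0 / 2]; the product with any other
       [X] is that of [z] with its projection, less [l X * (e0 / 2)]. *)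
    exists (z + ((e0 / 2 - dot z a) / dot y a) *: y) => X.
    rewrite inE dotDl dotZl => /orP[/eqP->|XL].
      by rewrite divfK ?lt_eqF //; lra.
    have := he (e0 / 2) X; rewrite XL => /(_ _ isT) h.
    have : 0 < dot z X + l X * dot z a + e0 / 2 * - l X by apply: h; lra.
    congr (_ < _); rewrite /l; field; exact: ltr0_neq0.
  rewrite /=; case/(comb_shift l0) => m m0 hm; right; exists (k + m); first by lra.
  exists m => //; rewrite addrK //.
- left; exists y => X; rewrite inE => /orP[/eqP->//|]; exact: hy.
Qed.

End Vectors.

(** * A spherical sign count *)

Section SignLemma.
Variable R : realType.
Implicit Types (p r z D : R).

(** Let [D] be the determinant of three vectors and the [p]s those with one vector replaced by [u].
    By Cramer's rule equal signs put [u] inside the cone of the vectors, and the value is then the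
    orientation of the cone. *)
Definition tri p1 p2 p3 D : int :=
  if [&& 0 < p1, 0 < p2, 0 < p3 & 0 < D] then 1
  else if [&& p1 < 0, p2 < 0, p3 < 0 & D < 0] then -1 else 0.

(** Signed crossing of a spherical arc XY with the arc from u to v: [z1], [z2] tell the sides of X,
    Y with respect to the plane of u, v, and [p], [r] those of u, v with respect to the plane of X,
    Y. In the two other patterns of opposite signs one arc meets the antipode of the other. *)
Definition arc z1 z2 p r : int :=
  if [&& z1 < 0, 0 < z2, 0 < p & r < 0] then 1
  else if [&& 0 < z1, z2 < 0, p < 0 & 0 < r] then -1 else 0.

Lemma triC p1 p2 p3 D : tri p1 p2 p3 D = tri p2 p3 p1 D.
Proof.
rewrite /tri.
by case: (ltgtP p1 0); case: (ltgtP p2 0); case: (ltgtP p3 0); case: (ltgtP D 0).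
Qed.

Lemma triN p1 p2 p3 D : tri (- p1) (- p2) (- p3) (- D) = - tri p1 p2 p3 D.
Proof.
rewrite /tri !oppr_gt0 !oppr_lt0.
by case: (ltgtP p1 0); case: (ltgtP p2 0); case: (ltgtP p3 0); case: (ltgtP D 0).
Qed.

Lemma arcN z1 z2 p r : arc (- z1) (- z2) (- p) (- r) = - arc z1 z2 p r.
Proof.
rewrite /arc !oppr_gt0 !oppr_lt0.
by case: (ltgtP z1 0); case: (ltgtP z2 0); case: (ltgtP p 0); case: (ltgtP r 0).
Qed.

Lemma arc_sym z1 z2 p r : arc z2 z1 (- p) (- r) = - arc z1 z2 p r.
Proof.
rewrite /arc !oppr_gt0 !oppr_lt0.
by case: (ltgtP z1 0); case: (ltgtP z2 0); case: (ltgtP p 0); case: (ltgtP r 0).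
Qed.

Let same_sign p1 p2 p3 := [/\ 0 < p1, 0 < p2 & 0 < p3] \/ [/\ p1 < 0, p2 < 0 & p3 < 0].

(** Vertices 1 and 2 are on one side of the plane of u, v and vertex 3 on the other. The linear
    relations give the signs of [p3] and [r3] when the first two signs agree, and the third one
    gives that of [D] when [p1 * r2] and [p2 * r1] have opposite signs; sixteen cases remain to be
    inspected. *)
Lemma tri_arc_core p1 p2 p3 r1 r2 r3 z1 z2 z3 D :
  0 < z1 -> 0 < z2 -> z3 < 0 ->
  p1 * z1 + p2 * z2 + p3 * z3 = 0 -> r1 * z1 + r2 * z2 + r3 * z3 = 0 ->
  p1 * r2 - p2 * r1 = z3 * D ->
  p1 != 0 -> p2 != 0 -> r1 != 0 -> r2 != 0 ->
  (D = 0 -> ~ same_sign p1 p2 p3 /\ ~ same_sign r1 r2 r3) ->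
  tri p1 p2 p3 D - tri r1 r2 r3 D =
  arc z1 z2 p3 r3 + arc z2 z3 p1 r1 + arc z3 z1 p2 r2.
Proof.
move=> Z1 Z2 Z3 Lp Lr B p1n p2n r1n r2n D0.
have Pp : 0 < p1 -> 0 < p2 -> 0 < p3 by move=> *; nra.
have Pn : p1 < 0 -> p2 < 0 -> p3 < 0 by move=> *; nra.
have Rp : 0 < r1 -> 0 < r2 -> 0 < r3 by move=> *; nra.
have Rn : r1 < 0 -> r2 < 0 -> r3 < 0 by move=> *; nra.
have K1 : 0 < p1 * r2 -> p2 * r1 < 0 -> D < 0.
  by move=> a b; rewrite -(nmulr_rgt0 D Z3) -B; lra.
have K2 : p1 * r2 < 0 -> 0 < p2 * r1 -> 0 < D.
  by move=> a b; rewrite -(nmulr_rlt0 D Z3) -B; lra.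
have D0' : D = 0 -> ~ (0 < p1 /\ 0 < p2) /\ ~ (p1 < 0 /\ p2 < 0) /\
                    ~ (0 < r1 /\ 0 < r2) /\ ~ (r1 < 0 /\ r2 < 0).
  move=> /D0[dp dr]; split; [|split; [|split]] => -[h1 h2].
  - by apply: dp; left; split=> //; apply: Pp.
  - by apply: dp; right; split=> //; apply: Pn.
  - by apply: dr; left; split=> //; apply: Rp.
  - by apply: dr; right; split=> //; apply: Rn.
rewrite /tri /arc Z1 Z2 Z3 (lt_gtF Z1) (lt_gtF Z2) (lt_gtF Z3) /=.
move: p1n p2n r1n r2n; rewrite !neq_lt.
move=> /orP[] h1 /orP[] h2 /orP[] h3 /orP[] h4;
rewrite ?h1 ?h2 ?h3 ?h4 ?(lt_gtF h1) ?(lt_gtF h2) ?(lt_gtF h3) ?(lt_gtF h4) /=;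
rewrite ?(Pp h1 h2) ?(Pn h1 h2) ?(Rp h3 h4) ?(Rn h3 h4) /=;
case: (ltgtP D 0) => hD //=;
try (have [a [b [c d]]] := D0' hD; exfalso; by [apply: a | apply: b | apply: c | apply: d]);
exfalso; move: K1 K2;
rewrite ?(pmulr_rgt0 _ h1) ?(pmulr_rlt0 _ h1) ?(nmulr_rgt0 _ h1) ?(nmulr_rlt0 _ h1);
rewrite ?(pmulr_rgt0 _ h2) ?(pmulr_rlt0 _ h2) ?(nmulr_rgt0 _ h2) ?(nmulr_rlt0 _ h2);
rewrite ?h3 ?h4 ?(lt_gtF h3) ?(lt_gtF h4) ?(lt_gtF hD) ?hD ?ltxx => k1 k2;
by [have := k1 isT isT | have := k2 isT isT].
Qed.

(** Up to a global sign and a cyclic rotation this is [tri_arc_core], unless the three [z] have the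
    same sign; then the linear relations forbid [p]s, or [r]s, of one sign and everything
    vanishes. *)
Lemma tri_arc p1 p2 p3 r1 r2 r3 z1 z2 z3 D :
  z1 != 0 -> z2 != 0 -> z3 != 0 ->
  p1 * z1 + p2 * z2 + p3 * z3 = 0 -> r1 * z1 + r2 * z2 + r3 * z3 = 0 ->
  p2 * r3 - p3 * r2 = z1 * D -> p3 * r1 - p1 * r3 = z2 * D ->
  p1 * r2 - p2 * r1 = z3 * D ->
  (z2 * z3 < 0 -> p1 != 0 /\ r1 != 0) -> (z3 * z1 < 0 -> p2 != 0 /\ r2 != 0) ->
  (z1 * z2 < 0 -> p3 != 0 /\ r3 != 0) ->
  (D = 0 -> ~ same_sign p1 p2 p3 /\ ~ same_sign r1 r2 r3) ->
  tri p1 p2 p3 D - tri r1 r2 r3 D =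
  arc z1 z2 p3 r3 + arc z2 z3 p1 r1 + arc z3 z1 p2 r2.
Proof.
wlog z1gt : p1 p2 p3 r1 r2 r3 z1 z2 z3 D / 0 < z1.
  move=> wl; case: (ltgtP z1 0) => // h1 _; last by apply: wl => //; rewrite gt_eqF.
  move=> z2n z3n Lp Lr B1 B2 B3 n1 n2 n3 D0.
  have := wl (- p1) (- p2) (- p3) (- r1) (- r2) (- r3) (- z1) (- z2) (- z3) (- D).
  rewrite !oppr_gt0 !oppr_eq0 !mulrNN !triN !arcN => /(_ h1).
  move=> h; apply: oppr_inj; rewrite opprB addrC -[tri r1 _ _ _]opprK.
  rewrite [X in X = _](_ : _ = - tri p1 p2 p3 D - - tri r1 r2 r3 D); last first.
    by rewrite opprK addrC.
  rewrite h //; first by rewrite !opprD.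
  - by rewrite lt_eqF.
  - by move=> /eqP; rewrite oppr_eq0 => /eqP /D0[a b]; split=> -[] []; rewrite ?oppr_gt0 ?oppr_lt0 => *;
      [apply: a; right|apply: a; left|apply: b; right|apply: b; left].
case: (ltgtP z2 0) => // h2 _ _; case: (ltgtP z3 0) => // h3 _ Lp Lr B1 B2 B3 n1 n2 n3 D0.
- have [|a b] := n3; first by nra.
  have [|c d] := n2; first by nra.
  have := @tri_arc_core (- p2) (- p3) (- p1) (- r2) (- r3) (- r1) (- z2) (- z3) (- z1) (- D).
  rewrite !oppr_gt0 !oppr_lt0 !oppr_eq0 !mulrNN !triN !arcN => h.
  apply: oppr_inj; rewrite (triC p1) (triC r1).
  rewrite [LHS](_ : _ = - tri p2 p3 p1 D - - tri r2 r3 r1 D); last by ring.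
  rewrite h //.
  + by ring.
  + by rewrite -Lp; ring.
  + by rewrite -Lr; ring.
  + by move=> /eqP; rewrite oppr_eq0 => /eqP /D0[e f]; split=> -[] []; rewrite ?oppr_gt0 ?oppr_lt0 => *;
      [apply: e; right|apply: e; left|apply: f; right|apply: f; left].
- have [|a b] := n3; first by nra.
  have [|c d] := n1; first by nra.
  have := @tri_arc_core p3 p1 p2 r3 r1 r2 z3 z1 z2 D.
  rewrite (triC p3) (triC r3) => -> //.
  + by ring.
  + by rewrite -Lp; ring.
  + by rewrite -Lr; ring.
  + by move=> /D0[e f]; split=> -[] [] *;
      [apply: e; left|apply: e; right|apply: f; left|apply: f; right].
- have [|a b] := n2; first by nra.
  have [|c d] := n1; first by nra.
  exact: tri_arc_core.
- have tri0 (x y z : R) : x * z1 + y * z2 + z * z3 = 0 -> tri x y z D = 0.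
    move=> L; rewrite /tri; case: ifP => [/and4P[? ? ? _]|_]; first by exfalso; nra.
    by case: ifP => // /and4P[? ? ? _]; exfalso; nra.
  by rewrite !tri0 // /arc (lt_gtF z1gt) (lt_gtF h2) (lt_gtF h3) /= !andbF.
Qed.

End SignLemma.

(** * Generic directions and the signed count of cones *)

Section Generic.
Variable R : realType.
Notation space := 'rV[R]_3.
Implicit Types (u v w n X Y Z A B C D E : space) (L N s o : seq space).

Lemma generic_near N u w :
  (forall n, n \in N -> n != 0 -> dot n w != 0) ->
  exists2 e0, 0 < e0 & forall e, 0 < e < e0 ->
    forall n, n \in N -> n != 0 -> dot n (u + e *: w) != 0.
Proof.
move=> hw; have [] := @small_pos R _ [seq n <- N | dot n u != 0]
   (fun n => dot n u * dot n u) (fun n => dot n u * dot n w).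
  by move=> n; rewrite mem_filter => /andP[h _]; rewrite -expr2 exprn_even_gt0.
move=> e0 e0_gt0 he; exists e0 => // e /andP[e_gt0 ee0] n nN n0.
rewrite dotDr dotZr; have [->|h] := eqVneq (dot n u) 0.
  by rewrite add0r mulf_neq0 ?hw // gt_eqF.
have := he e n; rewrite mem_filter h nN ee0 ltW // => /(_ isT isT).
by apply: contraTneq => k; rewrite mulrCA -mulrDr k mulr0 ltxx.
Qed.

Lemma generic_exists N : exists w, forall n, n \in N -> n != 0 -> dot n w != 0.
Proof.
elim: N => [|a N [w hw]]; first by exists 0.
have [->|a0] := eqVneq a 0.
  by exists w => n; rewrite inE => /orP[/eqP->|]; rewrite ?eqxx //; exact: hw.
have [e0 e0_gt0 he] := generic_near a hw.
have [//|e1 e1_gt0 he1] := @small_pos R _ [:: a] (fun=> dot a a) (fun=> dot a w).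
  by move=> _ _; exact: dot_gt0.
exists (a + (Num.min e0 e1 / 2) *: w) => n.
have m0 : 0 < Num.min e0 e1 by rewrite lt_min e0_gt0.
have [m1 m2] : Num.min e0 e1 <= e0 /\ Num.min e0 e1 <= e1.
  by rewrite !ge_min !lexx orbT.
rewrite inE => /orP[/eqP-> _|]; last by apply: he; lra.
by rewrite gt_eqF // dotDr dotZr; apply: (he1 _ a); rewrite ?mem_head //; lra.
Qed.

Definition basis : seq space := [seq delta_mx 0 i | i : 'I_3].

(** The coordinate vectors are added so that [u] avoids the line of every nonzero [X] of [L], even
    when the members of [L] are all parallel. *)
Definition generic_dir u L := forall X Y, X \in L ++ basis -> Y \in L ++ basis ->
  cross X Y != 0 -> det3 X Y u != 0.

Lemma cross_basis X : X != 0 -> exists2 a, a \in basis & cross X a != 0.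
Proof.
move=> X0; apply/not_exists2P => h.
have {}h i : cross X (delta_mx 0 i) = 0.
  have kb : (delta_mx 0 i : space) \in basis by apply/mapP; exists i; rewrite ?mem_enum.
  by apply/eqP/negPn/negP => k; case: (h (delta_mx 0 i)) => h1; [case: h1 | exact: h1].
move: X0; apply/negP; rewrite negbK; apply/eqP/rowP.
have E (i j : 'I_3) := congr1 (fun M : space => M 0 j) (h i).
apply: ord3P; rewrite mxE.
- by have := E 1 ord_max; rewrite !mxE /= => k; rewrite -[RHS]k; ring.
- by have := E ord_max 0; rewrite !mxE /= => k; rewrite -[RHS]k; ring.
- by have := E 0 1; rewrite !mxE /= => k; rewrite -[RHS]k; ring.
Qed.

Lemma generic_dir_cross u L X : generic_dir u L -> X \in L -> X != 0 -> cross u X != 0.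
Proof.
move=> g XL /cross_basis[a ab]; apply: contraNneq => h.
have : det3 X a u = 0.
  have -> : det3 X a u = dot (cross u X) a by rewrite dot_cross /det3; ring.
  by rewrite h dotC dot0r.
move=> /eqP; apply: contraTT; move=> k; apply: g => //; rewrite mem_cat ?XL // ab orbT.
by [].
Qed.

Lemma generic_dir_exists L N : exists w, generic_dir w L /\
  forall n, n \in N -> n != 0 -> dot n w != 0.
Proof.
have [w hw] := generic_exists (N ++ [seq cross X Y | X <- L ++ basis, Y <- L ++ basis]).
exists w; split=> [X Y hX hY c0|n nN]; last by apply: hw; rewrite mem_cat nN.
by rewrite -dot_cross hw // mem_cat (allpairs_f _ hX hY) orbT.
Qed.

Lemma generic_dir_near L N u : exists w e0,
  [/\ forall n, n \in N -> n != 0 -> dot n w != 0, 0 < e0 &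
  forall e, 0 < e < e0 -> generic_dir (u + e *: w) L].
Proof.
pose C := [seq cross X Y | X <- L ++ basis, Y <- L ++ basis].
have [w hw] := generic_exists (N ++ C).
have [|e0 e0_gt0 he] := @generic_near C u w.
  by move=> n nC; apply: hw; rewrite mem_cat nC orbT.
exists w, e0; split=> // [n nN|e /he{}he X Y hX hY c0].
  by apply: hw; rewrite mem_cat nN.
by rewrite -dot_cross he // allpairs_f.
Qed.

Definition theta u X Y Z : int :=
  tri (det3 Y Z u) (det3 Z X u) (det3 X Y u) (det3 X Y Z).

Definition eta u v X Y : int :=
  arc (det3 u v X) (det3 u v Y) (det3 X Y u) (det3 X Y v).

Lemma eta_sym u v X Y : eta u v Y X = - eta u v X Y.
Proof.
rewrite /eta -arc_sym; congr arc; rewrite /det3; ring.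
Qed.

Lemma cross_eq0 n X Y : cross X Y = 0 -> dot n Y *: X = dot n X *: Y.
Proof.
move=> h; have E (j : 'I_3) := congr1 (fun M : space => M 0 j) h.
have := E 0; have := E 1; have := E ord_max; rewrite !mxE /= => h2 h1 h0.
apply/rowP; rewrite !dotE; apply: ord3P; rewrite !mxE.
- apply: subr0_eq; transitivity (n 0 1 * (X 0 0 * Y 0 1 - X 0 1 * Y 0 0) - n 0 ord_max * (X 0 ord_max * Y 0 0 - X 0 0 * Y 0 ord_max)); first by ring.
  by rewrite h2 h1 !mulr0 subrr.
- apply: subr0_eq; transitivity (n 0 ord_max * (X 0 1 * Y 0 ord_max - X 0 ord_max * Y 0 1) - n 0 0 * (X 0 0 * Y 0 1 - X 0 1 * Y 0 0)); first by ring.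
  by rewrite h0 h2 !mulr0 subrr.
- apply: subr0_eq; transitivity (n 0 0 * (X 0 ord_max * Y 0 0 - X 0 0 * Y 0 ord_max) - n 0 1 * (X 0 1 * Y 0 ord_max - X 0 ord_max * Y 0 1)); first by ring.
  by rewrite h1 h0 !mulr0 subrr.
Qed.

(* The signed number of intersections of the spherical triangle XYZ with the   *)
(* direction [u] depends on [u] through a function of the sides of XYZ only.   *)
Lemma theta_eta u v X Y Z : halfspace [:: X; Y; Z] ->
  (forall A B, A \in [:: X; Y; Z] -> B \in [:: X; Y; Z] -> cross A B != 0 ->
     det3 A B u != 0 /\ det3 A B v != 0) ->
  (forall A, A \in [:: X; Y; Z] -> det3 u v A != 0) ->
  theta u X Y Z - theta v X Y Z = eta u v X Y + eta u v Y Z + eta u v Z X.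
Proof.
move=> [n hn] hg hz.
(* Parallel vectors of an open half-space are positive multiples of each other, so they lie on the
   same side of the plane of [u] and [v]. *)
have degen A B : A \in [:: X; Y; Z] -> B \in [:: X; Y; Z] ->
    det3 u v A * det3 u v B < 0 -> det3 A B u != 0 /\ det3 A B v != 0.
  move=> hA hB lt0; apply: hg => //; apply/negP => /eqP c0.
  have := congr1 (det3 u v) (cross_eq0 n c0).
  have -> k W : det3 u v (k *: W) = k * det3 u v W by rewrite /det3 !mxE; ring.
  have -> k W : det3 u v (k *: W) = k * det3 u v W by rewrite /det3 !mxE; ring.
  move=> e; have := hn _ hA; have := hn _ hB => h1 h2.
  have : 0 <= dot n A * (det3 u v A * det3 u v B).
    rewrite mulrCA -e mulrCA mulr_ge0 ?(ltW h1) // -expr2 sqr_ge0 //.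
  by rewrite pmulr_rge0 // leNgt lt0.
have inX : X \in [:: X; Y; Z] by rewrite !inE eqxx.
have inY : Y \in [:: X; Y; Z] by rewrite !inE eqxx orbT.
have inZ : Z \in [:: X; Y; Z] by rewrite !inE eqxx !orbT.
have pos (p q r : R) : [/\ 0 < p, 0 < q & 0 < r] \/ [/\ p < 0, q < 0 & r < 0] ->
    p * dot n X + q * dot n Y + r * dot n Z != 0.
  have := hn _ inX; have := hn _ inY; have := hn _ inZ => h1 h2 h3.
  by move=> [] [] *; apply/eqP; nra.
(* Cramer's identity paired with [n]: if the determinant of X, Y, Z vanishes, the three coefficients
   cannot have the same sign. *)
have lin W : det3 Y Z W * dot n X + det3 Z X W * dot n Y + det3 X Y W * dot n Z
             = det3 X Y Z * dot n W by rewrite !dotE /det3; ring.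
apply: tri_arc; rewrite ?hz //; try (by rewrite /det3; ring).
- exact: degen.
- exact: degen.
- exact: degen.
- by move=> D0; split=> /pos /eqP; rewrite lin D0 mul0r.
Qed.

(** The differences of points of AB and CD fill a parallelogram, cut here along the diagonal from
    [A - C] to [B - D]. *)
Definition quad u A B C D : int :=
  theta u (A - C) (B - C) (B - D) + theta u (A - C) (B - D) (A - D).

Lemma quad_eta L u v A B C D :
  generic_dir u L -> generic_dir v L -> (forall X, X \in L -> det3 u v X != 0) ->
  {subset [:: A - C; B - C; B - D; A - D] <= L} ->
  halfspace [:: A - C; B - C; B - D; A - D] ->
  quad u A B C D - quad v A B C D =
    eta u v (A - C) (B - C) - eta u v (A - D) (B - D)
    - eta u v (A - C) (A - D) + eta u v (B - C) (B - D).
Proof.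
move=> gu gv guv LS hs; rewrite /quad.
have T X Y Z : {subset [:: X; Y; Z] <= [:: A - C; B - C; B - D; A - D]} ->
    theta u X Y Z - theta v X Y Z = eta u v X Y + eta u v Y Z + eta u v Z X.
  move=> S; apply: theta_eta; first exact: halfspaceS S hs.
  - move=> P Q /S/LS hP /S/LS hQ c0; split.
      by apply: gu => //; rewrite mem_cat ?hP ?hQ.
    by apply: gv => //; rewrite mem_cat ?hP ?hQ.
  - by move=> P /S/LS; exact: guv.
have := T (A - C) (B - C) (B - D); have := T (A - C) (B - D) (A - D).
move=> /(_ _)/[swap] /(_ _)/[swap] h1 h2.
rewrite [LHS](_ : _ = (theta u (A - C) (B - C) (B - D) - theta v (A - C) (B - C) (B - D))
  + (theta u (A - C) (B - D) (A - D) - theta v (A - C) (B - D) (A - D))); last by ring.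
rewrite h1; last by move=> x; rewrite !inE => /or3P[]->; rewrite ?orbT.
rewrite h2; last by move=> x; rewrite !inE => /or3P[]->; rewrite ?orbT.
rewrite (eta_sym u v (A - C) (B - D)) (eta_sym u v (A - D) (B - D)).
rewrite (eta_sym u v (A - C) (A - D)); ring.
Qed.

End Generic.

Section Edges.
Variables (R : realType) (T : lmodType R).
Implicit Type s : seq T.

Lemma edges1 s : map fst (edges s) = s.
Proof. by rewrite -/unzip1 unzip1_zip // size_rot. Qed.

Lemma edges2 s : map snd (edges s) = rot 1 s.
Proof. by rewrite -/unzip2 unzip2_zip // size_rot. Qed.

Lemma mem_edges s e : e \in edges s -> e.1 \in s /\ e.2 \in s.
Proof.
move=> h; split; first by rewrite -[X in _ \in X]edges1 map_f.
by rewrite -(mem_rot 1) -edges2 map_f.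
Qed.

Lemma sum_edges1 (V : nmodType) s (F : T -> V) :
  \sum_(e <- edges s) F e.1 = \sum_(x <- s) F x.
Proof. by rewrite -[in RHS](edges1 s) big_map. Qed.

Lemma sum_edges2 (V : nmodType) s (F : T -> V) :
  \sum_(e <- edges s) F e.2 = \sum_(x <- s) F x.
Proof.
rewrite -(big_map snd predT F) edges2; apply: perm_big.
by rewrite perm_rot.
Qed.
End Edges.

(** * Separating planes and independence of the direction *)

Section Separation.
Variable R : realType.
Notation space := 'rV[R]_3.
Implicit Types (u v w n X Y Z A B C D E : space) (L N s o : seq space).

Lemma gordan_false L : (forall k, 0 < k -> comb L 0 k -> False) -> halfspace L.
Proof. by case: (gordan L) => // -[k k0 hk] h; have := h _ k0 hk. Qed.

(** A vanishing combination of the corners, divided by its total weight, regroups as a point of AB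
    minus a point of CD. *)
Lemma sep_segments A B C D : segment A B `&` segment C D = set0 ->
  halfspace [:: A - C; B - C; B - D; A - D].
Proof.
move=> h; apply: gordan_false => k k0 /= [a a0 [b b0 [c c0 [d d0 [/rowP e1 e2]]]]].
suff : (segment A B `&` segment C D) (((a + d) / k) *: A + ((b + c) / k) *: B).
  by rewrite h.
have kn : k != 0 by rewrite gt_eqF.
split.
- exists ((b + c) / k); split.
    by rewrite divr_ge0 ?addr_ge0 ?(ltW k0) //= ler_pdivrMr // mul1r; lra.
  congr (_ *: _ + _); apply: (mulIf kn); rewrite /= mulrBl !divfK // mul1r; lra.
- exists ((c + d) / k); split.
    by rewrite divr_ge0 ?addr_ge0 ?(ltW k0) //= ler_pdivrMr // mul1r; lra.
  apply/rowP => i; have := e1 i; rewrite !mxE => {}e1.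
  have {}e2 : k = a + b + c + d by lra.
  apply: subr0_eq; move/(congr1 (fun x => - x / k)): e1; rewrite oppr0 mul0r => <-.
  by rewrite e2 in kn *; field.
Qed.

Lemma sep_triangle A B C D E : triangle A B C `&` segment D E = set0 ->
  halfspace [:: A - D; B - D; C - D; A - E; B - E; C - E].
Proof.
move=> h; apply: gordan_false => k k0 /= [a a0 [b b0 [c c0 [a' a0' [b' b0' [c' c0' [/rowP e1 e2]]]]]]].
suff : (triangle A B C `&` segment D E)
  (((a + a') / k) *: A + ((b + b') / k) *: B + ((c + c') / k) *: C) by rewrite h.
have kn : k != 0 by rewrite gt_eqF.
have {}e2 : k = a + b + c + a' + b' + c' by lra.
split.
- exists ((a + a') / k), ((b + b') / k), ((c + c') / k); split=> //;
    rewrite ?divr_ge0 ?addr_ge0 ?(ltW k0) //.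
  by rewrite -!mulrDl [X in X / k](_ : _ = k) ?divff //; lra.
- exists ((a' + b' + c') / k); split.
    by rewrite divr_ge0 ?addr_ge0 ?(ltW k0) //= ler_pdivrMr // mul1r; lra.
  apply/rowP => i; have := e1 i; rewrite !mxE => {}e1.
  apply: subr0_eq; move/(congr1 (fun x => - x / k)): e1; rewrite oppr0 mul0r => <-.
  by rewrite e2 in kn *; field.
Qed.

Lemma theta_neg n u X Y Z : 0 < dot n X -> 0 < dot n Y -> 0 < dot n Z ->
  dot n u < 0 -> theta u X Y Z = 0.
Proof.
move=> hX hY hZ hu.
have lin : det3 Y Z u * dot n X + det3 Z X u * dot n Y + det3 X Y u * dot n Z
             = det3 X Y Z * dot n u by rewrite !dotE /det3; ring.
rewrite /theta /tri; case: ifP => [/and4P[a b c d]|_].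
  have p1 := mulr_gt0 a hX; have p2 := mulr_gt0 b hY; have p3 := mulr_gt0 c hZ.
  have p4 : det3 X Y Z * dot n u < 0 by rewrite pmulr_rlt0.
  by rewrite -lin ltNge !addr_ge0 ?ltW in p4.
case: ifP => // /and4P[a b c d].
have p1 : det3 Y Z u * dot n X < 0 by rewrite pmulr_llt0.
have p2 : det3 Z X u * dot n Y < 0 by rewrite pmulr_llt0.
have p3 : det3 X Y u * dot n Z < 0 by rewrite pmulr_llt0.
have p4 : 0 < det3 X Y Z * dot n u by rewrite nmulr_rgt0.
by rewrite -lin ltNge ltW // in p4; lra.
Qed.

Lemma quad_neg n u A B C D :
  (forall X, X \in [:: A - C; B - C; B - D; A - D] -> 0 < dot n X) ->
  dot n u < 0 -> quad u A B C D = 0.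
Proof.
move=> h hu; rewrite /quad !(@theta_neg n) ?addr0 //; apply: h;
by rewrite !inE eqxx ?orbT.
Qed.

Lemma generic_neg n L : n != 0 -> exists v, generic_dir v L /\ dot n v < 0.
Proof.
move=> n0; have [w [e0 [_ e0_gt0 he]]] := generic_dir_near L [::] (- n).
have [//|e1 e1_gt0 he1] := @small_pos R _ [:: n] (fun=> dot n n) (fun=> - dot n w).
  by move=> _ _; exact: dot_gt0.
have m0 : 0 < Num.min e0 e1 by rewrite lt_min e0_gt0.
have [m1 m2] : Num.min e0 e1 <= e0 /\ Num.min e0 e1 <= e1.
  by rewrite !ge_min !lexx orbT.
exists (- n + (Num.min e0 e1 / 2) *: w); split; first by apply: he; lra.
have := he1 (Num.min e0 e1 / 2) n; rewrite mem_head dotDr dotNr dotZr => h.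
have {}h : 0 < dot n n + Num.min e0 e1 / 2 * - dot n w by apply: h => //; lra.
lra.
Qed.

(** [theta_eta] compares two directions only when no [X] lies in their plane; a third direction [w],
    generic with respect to both, links any two. *)
Lemma dir_indep L (F : space -> int) : (forall X, X \in L -> X != 0) ->
  (forall u v, generic_dir u L -> generic_dir v L ->
     (forall X, X \in L -> det3 u v X != 0) -> F u = F v) ->
  forall u v, generic_dir u L -> generic_dir v L -> F u = F v.
Proof.
move=> L0 h u v gu gv.
have [w [gw hw]] := generic_dir_exists L ([seq cross u X | X <- L] ++ [seq cross v X | X <- L]).
have aux z : generic_dir z L -> {subset [seq cross z X | X <- L] <= [seq cross u X | X <- L] ++ [seq cross v X | X <- L]} ->
    F z = F w.
  move=> gz hz; apply: h => // X XL.
  have := hw (cross z X); rewrite hz ?map_f // (generic_dir_cross gz XL (L0 _ XL)).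
  move=> /(_ isT isT); rewrite dot_cross.
  by rewrite (_ : det3 z w X = - det3 z X w) ?oppr_eq0 // /det3; ring.
by rewrite !aux // => x hx; rewrite mem_cat hx ?orbT.
Qed.

End Separation.

(** * The linking number and its isotopy invariance *)

Section LinkingNumber.
Variable R : realType.
Notation space := 'rV[R]_3.
Implicit Types (u v w n X Y Z A B C D E : space) (L N s o t : seq space).

Definition diffs s o : seq space := [seq X - Y | X <- s, Y <- o].

Lemma diffsP s o X Y : X \in s -> Y \in o -> X - Y \in diffs s o.
Proof. exact: allpairs_f. Qed.

Definition lkd u s o : int :=
  \sum_(e <- edges s) \sum_(f <- edges o) quad u e.1 e.2 f.1 f.2.

Definition apart s o : Prop := forall e f, e \in edges s -> f \in edges o ->
  halfspace [:: e.1 - f.1; e.2 - f.1; e.2 - f.2; e.1 - f.2].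

Lemma apart_neq0 s o X : apart s o -> X \in diffs s o -> X != 0.
Proof.
move=> h /allpairsP[[A B] /= [As Bo ->]].
have /mapP[e he ->] : A \in map fst (edges s) by rewrite edges1.
have /mapP[f hf ->] : B \in map fst (edges o) by rewrite edges1.
have [n hn] := h e f he hf.
by have := hn (e.1 - f.1); rewrite mem_head => /(_ isT); apply: contraTneq => ->; rewrite dot0r ltxx.
Qed.

Lemma lkd_indep s o u v : apart s o -> generic_dir u (diffs s o) ->
  generic_dir v (diffs s o) -> lkd u s o = lkd v s o.
Proof.
move=> hso; apply: (@dir_indep R (diffs s o) (fun u => lkd u s o)) => [X|].
  exact: apart_neq0.
move=> {}u {}v gu gv guv.
apply/eqP; rewrite -subr_eq0 /lkd -sumrB.
(* The terms are grouped so that each bracket is a function of one end of an edge minus the same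
   function of the other end: for the ends of [f] first, for those of [e] next. Such differences sum
   to zero around a closed line. *)
rewrite (eq_big_seq (fun e => \sum_(f <- edges o)
   ((eta u v (e.1 - f.1) (e.2 - f.1) - eta u v (e.1 - f.2) (e.2 - f.2))
    - (eta u v (e.1 - f.1) (e.1 - f.2) - eta u v (e.2 - f.1) (e.2 - f.2))))); last first.
  move=> e he; rewrite -sumrB; apply: eq_big_seq => f hf.
  rewrite (@quad_eta _ (diffs s o)) //; first by ring.
  - have [? ?] := mem_edges he; have [? ?] := mem_edges hf.
    by move=> x; rewrite !inE => /or4P[] /eqP->; apply: diffsP.
  - exact: hso.
under eq_bigr do rewrite sumrB.
rewrite sumrB; apply/eqP; rewrite [X in X - _]big1 ?sub0r; last first.
  move=> e _; rewrite sumrB (sum_edges1 o (fun c => eta u v (e.1 - c) (e.2 - c))).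
  by rewrite (sum_edges2 o (fun c => eta u v (e.1 - c) (e.2 - c))) subrr.
apply/eqP; rewrite oppr_eq0 exchange_big /= big1 // => f _; rewrite sumrB.
rewrite (sum_edges1 s (fun c => eta u v (c - f.1) (c - f.2))).
by rewrite (sum_edges2 s (fun c => eta u v (c - f.1) (c - f.2))) subrr.
Qed.

(** The [0] is only the default of [xget]: generic directions exist, and for disjoint lines they all
    give the same value. *)
Definition lkn s o : int :=
  lkd (xget 0 [set u | generic_dir u (diffs s o)]) s o.

Lemma lknE u s o : apart s o -> generic_dir u (diffs s o) -> lkn s o = lkd u s o.
Proof.
move=> hso gu; apply: lkd_indep => //.
by case: xgetP => [x _ //|h]; have := h u.
Qed.

Lemma generic_dirS u L N : {subset L <= N} -> generic_dir u N -> generic_dir u L.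
Proof.
move=> LN g X Y hX hY; apply: g.
  by move: hX; rewrite !mem_cat => /orP[/LN->|->]; rewrite ?orbT.
by move: hY; rewrite !mem_cat => /orP[/LN->|->]; rewrite ?orbT.
Qed.

Lemma generic_dirN u L N : (forall X, X \in L -> - X \in N) -> generic_dir u N ->
  generic_dir (- u) L.
Proof.
move=> LN g X Y hX hY c0.
have aux Z : Z \in L ++ basis R -> exists2 Z', Z' \in N ++ basis R & Z' = Z \/ Z' = - Z.
  rewrite mem_cat => /orP[/LN h|h].
    by exists (- Z); [rewrite mem_cat h|right].
  by exists Z; [rewrite mem_cat h orbT|left].
have [X' hX' eX] := aux _ hX; have [Y' hY' eY] := aux _ hY.
have cE : cross X' Y' = cross X Y \/ cross X' Y' = - cross X Y.
  by case: eX => ->; case: eY => ->; [left|right|right|left];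
    apply/rowP; apply: ord3P; rewrite !mxE /=; ring.
have : det3 X' Y' u != 0.
  apply: g => //; case: cE => -> //; by rewrite oppr_eq0.
have cN : det3 X Y (- u) = - dot (cross X Y) u by rewrite dot_cross /det3 !mxE; ring.
rewrite cN oppr_eq0 -dot_cross; case: cE => -> //.
by rewrite dotC dotNr oppr_eq0 dotC.
Qed.

(** Exchanging the edges applies the antipode to the parallelogram and swaps its two parameters;
    both reverse the orientation. *)
Lemma quad_swap u A B C D : quad (- u) C D A B = quad u A B C D.
Proof.
have T X Y Z : theta (- u) X Z Y = theta u (- X) (- Y) (- Z).
  have tsw (p q r d : R) : tri p q r d = tri p r q d.
    by rewrite /tri; case: (ltgtP p 0); case: (ltgtP q 0); case: (ltgtP r 0); case: (ltgtP d 0).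
  by rewrite /theta tsw; congr tri; rewrite /det3 !mxE; ring.
by rewrite /quad addrC !T !opprB.
Qed.

Lemma lkd_swap u s o : lkd (- u) o s = lkd u s o.
Proof.
rewrite /lkd exchange_big /=; do 2 (apply: eq_bigr => ? _); exact: quad_swap.
Qed.

Lemma apart_sym s o : apart s o -> apart o s.
Proof.
move=> h e f he hf; have [n hn] := h f e hf he; exists (- n) => X.
have E Y : dot (- n) Y = dot n (- Y) by rewrite dotC dotNr dotNr dotC.
by rewrite E !inE => /or4P[] /eqP->; rewrite opprB; apply: hn; rewrite !inE eqxx ?orbT.
Qed.

Lemma lkn_sym s o : apart s o -> lkn s o = lkn o s.
Proof.
move=> hso; have [u [gu _]] := generic_dir_exists (diffs s o) [::].
rewrite (lknE hso gu) (@lknE (- u)) ?lkd_swap //; first exact: apart_sym.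
apply: generic_dirN gu => X /allpairsP[[A B] /= [As Bo ->]].
by rewrite opprB; apply: diffsP.
Qed.

End LinkingNumber.

Section EdgesRot.
Variables (R : realType) (T : lmodType R).
Implicit Type s : seq T.

Lemma zip_rot (S1 S2 : Type) m (s : seq S1) (t : seq S2) : size s = size t ->
  zip (rot m s) (rot m t) = rot m (zip s t).
Proof.
move=> st; rewrite /rot zip_cat ?size_drop ?st //.
congr (_ ++ _).
  elim: m s t st => [|m IH] [|a s] [|b t] //= [st].
  exact: IH.
elim: m s t st => [|m IH] [|a s] [|b t] //= [st].
by rewrite IH.
Qed.

Lemma edges_rot m s : edges (rot m s) = rot m (edges s).
Proof. by rewrite /edges rot_rot zip_rot // size_rot. Qed.

Lemma mem_edges_rot m s : edges (rot m s) =i edges s.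
Proof. by move=> e; rewrite edges_rot mem_rot. Qed.

Definition arcs (x : T) s (y : T) : seq (T * T) := zip (x :: s) (rcons s y).

Lemma edges_cons x s : edges (x :: s) = arcs x s x.
Proof. by rewrite /edges rot1_cons. Qed.

Lemma arcs_cons x a s y : arcs x (a :: s) y = (x, a) :: arcs a s y.
Proof. by []. Qed.

Lemma carrier_rot m s : carrier (rot m s) = carrier s.
Proof.
by apply/seteqP; split=> x [e he hx]; exists e => //; move: he; rewrite mem_edges_rot.
Qed.

End EdgesRot.

(** * Invariance under elementary moves *)

Section Isotopy.
Variable R : realType.
Notation space := 'rV[R]_3.
Implicit Types (u v w n X Y Z A B C D E : space) (L N s o t : seq space).

Lemma lkd_rotl u m s o : lkd u (rot m s) o = lkd u s o.
Proof. by rewrite /lkd; apply: perm_big; rewrite edges_rot perm_rot. Qed.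

Lemma lkn_rotl m s o : apart s o -> lkn (rot m s) o = lkn s o.
Proof.
move=> h; have [u [gu _]] := generic_dir_exists (diffs s o) [::].
rewrite (lknE h gu) (@lknE _ u) ?lkd_rotl //.
  by move=> e f; rewrite mem_edges_rot; exact: h.
apply: generic_dirS gu => X /allpairsP[[A B] /= [As Bo ->]].
by apply: diffsP => //; rewrite -(mem_rot m).
Qed.

Lemma segment_ends A B : segment A B A /\ segment A B B.
Proof.
split; [exists 0|exists 1]; rewrite ?lexx ler01; split=> //.
  by rewrite subr0 scale1r scale0r addr0.
by rewrite subrr scale1r scale0r add0r.
Qed.

Lemma carrier_apart s o : carrier s `&` carrier o = set0 -> apart s o.
Proof.
move=> h e f he hf; apply: sep_segments; apply/seteqP; split=> // x [xe xf].
by rewrite -h; split; [exists e|exists f].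
Qed.

(* The lateral faces of the prism [ABC - f] and its two bases form a closed    *)
(* surface which does not meet the origin.                                     *)
Lemma prism u L A B C D E :
  halfspace [:: A - D; C - D; B - D; A - E; C - E; B - E] ->
  generic_dir u L -> {subset [:: A - D; C - D; B - D; A - E; C - E; B - E] <= L} ->
  (forall X, X \in L -> X != 0) ->
  quad u A C D E + quad u C B D E - quad u A B D E =
  theta u (A - D) (C - D) (B - D) - theta u (A - E) (C - E) (B - E).
Proof.
move=> hs gu LS L0; have [n hn] := hs.
have n0 : n != 0.
  apply/eqP => n0; have := hn (A - D); rewrite mem_head n0 => /(_ isT).
  by rewrite dotC dot0r ltxx.
have [v [gv nv]] := generic_neg L n0.
pose F u := quad u A C D E + quad u C B D E - quad u A B D E
  - (theta u (A - D) (C - D) (B - D) - theta u (A - E) (C - E) (B - E)).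
suff : F u = 0 by move/subr0_eq.
have -> : F u = F v; last first.
  rewrite /F !(@quad_neg _ n) ?(@theta_neg _ n) //; try by apply: hn; rewrite !inE eqxx ?orbT.
  - by move=> X h; apply: hn; move: h; rewrite !inE => /or4P[]->; rewrite ?orbT.
  - by move=> X h; apply: hn; move: h; rewrite !inE => /or4P[]->; rewrite ?orbT.
  - by move=> X h; apply: hn; move: h; rewrite !inE => /or4P[]->; rewrite ?orbT.
apply: (dir_indep L0) gu gv => {n0 nv hn}{}u {}v gu gv guv; apply/eqP; rewrite -subr_eq0.
have Q P P' : P \in [:: A; B; C] -> P' \in [:: A; B; C] ->
    quad u P P' D E - quad v P P' D E =
    eta u v (P - D) (P' - D) - eta u v (P - E) (P' - E)
    - eta u v (P - D) (P - E) + eta u v (P' - D) (P' - E).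
  move=> hP hP'.
  have S : {subset [:: P - D; P' - D; P' - E; P - E] <= [:: A - D; C - D; B - D; A - E; C - E; B - E]}.
    move=> x; move: hP hP'; rewrite !inE => /or3P[]/eqP-> /or3P[]/eqP-> /or4P[]/eqP->;
    by rewrite eqxx ?orbT.
  apply: (quad_eta gu gv guv); last exact: halfspaceS S hs.
  by move=> x /S/LS.
have T X Y Z : {subset [:: X; Y; Z] <= [:: A - D; C - D; B - D; A - E; C - E; B - E]} ->
    theta u X Y Z - theta v X Y Z = eta u v X Y + eta u v Y Z + eta u v Z X.
  move=> S; apply: theta_eta; first exact: halfspaceS S hs.
  - move=> P P' /S/LS hP /S/LS hP' c0; split.
      by apply: gu => //; rewrite mem_cat ?hP ?hP'.
    by apply: gv => //; rewrite mem_cat ?hP ?hP'.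
  - by move=> P /S/LS; exact: guv.
rewrite /F [X in X == 0](_ : _ =
   (quad u A C D E - quad v A C D E) + (quad u C B D E - quad v C B D E)
   - (quad u A B D E - quad v A B D E)
   - (theta u (A - D) (C - D) (B - D) - theta v (A - D) (C - D) (B - D))
   + (theta u (A - E) (C - E) (B - E) - theta v (A - E) (C - E) (B - E))); last by ring.
rewrite !Q ?inE ?eqxx ?orbT // !T; last first.
- by move=> x; rewrite !inE => /or3P[]->; rewrite ?orbT.
- by move=> x; rewrite !inE => /or3P[]->; rewrite ?orbT.
by rewrite (eta_sym u v (A - D) (B - D)) (eta_sym u v (A - E) (B - E)); apply/eqP; ring.
Qed.

Lemma triangleAC A B C : triangle A B C = triangle A C B.
Proof.
by apply/seteqP; split=> x [a [b [c [a0 b0 c0 s1 ->]]]];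
  exists a, c, b; split=> //; by [rewrite addrAC | exact: addrAC].
Qed.

(** By [prism], an edge of [o] contributes the difference of the bases at its two ends, and these
    differences cancel around [o]. *)
Lemma lkn_triangle A B C t o :
  apart [:: A, C, B & t] o -> apart [:: A, B & t] o ->
  triangle A B C `&` carrier o = set0 ->
  lkn [:: A, C, B & t] o = lkn [:: A, B & t] o.
Proof.
move=> h1 h2 h3; have [u [gu _]] := generic_dir_exists (diffs [:: A, C, B & t] o) [::].
rewrite (lknE h1 gu) (lknE h2 (u := u)); last first.
  apply: generic_dirS gu => X /allpairsP[[P Q] /= [Ps Qo ->]].
  by apply: diffsP => //; move: Ps; rewrite !inE => /or3P[]->; rewrite ?orbT.
apply/eqP; rewrite -subr_eq0 /lkd !edges_cons !arcs_cons !big_cons /=.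
have E (a b c d : int) : a + (b + d) - (c + d) = a + b - c by ring.
rewrite E.
rewrite -big_split -sumrB /=.
rewrite (eq_big_seq (fun f => theta u (A - f.1) (C - f.1) (B - f.1)
   - theta u (A - f.2) (C - f.2) (B - f.2))); last first.
  move=> f hf; have [hf1 hf2] := mem_edges hf.
  apply: (@prism _ (diffs [:: A, C, B & t] o)) => //.
  - apply: sep_triangle; apply/seteqP; split=> // x [xt xf].
    by rewrite -h3 triangleAC; split => //; exists f.
  - by move=> X; rewrite !inE => /or4P[|||/or3P[]] /eqP->; apply: diffsP; rewrite ?inE ?eqxx ?orbT.
  - by move=> X; exact: apart_neq0.
rewrite sumrB (sum_edges1 o (fun c => theta u (A - c) (C - c) (B - c))).
by rewrite (sum_edges2 o (fun c => theta u (A - c) (C - c) (B - c))) subrr.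
Qed.

(** The minus sign fits the convention that clockwise crossings are positive: by [orient_det] a
    clockwise crossing has negative [det_edges], and it is the sign of [det_edges] that [lkn] adds
    up. *)
Definition lk (K : link2 R) : int := - lkn (comp1 K) (comp2 K).

Lemma link_apart (K : link2 R) : apart (comp1 K) (comp2 K).
Proof. exact/carrier_apart/comp_disjoint. Qed.
Arguments link_apart : clear implicits.

Lemma lkn_move s s' o : apart s o -> apart s' o -> carrier s `&` carrier o = set0 ->
  triangle_move s s' o -> lkn s o = lkn s' o.
Proof.
move=> h1 h2 hso [A [C [B [t [es es' ht]]]]]; rewrite es es' in h1 h2 hso ht *.
apply: lkn_triangle => //; apply/seteqP; split=> // x [xt xo].
have : ((carrier [:: A, C, B & t] `|` carrier o) `&` triangle A B C) x by split=> //; right.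
rewrite ht => hx; rewrite -hso; split=> //.
by case: hx => hx; [exists (A, C)|exists (C, B)]; rewrite // edges_cons !arcs_cons !inE eqxx ?orbT.
Qed.

Lemma lk_isotopic (K K' : link2 R) : isotopic K K' -> lk K = lk K'.
Proof.
elim=> {K K'} [K K' [[m [n [e1 e2]]]|[[h e]|[h e]]]|//|K K' _ ->//|K K' K'' _ -> _ //].
- have hK := link_apart K.
  have hn : apart (comp1 K) (rot n (comp2 K)) by move=> e f he; rewrite mem_edges_rot; exact: hK.
  rewrite /lk e1 e2; congr (- _); rewrite (lkn_rotl _ hn) (lkn_sym hn) lkn_rotl; last exact: apart_sym.
  exact: lkn_sym.
- rewrite /lk e; congr (- _); apply: lkn_move => //; first exact: link_apart.
    by rewrite -e; exact: link_apart.
  exact: comp_disjoint.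
- rewrite /lk; congr (- _); rewrite lkn_sym; last exact: link_apart.
  rewrite (lkn_sym (s := comp1 K')); last exact: link_apart.
  rewrite e; apply: lkn_move => //; try apply/apart_sym; try exact: link_apart.
    by rewrite -e; exact: link_apart.
  by rewrite setIC; exact: comp_disjoint.
Qed.

Lemma lk_trivial (K : link2 R) : trivial_link K -> lk K = 0.
Proof.
case=> _ _ [n [h1 [h2 [n0 h12 H1 H2]]]].
have aux m k : m != 0 -> 0 < k ->
    (forall X Y, X \in comp1 K -> Y \in comp2 K -> dot m (X - Y) = k) -> lk K = 0.
  move=> m0 k0 hm; have [v [gv nv]] := generic_neg (diffs (comp1 K) (comp2 K)) m0.
  rewrite /lk (lknE (link_apart K) gv) /lkd big_seq big1 ?oppr0 // => e he.
  rewrite big_seq big1 // => f hf; apply: (@quad_neg _ m) => // X.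
  have [? ?] := mem_edges he; have [? ?] := mem_edges hf.
  by rewrite !inE => /or4P[] /eqP->; rewrite hm.
have [h|h|h] := ltgtP h1 h2; last by rewrite h eqxx in h12.
- apply: (aux (- n) (h2 - h1)); rewrite ?oppr_eq0 ?subr_gt0 // => X Y /H1 e1 /H2 e2.
  by rewrite dotC dotNr dotC dotBr e1 e2 opprB.
- apply: (aux n (h1 - h2)); rewrite ?subr_gt0 // => X Y /H1 e1 /H2 e2.
  by rewrite dotBr e1 e2.
Qed.

End Isotopy.

Arguments link_apart [R] K.

(** * Projections and the diagram formula *)

Section Frames.
Variable R : realType.
Notation space := 'rV[R]_3.
Notation plane := 'rV[R]_2.
Implicit Types (u v w n X Y Z A B C D E : space) (M : 'M[R]_3).

Definition axis M : space := \row_i M i ord_max.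

Lemma mulmx3 v M j : (v *m M) 0 j = v 0 0 * M 0 j + v 0 1 * M 1 j + v 0 ord_max * M ord_max j.
Proof. by rewrite mxE big3. Qed.

Lemma heightE M v : height M v = dot v (axis M).
Proof. by rewrite /height mulmx3 dotE !mxE. Qed.

Lemma project0 M v : project M v 0 0 = (v *m M) 0 0.
Proof. by rewrite /project [LHS]mxE; congr ((v *m M) _ _); apply: val_inj. Qed.

Lemma project1 M v : project M v 0 1 = (v *m M) 0 1.
Proof. by rewrite /project [LHS]mxE; congr ((v *m M) _ _); apply: val_inj. Qed.

Lemma det33 M : \det M =
  M 0 0 * (M 1 1 * M ord_max ord_max - M 1 ord_max * M ord_max 1)
  - M 0 1 * (M 1 0 * M ord_max ord_max - M 1 ord_max * M ord_max 0)
  + M 0 ord_max * (M 1 0 * M ord_max 1 - M 1 1 * M ord_max 0).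
Proof.
rewrite (expand_det_row _ 0) big3 /cofactor !(expand_det_row _ ord0).
rewrite !big_ord_recl !big_ord0 /cofactor !det_mx11 !mxE /=.
have [f E] : exists f : nat -> nat -> R, forall i j : 'I_3, M i j = f i j.
  by exists (fun i j => M (inord i) (inord j)) => i j; rewrite !inord_val.
rewrite !E /= /bump /= !exprS !expr0; ring.
Qed.

Lemma det3_mul M X Y Z : det3 (X *m M) (Y *m M) (Z *m M) = \det M * det3 X Y Z.
Proof. rewrite det33 /det3 !mulmx3; ring. Qed.

Definition pcr (a c : plane) : R := a 0 0 * c 0 1 - a 0 1 * c 0 0.

Lemma axis_mul M : is_frame M -> axis M *m M = delta_mx 0 ord_max.
Proof.
case=> hM _; have -> : axis M = delta_mx 0 ord_max *m M^T.
  by rewrite -rowE; apply/rowP => i; rewrite !mxE.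
by rewrite -mulmxA hM mulmx1.
Qed.

(** [M] has determinant 1 and takes its axis to the third coordinate vector, so planar areas are
    volumes with the line of sight. *)
Lemma pcr_project M X Y : is_frame M -> pcr (project M X) (project M Y) = det3 X Y (axis M).
Proof.
move=> hM; rewrite -[RHS]mul1r -(proj2 hM) -det3_mul axis_mul //.
rewrite /pcr !project0 !project1 /det3 !mxE /=; ring.
Qed.

Lemma project_lin M (a b : R) X Y :
  project M (a *: X + b *: Y) = a *: project M X + b *: project M Y.
Proof. by rewrite /project mulmxDl -!scalemxAl linearD !linearZ. Qed.

Lemma projectB M X Y : project M (X - Y) = project M X - project M Y.
Proof. by rewrite /project mulmxBl linearB. Qed.

Lemma orient_project M X Y Z : is_frame M ->
  orient (project M X) (project M Y) (project M Z) = det3 (Y - X) (Z - X) (axis M).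
Proof.
by move=> hM; rewrite -pcr_project // !projectB /orient /pcr !mxE.
Qed.

Lemma project_axis M X Y : is_frame M -> project M X = project M Y ->
  X - Y = (height M X - height M Y) *: axis M.
Proof.
move=> hM /rowP h; have := h 0; have := h 1; rewrite !project0 !project1 => h1 h0.
have MM : M *m M^T = 1%:M by apply: mulmx1C; case: hM.
have e : (X - Y) *m M = ((height M X - height M Y) *: axis M) *m M.
  rewrite -scalemxAl axis_mul // mulmxBl /height.
  move: (X *m M) (Y *m M) h0 h1 => x y h0 h1.
  by apply/rowP; apply: ord3P; rewrite !mxE /= ?h0 ?h1 ?mulr1 ?mulr0 ?subrr.
by rewrite -[LHS]mulmx1 -MM mulmxA e -mulmxA MM mulmx1.
Qed.

Lemma axis_norm M : is_frame M -> dot (axis M) (axis M) = 1.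
Proof.
move=> hM; rewrite -heightE /height axis_mul // mxE //.
Qed.

End Frames.

(** * Planar counts that are additive under subdivision *)

Section PlanarCount.
Variable R : realType.
Notation plane := 'rV[R]_2.
Implicit Types (A B C D X w : plane) (e f : plane * plane) (s L o : seq plane).

Lemma ord2P (P : 'I_2 -> Prop) : P 0 -> P 1 -> forall i, P i.
Proof.
move=> P0 P1 [[|[|//]] i].
- by rewrite (_ : Ordinal i = 0) //; apply/val_inj.
- by rewrite (_ : Ordinal i = 1) //; apply/val_inj.
Qed.

Definition halfopen (b : bool) (s : R) : bool :=
  if b then 0 <= s < 1 else 0 < s <= 1.

Definition det_edges e f : R := pcr (f.2 - f.1) (e.2 - e.1).

(* When [e] and [f] are not parallel, their lines meet at the point of         *)
(* parameter [crosspar e f] on [e].                                            *)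
Definition crosspar e f : R := pcr (e.1 - f.1) (f.2 - f.1) / det_edges e f.

Definition crosspoint e f : plane := e.1 + crosspar e f *: (e.2 - e.1).

(* The contribution of two edges to the count of the crossings where [ov]      *)
(* holds.  Which end points of the edges are included is decided by the        *)
(* direction [w], so that the count is additive under subdivision.             *)
Definition crosscount (ov : plane -> Prop) w e f : int :=
  if [&& det_edges e f != 0,
         halfopen (0 < pcr (f.2 - f.1) w * det_edges e f) (crosspar e f),
         halfopen (0 < pcr (e.2 - e.1) w * det_edges e f) (crosspar f e) &
         `[< ov (crosspoint e f) >] ]
  then sgz (det_edges e f) else 0.

Lemma det_edges_sym e f : det_edges f e = - det_edges e f.
Proof. by rewrite /det_edges /pcr; ring. Qed.

Lemma pcrNr A B : pcr A (- B) = - pcr A B.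
Proof. by rewrite /pcr !mxE; ring. Qed.

Lemma pcrZl k A B : pcr (k *: A) B = k * pcr A B.
Proof. by rewrite /pcr !mxE; ring. Qed.

Lemma crosspoint_sym e f : det_edges e f != 0 -> crosspoint f e = crosspoint e f.
Proof.
move=> D0; have key i : (e.1 0 i - f.1 0 i) * det_edges e f
    + pcr (e.1 - f.1) (f.2 - f.1) * (e.2 0 i - e.1 0 i)
    + pcr (f.1 - e.1) (e.2 - e.1) * (f.2 0 i - f.1 0 i) = 0.
  by move: i; rewrite /det_edges /pcr; apply: ord2P; rewrite !mxE; ring.
apply/rowP => i; rewrite /crosspoint /crosspar det_edges_sym !mxE.
move/(congr1 (fun x => - x / det_edges e f)): (key i); rewrite oppr0 mul0r => k0.
by apply: subr0_eq; rewrite -[RHS]k0; field.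
Qed.

(** The choice of end points amounts to displacing [f] by a small positive multiple of [w], or [e]
    by the opposite vector; this is why [w] changes sign. *)
Lemma crosscount_sym ov w e f : crosscount ov (- w) f e = - crosscount ov w e f.
Proof.
rewrite /crosscount det_edges_sym oppr_eq0 !pcrNr !mulrNN sgzN.
have [D0|D0] := eqVneq (det_edges e f) 0; first by rewrite oppr0.
by rewrite crosspoint_sym //= andbCA; case: ifP; rewrite ?oppr0.
Qed.

Definition split_additive (G : plane -> plane -> int) : Prop :=
  forall A B C, A != B -> open_segment A B C -> G A B = G A C + G C B.

Lemma halfopen_split b (s k : R) : 0 < k < 1 ->
  (halfopen b s = halfopen b (s / k) (+) halfopen b ((s - k) / (1 - k))) /\
  ~~ (halfopen b (s / k) && halfopen b ((s - k) / (1 - k))).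
Proof.
move=> /andP[k0 k1]; have k2 : 0 < 1 - k by lra.
rewrite /halfopen; case: b.
- rewrite !ler_pdivlMr // !ltr_pdivrMr // !mul0r !mul1r.
  rewrite subr_ge0 ltrD2r.
  by case: (leP 0 s) => h1; case: (ltP s k) => h2; case: (ltP s 1) => h3 //=; lra.
- rewrite !ltr_pdivlMr // !ler_pdivrMr // !mul0r !mul1r.
  rewrite subr_gt0 lerD2r.
  by case: (ltP 0 s) => h1; case: (leP s k) => h2; case: (leP s 1) => h3 //=; lra.
Qed.

(** Both halves of AB keep the direction of AB, hence the same end-point convention, so a crossing
    at [C] is counted in exactly one of them. The crossing point and its parameter on [f] do not
    change. *)
Lemma crosscount_additive1 ov w f :
  split_additive (fun A B => crosscount ov w (A, B) f).
Proof.
move=> A B C AB [k [hk ->]] /=; have /andP[k0 k1] := hk.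
have kn : k != 0 by rewrite gt_eqF.
have kn1 : 1 - k != 0 by rewrite gt_eqF // subr_gt0.
set C' := (1 - k) *: A + k *: B.
have eA : C' - A = k *: (B - A) by apply/rowP => i; rewrite !mxE; ring.
have eB : B - C' = (1 - k) *: (B - A) by apply/rowP => i; rewrite !mxE; ring.
have dA : det_edges (A, C') f = k * det_edges (A, B) f.
  by rewrite /det_edges /= eA /pcr !mxE; ring.
have dB : det_edges (C', B) f = (1 - k) * det_edges (A, B) f.
  by rewrite /det_edges /= eB /pcr !mxE; ring.
rewrite /crosscount dA dB !mulf_eq0 (negPf kn) (negPf kn1) /=.
have [//|D0] := eqVneq (det_edges (A, B) f) 0.
have sA : crosspar (A, C') f = crosspar (A, B) f / k.
  by rewrite /crosspar dA /=; field; rewrite ?kn ?D0.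
have sB : crosspar (C', B) f = (crosspar (A, B) f - k) / (1 - k).
  rewrite /crosspar dB /=; apply: (canLR (mulfK _)); first by rewrite mulf_neq0.
  rewrite [RHS](_ : _ = pcr (A - f.1) (f.2 - f.1) - k * det_edges (A, B) f); last first.
    by field; rewrite ?kn1 ?D0.
  by rewrite /det_edges /pcr /= !mxE; ring.
have D1 : det_edges f (A, B) != 0 by rewrite det_edges_sym oppr_eq0.
have tA : crosspar f (A, C') = crosspar f (A, B).
  by rewrite /crosspar !(det_edges_sym _ f) dA /= eA /pcr !mxE; field; rewrite ?kn ?D0.
have tB : crosspar f (C', B) = crosspar f (A, B).
  rewrite /crosspar !(det_edges_sym _ f) dB /= eB; apply: (canLR (mulfK _)).
    by rewrite oppr_eq0 mulf_neq0.
  rewrite [RHS](_ : _ = (1 - k) * pcr (f.1 - A) (B - A)); last by field; rewrite D0.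
  by rewrite /pcr !mxE; ring.
have pA : crosspoint (A, C') f = crosspoint (A, B) f.
  by rewrite /crosspoint sA /= eA scalerA divfK.
have pB : crosspoint (C', B) f = crosspoint (A, B) f.
  by rewrite /crosspoint sB /= eB scalerA divfK //; apply/rowP => i; rewrite !mxE; ring.
rewrite sA sB tA tB pA pB /= eA eB !pcrZl.
have pos (z x y : R) : 0 < z -> (0 < x * (z * y)) = (0 < x * y).
  by move=> z0; rewrite mulrCA pmulr_rgt0.
have pos2 (z x y : R) : 0 < z -> (0 < z * x * y) = (0 < x * y).
  by move=> z0; rewrite -mulrA pmulr_rgt0.
have k2 : 0 < 1 - k by lra.
rewrite !pos // !pos2 // !sgzM (gtr0_sgz k0) (gtr0_sgz k2) !mul1r.
have [hb] := halfopen_split (0 < pcr (f.2 - f.1) w * det_edges (A, B) f) (crosspar (A, B) f) hk.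
rewrite hb; move: (halfopen _ (_ / k)) (halfopen _ (_ / (1 - k))) => b1 b2.
by case: b1; case: b2 => //= _; rewrite ?addr0 ?add0r.
Qed.

Lemma crosscount_additive2 ov w e :
  split_additive (fun A B => crosscount ov w e (A, B)).
Proof.
move=> A B C AB hC; apply: oppr_inj; rewrite opprD -!(crosscount_sym ov w e).
exact: crosscount_additive1.
Qed.

(** Summed over a closed line, this is the number of its passages through [X]; being additive, it is
    the same for a diagram and for the projected link that subdivides it. *)
Definition onhalf X A B : int := if `[< half_open_segment A B X >] then 1 else 0.

Lemma segment_paramE n (A B X : 'rV[R]_n) (k k' : R) : A != B ->
  X = (1 - k) *: A + k *: B -> X = (1 - k') *: A + k' *: B -> k = k'.
Proof.
move=> AB -> /eqP; rewrite -subr_eq0 => /eqP h.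
have : (k' - k) *: (A - B) = 0 by rewrite -h; apply/rowP => i; rewrite !mxE; ring.
by move/eqP; rewrite scaler_eq0 [A - B == 0]subr_eq0 (negPf AB) orbF subr_eq0 => /eqP.
Qed.

Lemma onhalf_additive X : split_additive (onhalf X).
Proof.
move=> A B C AB [k [/andP[k0 k1] eC]].
have k2 : 0 < 1 - k by lra.
have h1 : half_open_segment A C X <-> exists2 t, 0 <= t < k & X = (1 - t) *: A + t *: B.
  split=> [[t [/andP[t0 t1] ->]]|[t /andP[t0 t1] ->]].
    exists (t * k); first by rewrite mulr_ge0 ?(ltW k0) // gtr_pMl.
    by rewrite eC; apply/rowP => i; rewrite !mxE; ring.
  exists (t / k); split; first by rewrite divr_ge0 ?(ltW k0) //= ltr_pdivrMr ?mul1r.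
  by rewrite eC; apply/rowP => i; rewrite !mxE; field; rewrite gt_eqF.
have h2 : half_open_segment C B X <-> exists2 t, k <= t < 1 & X = (1 - t) *: A + t *: B.
  split=> [[t [/andP[t0 t1] ->]]|[t /andP[t0 t1] ->]].
    exists (k + t * (1 - k)); first by rewrite lerDl mulr_ge0 ?(ltW k2) //=; nra.
    by rewrite eC; apply/rowP => i; rewrite !mxE; ring.
  exists ((t - k) / (1 - k)); split.
    by rewrite divr_ge0 ?subr_ge0 ?(ltW k1) //= ltr_pdivrMr // mul1r ltrD2r.
  by rewrite eC; apply/rowP => i; rewrite !mxE; field; rewrite gt_eqF.
rewrite /onhalf; case: asboolP => [[t [/andP[t0 t1] eX]]|h].
  have [tk|tk] := ltP t k.
    rewrite (asboolT (proj2 h1 _)); last by exists t; rewrite ?t0.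
    rewrite asboolF ?addr0 // => /h2[t' /andP[t0' _] eX'].
    by rewrite (segment_paramE AB eX eX') ltNge t0' in tk.
  rewrite (asboolT (proj2 h2 _)); last by exists t; rewrite ?tk.
  rewrite asboolF ?add0r // => /h1[t' /andP[_ t1'] eX'].
  by rewrite (segment_paramE AB eX eX') leNgt t1' in tk.
rewrite !asboolF ?addr0 //.
  by move=> /h2[t /andP[t0 t1] eX]; apply: h; exists t; rewrite t1 (le_trans _ t0) // ltW.
by move=> /h1[t /andP[t0 t1] eX]; apply: h; exists t; rewrite t0 (lt_trans t1).
Qed.

Lemma subdivides_sum L s (G : plane -> plane -> int) : split_additive G ->
  subdivides L s -> \sum_(e <- edges s) G e.1 e.2 = \sum_(e <- edges L) G e.1 e.2.
Proof.
move=> hG; elim=> [//|m t _ <-|A C B t AB hC _ <-].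
  by apply: perm_big; rewrite edges_rot perm_rot.
by rewrite !edges_cons !arcs_cons !big_cons /= (hG _ _ _ AB hC) addrA.
Qed.

Lemma subdivides_neq L s : (forall e, e \in edges L -> e.1 != e.2) ->
  subdivides L s -> forall e, e \in edges s -> e.1 != e.2.
Proof.
move=> hL; elim=> [//|m t _ IH e|A C B t AB hC _ IH e]; first by rewrite mem_edges_rot; exact: IH.
move: IH; rewrite !edges_cons !arcs_cons => IH.
case: hC => k [/andP[k0 k1] eC].
have AB0 : A - B != 0 by rewrite subr_eq0.
rewrite !inE => /or3P[/eqP->|/eqP->|h] /=; last by apply: IH; rewrite inE h orbT.
- rewrite -subr_eq0 eC [X in X != 0](_ : _ = k *: (A - B)).
    by rewrite scaler_eq0 negb_or gt_eqF.
  by apply/rowP => i; rewrite !mxE; ring.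
- rewrite -subr_eq0 eC [X in X != 0](_ : _ = (1 - k) *: (A - B)).
    by rewrite scaler_eq0 negb_or gt_eqF // subr_gt0.
  by apply/rowP => i; rewrite !mxE; ring.
Qed.

Lemma subdivides_sub L s : subdivides L s -> forall e, e \in edges s ->
  exists2 f, f \in edges L & segment e.1 e.2 `<=` segment f.1 f.2.
Proof.
elim=> [e he|m t _ IH e|A C B t AB hC _ IH e]; first by exists e.
  by rewrite mem_edges_rot; exact: IH.
move: IH; rewrite !edges_cons !arcs_cons => IH.
have [f hf hs] : exists2 f, f \in edges L & segment A B `<=` segment f.1 f.2.
  by apply: (IH (A, B)); rewrite mem_head.
case: hC => k [/andP[k0 k1] eC].
rewrite !inE => /or3P[/eqP->|/eqP->|h] /=; last by apply: IH; rewrite inE h orbT.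
- exists f => // x [t' [/andP[t0 t1] ->]]; apply: hs; exists (t' * k); split.
    by rewrite mulr_ge0 ?(ltW k0) //=; nra.
  by rewrite eC; apply/rowP => i; rewrite !mxE; ring.
- exists f => // x [t' [/andP[t0 t1] ->]]; apply: hs; exists (k + t' * (1 - k)); split.
    by apply/andP; split; nra.
  by rewrite eC; apply/rowP => i; rewrite !mxE; ring.
Qed.

End PlanarCount.

Section EdgesMore.
Variables (R : realType) (T : lmodType R).
Implicit Type s : seq T.

Lemma edges_rotP s e : (1 < size s)%N -> e \in edges s ->
  exists m t, rot m s = [:: e.1, e.2 & t].
Proof.
move=> s1 he; pose i := index e (edges s); exists i.
have isz : (i < size (edges s))%N by rewrite index_mem.
have := edges_rot i s; rewrite {2}/rot (drop_nth e isz) nth_index //.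
have : (1 < size (rot i s))%N by rewrite size_rot.
case: (rot i s) => [|x [|y t]] // _; rewrite edges_cons arcs_cons => -[<-] _.
by exists t.
Qed.

Lemma uniq_edges s : uniq s -> uniq (edges s).
Proof. by move=> us; apply: (@map_uniq _ _ fst); rewrite edges1. Qed.

Lemma edges_neq s e : uniq s -> (1 < size s)%N -> e \in edges s -> e.1 != e.2.
Proof.
move=> us s1 he; have [m [t ht]] := edges_rotP s1 he.
by move: us; rewrite -(rot_uniq m) ht /= inE negb_or => /andP[/andP[]].
Qed.

Lemma uniq_map_inj (S S' : eqType) (g : S -> S') (r : seq S) :
  uniq (map g r) -> {in r &, injective g}.
Proof.
elim: r => //= a r IH /andP[ga ur] x y; rewrite !inE.
move=> /orP[/eqP->|xr] /orP[/eqP->|yr] // e.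
- by rewrite e map_f in ga.
- by rewrite -e map_f in ga.
- exact: IH.
Qed.

Lemma edges_inj1 s e f : uniq s -> e \in edges s -> f \in edges s -> e.1 = f.1 -> e = f.
Proof. by move=> us; apply: uniq_map_inj; rewrite edges1. Qed.

Lemma edges_inj2 s e f : uniq s -> e \in edges s -> f \in edges s -> e.2 = f.2 -> e = f.
Proof. by move=> us; apply: uniq_map_inj; rewrite edges2 rot_uniq. Qed.

Lemma edges_flip s A B : uniq s -> (2 < size s)%N -> (A, B) \in edges s ->
  (B, A) \notin edges s.
Proof.
move=> us s2 he; have [|m [t /= ht]] := edges_rotP _ he; first exact: ltnW.
have us' : uniq (rot m s) by rewrite rot_uniq.
have s2' : (2 < size (rot m s))%N by rewrite size_rot.
rewrite -(mem_edges_rot m); apply/negP => h.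
rewrite ht in us' s2' h; case: t {ht} => [//|y t] in us' s2' h *.
have hy : (B, y) \in edges [:: A, B, y & t].
  by rewrite edges_cons !arcs_cons !inE eqxx orbT.
have [yA] := edges_inj1 us' h hy erefl.
by move: us'; rewrite yA /= !inE eqxx !orbT.
Qed.

Lemma edges_map (T' : lmodType R) (g : T -> T') s :
  edges (map g s) = map (fun e => (g e.1, g e.2)) (edges s).
Proof.
rewrite /edges -map_rot; elim: s (rot 1 s) => [|x s IH] [|y t] //=.
by rewrite IH.
Qed.
End EdgesMore.

Section Segments.
Variables (R : realType) (n : nat).
Notation vec := 'rV[R]_n.
Implicit Types (A B C X : vec).

Lemma open_sub A B X : open_segment A B X -> segment A B X.
Proof.
by case=> t [/andP[t0 t1] ->]; exists t; split=> //; rewrite !ltW.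
Qed.

Lemma segmentC A B : segment A B = segment B A.
Proof.
have aux A' B' : segment A' B' `<=` segment B' A'.
  move=> x [t [/andP[t0 t1] ->]]; exists (1 - t); split; first by apply/andP; split; lra.
  by rewrite addrC; congr (_ *: _ + _); rewrite opprB addrC subrK.
by apply/seteqP; split; exact: aux.
Qed.

Lemma open_segmentC A B : open_segment A B = open_segment B A.
Proof.
have aux A' B' : open_segment A' B' `<=` open_segment B' A'.
  move=> x [t [/andP[t0 t1] ->]]; exists (1 - t); split; first by apply/andP; split; lra.
  by rewrite addrC; congr (_ *: _ + _); rewrite opprB addrC subrK.
by apply/seteqP; split; exact: aux.
Qed.

Lemma segment_cases A B X : segment A B X -> [\/ X = A, X = B | open_segment A B X].
Proof.
case=> t [/andP[t0 t1] ->].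
move: t0; rewrite le_eqVlt => /orP[/eqP<-|t0].
  by apply: Or31; rewrite subr0 scale1r scale0r addr0.
move: t1; rewrite le_eqVlt => /orP[/eqP->|t1].
  by apply: Or32; rewrite subrr scale1r scale0r add0r.
by apply: Or33; exists t; rewrite t0.
Qed.

End Segments.

(** * Crossings of lines in general position in the plane *)

Section GeneralPosition.
Variable R : realType.
Notation plane := 'rV[R]_2.
Implicit Types (A B C D X : plane) (e f : plane * plane) (L : seq plane).

Lemma orientE A B C : orient A B C = pcr (B - A) (C - A).
Proof. by rewrite /orient /pcr !mxE. Qed.

Lemma segment_orient A B X : segment A B X -> orient A B X = 0.
Proof. by case=> t [_ ->]; rewrite /orient !mxE; ring. Qed.

Section Position.
Variables L1 L2 : seq plane.
Hypothesis gp : general_position L1 L2.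

Let vs := L1 ++ L2.

Lemma gp_orient A B C : A \in vs -> B \in vs -> C \in vs -> A != B -> segment A B C ->
  C = A \/ C = B.
Proof.
case: gp => _ _ _ h _ hA hB hC AB hs.
have [->|CA] := eqVneq C A; [by left|have [->|CB] := eqVneq C B; [by right|]].
have := h A B C hA hB hC; rewrite segment_orient // eqxx => h'.
by exfalso; have := h'; rewrite /= !inE negb_or AB (eq_sym A) CA (eq_sym B) CB => /(_ isT).
Qed.

Lemma gp_edge e : e \in edges L1 ++ edges L2 -> [/\ e.1 \in vs, e.2 \in vs & e.1 != e.2].
Proof.
case: gp => s1 s2; rewrite cat_uniq => /and3P[u1 _ u2] _ _.
rewrite mem_cat /vs !mem_cat => /orP[] he; have [-> ->] := mem_edges he; rewrite ?orbT.
  by rewrite (edges_neq u1 (ltnW s1) he).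
by rewrite (edges_neq u2 (ltnW s2) he).
Qed.

Lemma gp_disjoint A : A \in L1 -> A \in L2 -> False.
Proof.
case: gp => _ _; rewrite cat_uniq => /and3P[_ /hasPn h _] _ _ h1 h2.
by have := h _ h2; rewrite /= h1.
Qed.

(** An end of one edge lying on the other, or two parallel edges with a common point, would give
    three collinear vertices. *)
Lemma gp_cross e f X : e \in edges L1 -> f \in edges L2 ->
  segment e.1 e.2 X -> segment f.1 f.2 X ->
  [/\ det_edges e f != 0, open_segment e.1 e.2 X & open_segment f.1 f.2 X].
Proof.
move=> he hf eX fX.
have [e1 e2 e12] : [/\ e.1 \in vs, e.2 \in vs & e.1 != e.2] by apply: gp_edge; rewrite mem_cat he.
have [f1 f2 f12] : [/\ f.1 \in vs, f.2 \in vs & f.1 != f.2] by apply: gp_edge; rewrite mem_cat hf orbT.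
have [he1 he2] := mem_edges he; have [hf1 hf2] := mem_edges hf.
have ne A B : A \in L1 -> B \in L2 -> A <> B by move=> hA hB AB; apply: (@gp_disjoint A) => //; rewrite AB.
have oe : open_segment e.1 e.2 X.
  case: (segment_cases eX) => // E; rewrite E in fX.
    by case: (gp_orient f1 f2 e1 f12 fX) => h; case: (ne _ _ he1 _ h).
  by case: (gp_orient f1 f2 e2 f12 fX) => h; case: (ne _ _ he2 _ h).
have of_ : open_segment f.1 f.2 X.
  case: (segment_cases fX) => // E; rewrite E in eX.
    by case: (gp_orient e1 e2 f1 e12 eX) => h; [case: (ne e.1 f.1)|case: (ne e.2 f.1)].
  by case: (gp_orient e1 e2 f2 e12 eX) => h; [case: (ne e.1 f.2)|case: (ne e.2 f.2)].
split=> //; case: gp => _ _ _ h _.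
have : orient e.1 e.2 f.1 != 0.
  apply: h => //; rewrite /= !inE negb_or e12 /= andbT; apply/andP.
  by split; apply/eqP; apply: ne.
apply: contraNneq => D0; case: oe => s [_ eS]; case: of_ => t [_ eT].
have /rowP eq : X - e.1 - (X - f.1) = f.1 - e.1 by apply/rowP => i; rewrite !mxE; ring.
rewrite orientE [f.1 - e.1](_ : _ = s *: (e.2 - e.1) - t *: (f.2 - f.1)); last first.
  apply/rowP => i; rewrite -eq {1}eS eT !mxE; ring.
have -> : pcr (e.2 - e.1) (s *: (e.2 - e.1) - t *: (f.2 - f.1)) = t * det_edges e f.
  by rewrite /det_edges /pcr !mxE; ring.
by rewrite D0 mulr0.
Qed.

(** Three different segments have no common interior point, so [e] and [e'] have the same support
    and thus the same ends; a closed line with more than two vertices does not run back along an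
    edge. *)
Lemma gp_cross_uniq e f e' X : e \in edges L1 -> f \in edges L2 -> e' \in edges L1 ->
  segment e.1 e.2 X -> segment f.1 f.2 X -> segment e'.1 e'.2 X -> e' = e.
Proof.
move=> he hf he' eX fX eX'.
have [_ oe of_] := gp_cross he hf eX fX.
have [_ oe' _] := gp_cross he' hf eX' fX.
have [e1 e2 e12] : [/\ e.1 \in vs, e.2 \in vs & e.1 != e.2] by apply: gp_edge; rewrite mem_cat he.
have [e1' e2' e12'] : [/\ e'.1 \in vs, e'.2 \in vs & e'.1 != e'.2] by apply: gp_edge; rewrite mem_cat he'.
have [f1 f2 f12] : [/\ f.1 \in vs, f.2 \in vs & f.1 != f.2] by apply: gp_edge; rewrite mem_cat hf orbT.
have [he1 he2] := mem_edges he; have [he1' he2'] := mem_edges he'.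
have [hf1 hf2] := mem_edges hf.
have hends A B : segment A B A /\ segment A B B.
  split; [exists 0|exists 1]; rewrite ?lexx ler01; split=> //.
    by rewrite subr0 scale1r scale0r addr0.
  by rewrite subrr scale1r scale0r add0r.
have nef A B : A \in L1 -> B \in L1 -> A != B -> segment A B <> segment f.1 f.2.
  move=> hA hB AB E; have := (hends f.1 f.2).1; rewrite -E => h.
  have hA' : A \in vs by rewrite mem_cat hA.
  have hB' : B \in vs by rewrite mem_cat hB.
  by case: (gp_orient hA' hB' f1 AB h) => F; rewrite F in hf1; [case: (gp_disjoint hA hf1)|case: (gp_disjoint hB hf1)].
have see : segment e'.1 e'.2 = segment e.1 e.2.
  apply: contrapT => E; case: gp => _ _ _ _ h.
  have := h e'.1 e'.2 e.1 e.2 f.1 f.2; move=> /(_ _ e12' e12 f12 E (nef _ _ he1' he2' e12') (nef _ _ he1 he2 e12)) h'.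
  suff : (open_segment e'.1 e'.2 `&` open_segment e.1 e.2 `&` open_segment f.1 f.2) X by rewrite h' // => A; rewrite !inE => /or4P[|||/or3P[]] /eqP->.
  by [].
have ends1 : e'.1 = e.1 \/ e'.1 = e.2.
  by apply: gp_orient => //; rewrite -see; exact: (hends _ _).1.
have ends2 : e'.2 = e.1 \/ e'.2 = e.2.
  by apply: gp_orient => //; rewrite -see; exact: (hends _ _).2.
case: gp => s1 _; rewrite cat_uniq => /and3P[u1 _ _] _ _.
case: ends1 => h1; first exact: (edges_inj1 u1).
case: ends2 => h2; last exact: (edges_inj2 u1).
have := @edges_flip _ _ L1 e.1 e.2 u1 s1.
rewrite -surjective_pairing => /(_ he).
by rewrite -h1 -h2 -surjective_pairing he'.
Qed.

Lemma gp_sym : general_position L2 L1.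
Proof.
case: gp => s1 s2 u h1 h2; have E : L2 ++ L1 =i L1 ++ L2 by move=> x; rewrite !mem_cat orbC.
split=> //; first by rewrite uniq_catC.
  by move=> A B C; rewrite !E; exact: h1.
by move=> A1 B1 A2 B2 A3 B3 h; apply: h2 => x /h; rewrite E.
Qed.

End Position.
End GeneralPosition.

Section QuadSides.
Variable R : realType.
Notation space := 'rV[R]_3.

(** The two relations express that the corners form a parallelogram. The sign of the diagonal [h]
    leaves one triangle for each sign of [D], and the signs of two sides then force those of the
    other two. *)
Lemma tri_sides (h g1 g2 g3 g4 D : R) : h = g1 - g4 -> g2 + g4 = g1 + g3 ->
  (h = 0 -> D = 0) ->
  tri g2 (- h) g1 D + tri g3 g4 h D =
  if [&& 0 < g1, 0 < g2, 0 < g3, 0 < g4 & 0 < D] then 1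
  else if [&& g1 < 0, g2 < 0, g3 < 0, g4 < 0 & D < 0] then -1 else 0.
Proof.
move=> eh eg h0; rewrite /tri oppr_gt0 oppr_lt0.
case: (ltgtP h 0) => hh; last by rewrite (h0 hh) !ltxx !andbF.
- rewrite !andbF /=.
  have -> : [&& 0 < g1, 0 < g2, 0 < g3, 0 < g4 & 0 < D] = [&& 0 < g2, 0 < g1 & 0 < D].
    by apply/and5P/and3P => -[*]; split=> //; lra.
  have -> : [&& g1 < 0, g2 < 0, g3 < 0, g4 < 0 & D < 0] = [&& g3 < 0, g4 < 0 & D < 0].
    by apply/and5P/and3P => -[*]; split=> //; lra.
  case: (boolP [&& g3 < 0, _ & _]) => [/and3P[a b c]|_]; last by rewrite addr0.
  by rewrite (lt_gtF c) !andbF add0r.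
- rewrite !andbF /=.
  have -> : [&& 0 < g1, 0 < g2, 0 < g3, 0 < g4 & 0 < D] = [&& 0 < g3, 0 < g4 & 0 < D].
    by apply/and5P/and3P => -[*]; split=> //; lra.
  have -> : [&& g1 < 0, g2 < 0, g3 < 0, g4 < 0 & D < 0] = [&& g2 < 0, g1 < 0 & D < 0].
    by apply/and5P/and3P => -[*]; split=> //; lra.
  case: (boolP [&& 0 < g3, _ & _]) => [/and3P[a b c]|_]; last by rewrite addr0.
  by rewrite (lt_gtF c) !andbF add0r.
Qed.

Lemma quad_sides (u A B C D : space) :
  (det3 (A - C) (B - D) u = 0 -> cross (A - C) (B - D) = 0) ->
  quad u A B C D =
  if [&& 0 < det3 (A - C) (B - C) u, 0 < det3 (B - C) (B - D) u,
         0 < det3 (B - D) (A - D) u, 0 < det3 (A - D) (A - C) u &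
         0 < det3 (A - C) (B - C) (B - D)] then 1
  else if [&& det3 (A - C) (B - C) u < 0, det3 (B - C) (B - D) u < 0,
         det3 (B - D) (A - D) u < 0, det3 (A - D) (A - C) u < 0 &
         det3 (A - C) (B - C) (B - D) < 0] then -1 else 0.
Proof.
move=> h; rewrite -(@tri_sides (det3 (A - C) (B - D) u)).
- rewrite /quad /theta; congr (_ + _); congr tri.
    by rewrite /det3; ring.
  by rewrite /det3 !mxE; ring.
- by rewrite /det3 !mxE; ring.
- by rewrite /det3 !mxE; ring.
move=> /h h0; have -> : det3 (A - C) (B - C) (B - D) = - dot (cross (A - C) (B - D)) (B - C).
  by rewrite dot_cross /det3; ring.
by rewrite h0 dotC dot0r oppr0.
Qed.

End QuadSides.

(** * Points of a link above a crossing *)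

Section Lifts.
Variable R : realType.
Notation space := 'rV[R]_3.
Notation plane := 'rV[R]_2.
Implicit Types (M : 'M[R]_3) (s : seq space).

Definition pedge M (p : space * space) : plane * plane := (project M p.1, project M p.2).

Lemma carrier_half s P : carrier s P ->
  exists2 p, p \in edges s & half_open_segment p.1 p.2 P.
Proof.
case=> p hp [t [/andP[t0 t1] eP]].
move: t1; rewrite le_eqVlt => /orP[/eqP t1|t1]; last first.
  by exists p => //; exists t; rewrite t0.
have [_ h2] := mem_edges hp.
have /mapP[q hq eq] : p.2 \in map fst (edges s) by rewrite edges1.
exists q => //; exists 0; rewrite lexx ltr01; split=> //.
by rewrite eP t1 subrr scale0r add0r scale1r subr0 scale0r addr0 scale1r -eq.
Qed.

(** The projection of [s] passes through [X] as often as [L1] does, which is at most once since [e]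
    is the only edge of [L1] through [X]. Two lifts thus lie on one edge of [s], where the
    projection is injective. *)
Lemma lift_unique L1 L2 s M e f X P P' :
  general_position L1 L2 -> subdivides L1 (map (project M) s) -> uniq s ->
  e \in edges L1 -> f \in edges L2 -> segment e.1 e.2 X -> segment f.1 f.2 X ->
  carrier s P -> carrier s P' -> project M P = X -> project M P' = X -> P = P'.
Proof.
move=> gp sub us he hf eX fX /carrier_half[p hp hP] /carrier_half[p' hp' hP'] XP XP'.
have u1 : uniq L1 by case: gp => _ _; rewrite cat_uniq => /and3P[].
have s1 : (2 < size L1)%N by case: gp.
have half1 (q : space * space) Q : half_open_segment q.1 q.2 Q -> project M Q = X ->
    onhalf X (project M q.1) (project M q.2) = 1.
  move=> [t [ht eQ]] XQ; rewrite /onhalf asboolT //; exists t; split=> //.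
  by rewrite -XQ eQ project_lin.
have le1 : \sum_(q <- edges s) onhalf X (project M q.1) (project M q.2) <= 1.
  have := subdivides_sum (onhalf_additive X) sub; rewrite edges_map big_map /= => ->.
  rewrite (bigD1_seq e) ?uniq_edges //= big_seq_cond big1 ?addr0; last first.
    move=> e' /andP[he' ne]; rewrite /onhalf; case: asboolP => // -[t [/andP[t0 t1] eX']].
    move: ne; rewrite (@gp_cross_uniq _ _ _ gp e f e' X) ?eqxx //.
    by exists t; rewrite t0 ltW.
  by rewrite /onhalf; case: asboolP.
have pp' : p = p'.
  apply/eqP; apply: contraTT le1 => ne; rewrite -ltNge.
  rewrite (big_rem p) //= (half1 p P hP XP) (big_rem p') /=; last first.
    by rewrite mem_rem_uniq ?uniq_edges // inE eq_sym ne.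
  rewrite (half1 p' P' hP' XP') addrA ltr_wpDr //.
  by apply: sumr_ge0 => q _; rewrite /onhalf; case: asboolP.
case: hP => t [_ eP]; case: hP' => t' [_ eP']; rewrite -pp' in eP'.
have ne : project M p.1 != project M p.2.
  have := subdivides_neq (fun e he => edges_neq u1 (ltnW s1) he) sub.
  by rewrite edges_map => /(_ _ (map_f _ hp)).
have : t = t'.
  apply: (segment_paramE (X := X) ne); first by rewrite -XP eP project_lin.
  by rewrite -XP' eP' project_lin.
by rewrite eP eP' => ->.
Qed.

End Lifts.

(** * From parallelograms in space to crossings in the plane *)

Section LocalCount.
Variable R : realType.
Notation space := 'rV[R]_3.
Notation plane := 'rV[R]_2.
Implicit Types (M : 'M[R]_3) (s : seq space).

Lemma eps_all (T : eqType) (r : seq T) (P : T -> R -> Prop) :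
  (forall x, x \in r -> exists2 e0, 0 < e0 & forall e, 0 < e < e0 -> P x e) ->
  exists2 e0, 0 < e0 & forall e, 0 < e < e0 -> forall x, x \in r -> P x e.
Proof.
elim: r => [|a r IH] h; first by exists 1.
have [|e1 e10 h1] := h a; first by rewrite mem_head.
have [|e2 e20 h2] := IH; first by move=> x xr; apply: h; rewrite inE xr orbT.
exists (Num.min e1 e2); first by rewrite lt_min e10.
move=> e /andP[e_gt0]; rewrite lt_min => /andP[ee1 ee2] x.
by rewrite inE => /orP[/eqP->|xr]; [apply: h1|apply: h2]; rewrite ?e_gt0.
Qed.

Lemma sign_small (l : seq (R * R)) (D d k : R) : D != 0 -> 0 < k ->
  (forall x, x \in l -> 0 <= x.1) ->
  exists2 e0, 0 < e0 & forall e, 0 < e < e0 -> forall x, x \in l ->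
    (0 < (x.1 * (D + e * d) + e * k * x.2) * D) =
    (0 < x.1) || ((x.1 == 0) && (0 < x.2 * D)).
Proof.
move=> D0 k0 hl; apply: eps_all => x xl.
have := hl x xl; rewrite le_eqVlt => /orP[/eqP x0|x0].
  exists 1 => // e /andP[e0 _]; rewrite -x0 ltxx eqxx mul0r add0r /=.
  by rewrite -!mulrA (pmulr_rgt0 _ e0) (pmulr_rgt0 _ k0).
have [|e0 e00 he] := @small_pos R _ [:: x] (fun x => x.1 * (D * D)) (fun x => x.1 * d * D + k * x.2 * D).
  by move=> y; rewrite inE => /eqP->; rewrite mulr_gt0 // -expr2 exprn_even_gt0.
exists e0 => // e /andP[e_gt0 ee0]; rewrite x0 /=.
have := he e x; rewrite (ltW e_gt0) ee0 mem_head => /(_ isT isT).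
by congr (_ < _); ring.
Qed.

Lemma ifs_sign (D g1 g2 g3 g4 k : R) : D != 0 -> 0 < k ->
  (if [&& 0 < g1, 0 < g2, 0 < g3, 0 < g4 & 0 < k * D] then 1
  else if [&& g1 < 0, g2 < 0, g3 < 0, g4 < 0 & k * D < 0] then -1 else 0 : int) =
  if [&& 0 < g1 * D, 0 < g2 * D, 0 < g3 * D & 0 < g4 * D] then sgz D else 0.
Proof.
move=> D0 k0; rewrite pmulr_rgt0 // pmulr_rlt0 //.
case: (ltgtP D 0) D0 => // hD _.
  by rewrite !andbF !nmulr_lgt0 // ltr0_sgz // !andbT.
by rewrite !andbF !pmulr_lgt0 // gtr0_sgz // !andbT; case: ifP.
Qed.

(** In a vanishing combination of the corners and [- u], dividing by the weight [S] of the corners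
    gives points of the two segments whose difference is a multiple of [u]. The weight is nonzero
    because [u] is, and the multiple is nonzero because of the half-space containing the corners. *)
Lemma above_or_separated (A B C D u : space) :
  halfspace [:: A - C; B - C; B - D; A - D] -> u != 0 ->
  (exists P Q k, [/\ 0 < k, segment A B P, segment C D Q & P - Q = k *: u]) \/
  halfspace [:: A - C; B - C; B - D; A - D; - u].
Proof.
move=> [n hn] u0; have [no|no] := pselect (exists P Q k,
    [/\ 0 < k, segment A B P, segment C D Q & P - Q = k *: u]); [by left|right].
    apply: gordan_false => k k0 /= [c1 c10 [c2 c20 [c3 c30 [c4 c40 [c5 c50 [e1 e2]]]]]].
    have eV : c1 *: (A - C) + c2 *: (B - C) + c3 *: (B - D) + c4 *: (A - D) = c5 *: u.
      by apply: subr0_eq; rewrite -[RHS]oppr0 -e1; apply/rowP => i; rewrite !mxE; ring.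
    pose S := c1 + c2 + c3 + c4.
    have S0 : 0 <= S by rewrite !addr_ge0.
    move: S0; rewrite le_eqVlt => /orP[/eqP S0|S0].
      have [z1 z2 z3 z4] : [/\ c1 = 0, c2 = 0, c3 = 0 & c4 = 0] by rewrite /S in S0; split; lra.
      move: eV; rewrite z1 z2 z3 z4 !scale0r !addr0 => /esym/eqP.
      rewrite scaler_eq0 (negPf u0) orbF => /eqP c5z.
      by move: k0; rewrite (_ : k = 0) ?ltxx //; lra.
    have c5p : 0 < c5.
      rewrite lt_neqAle c50 andbT; apply/eqP => z.
      have := congr1 (dot n) eV; rewrite -z scale0r dot0r !dotDr !dotZr => ez.
      have n1 : 0 < dot n (A - C) by apply: hn; rewrite !inE eqxx ?orbT.
      have n2 : 0 < dot n (B - C) by apply: hn; rewrite !inE eqxx ?orbT.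
      have n3 : 0 < dot n (B - D) by apply: hn; rewrite !inE eqxx ?orbT.
      have n4 : 0 < dot n (A - D) by apply: hn; rewrite !inE eqxx ?orbT.
      have m1 := mulr_ge0 c10 (ltW n1); have m2 := mulr_ge0 c20 (ltW n2).
      have m3 := mulr_ge0 c30 (ltW n3); have m4 := mulr_ge0 c40 (ltW n4).
      have z1 : c1 * dot n (A - C) = 0 by lra.
      have z2 : c2 * dot n (B - C) = 0 by lra.
      have z3 : c3 * dot n (B - D) = 0 by lra.
      have z4 : c4 * dot n (A - D) = 0 by lra.
      move/eqP: z1; move/eqP: z2; move/eqP: z3; move/eqP: z4.
      rewrite !mulf_eq0 !(gt_eqF n1, gt_eqF n2, gt_eqF n3, gt_eqF n4) !orbF.
      by move=> /eqP y4 /eqP y3 /eqP y2 /eqP y1; move: S0; rewrite /S y1 y2 y3 y4 !addr0 ltxx.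
    apply: no; exists (((c1 + c4) / S) *: A + ((c2 + c3) / S) *: B),
                      (((c1 + c2) / S) *: C + ((c3 + c4) / S) *: D), (c5 / S).
    have Sn : S != 0 by rewrite gt_eqF.
    split; first by rewrite divr_gt0.
    + exists ((c2 + c3) / S); split.
        by rewrite divr_ge0 ?addr_ge0 ?(ltW S0) //= ler_pdivrMr // mul1r /S; lra.
      by rewrite [in RHS](_ : 1 - _ = (c1 + c4) / S) // /S; field.
    + exists ((c3 + c4) / S); split.
        by rewrite divr_ge0 ?addr_ge0 ?(ltW S0) //= ler_pdivrMr // mul1r /S; lra.
      by rewrite [in RHS](_ : 1 - _ = (c1 + c2) / S) // /S; field.
    + rewrite (mulrC c5) -[(_ * c5) *: u]scalerA -eV; apply/rowP => i; rewrite !mxE; field.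
      exact: Sn.
Qed.

Variables (s1 s2 : seq space) (M : 'M[R]_3) (w : space).
Let u0 := axis M.

Definition above (X : plane) : Prop := exists P Q,
  [/\ carrier s1 P, carrier s2 Q, project M P = X, project M Q = X &
      height M Q < height M P].

Hypothesis hM : is_frame M.

Lemma axis_neq0 : u0 != 0.
Proof.
apply/eqP => h; have := axis_norm hM; rewrite -/u0 h dot0r.
by move/eqP; rewrite eq_sym oner_eq0.
Qed.

(** Looking along [u0 + e *: w] instead of [u0] displaces the projection of the upper edge by a
    small multiple of [- w] with respect to the lower one, which is precisely the end-point
    convention of [crosscount]. This also covers crossings at vertices of the projected link. *)
Lemma local_count p q :
  p \in edges s1 -> q \in edges s2 ->
  halfspace [:: p.1 - q.1; p.2 - q.1; p.2 - q.2; p.1 - q.2] ->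
  (cross u0 (p.2 - p.1) != 0 -> dot (cross u0 (p.2 - p.1)) w != 0) ->
  (cross u0 (q.2 - q.1) != 0 -> dot (cross u0 (q.2 - q.1)) w != 0) ->
  (forall X, segment (project M p.1) (project M p.2) X ->
     segment (project M q.1) (project M q.2) X ->
     [/\ det_edges (pedge M p) (pedge M q) != 0,
     forall P P', carrier s1 P -> carrier s1 P' -> project M P = X -> project M P' = X -> P = P' &
     forall P P', carrier s2 P -> carrier s2 P' -> project M P = X -> project M P' = X -> P = P']) ->
  exists2 e0, 0 < e0 & forall e, 0 < e < e0 ->
    (det3 (p.1 - q.1) (p.2 - q.2) (u0 + e *: w) = 0 -> cross (p.1 - q.1) (p.2 - q.2) = 0) ->
    quad (u0 + e *: w) p.1 p.2 q.1 q.2 =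
    crosscount above (project M w) (pedge M p) (pedge M q).
Proof.
case: p => A B; case: q => C D /= hp hq hs wa wc hX.
set a := B - A in wa *; set c := D - C in wc *.
have eD : det_edges (pedge M (A, B)) (pedge M (C, D)) = det3 c a u0.
  by rewrite /det_edges /= -!projectB pcr_project.
have eS : det3 c a u0 * crosspar (pedge M (A, B)) (pedge M (C, D)) = det3 (A - C) c u0 \/ det3 c a u0 = 0.
  have [->|D0] := eqVneq (det3 c a u0) 0; [by right|left].
  by rewrite /crosspar eD /= -!projectB pcr_project // mulrC divfK.
have eT : det3 c a u0 * crosspar (pedge M (C, D)) (pedge M (A, B)) = det3 (A - C) a u0 \/ det3 c a u0 = 0.
  have [->|D0] := eqVneq (det3 c a u0) 0; [by right|left].
  rewrite /crosspar det_edges_sym eD /= -!projectB pcr_project //.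
  have -> : det3 (C - A) (B - A) u0 = - det3 (A - C) a u0 by rewrite /det3 !mxE; ring.
  by field.
have inA P : segment A B P -> carrier s1 P by exists (A, B).
have inC P : segment C D P -> carrier s2 P by exists (C, D).
have [[P [Q [k [k0 hP hQ PQ]]]]|no] := pselect (exists P Q k, [/\ 0 < k, segment A B P, segment C D Q & P - Q = k *: u0]).
- have pPQ : project M P = project M Q.
    apply/subr0_eq; rewrite -projectB PQ.
    have -> : k *: u0 = k *: axis M + 0 *: axis M by rewrite scale0r addr0.
    rewrite project_lin; have -> : project M (axis M) = 0.
      by apply/rowP; apply: ord2P; rewrite ?project0 ?project1 axis_mul // !mxE.
    by rewrite !scaler0 addr0.
  have hov : above (project M P).
    exists P, Q; split=> //; [exact: inA|exact: inC|].
    by rewrite -subr_gt0 !heightE -!(dotC (axis M)) -dotBr PQ dotZr axis_norm // mulr1.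
  case: (hP) => s0 [/andP[s00 s01] eP]; case: (hQ) => t0 [/andP[t00 t01] eQ].
  have eP' : P = A + s0 *: a by rewrite eP /a; apply/rowP => i; rewrite !mxE; ring.
  have eQ' : Q = C + t0 *: c by rewrite eQ /c; apply/rowP => i; rewrite !mxE; ring.
  have eAC : A - C = k *: u0 - s0 *: a + t0 *: c.
    by rewrite -PQ eP' eQ'; apply/rowP => i; rewrite !mxE; ring.
  have [D0 _ _] : [/\ det_edges (pedge M (A, B)) (pedge M (C, D)) != 0, True & True].
    have [] := hX (project M P); rewrite ?eP ?project_lin; try by exists s0; rewrite s00.
      by rewrite -project_lin -eP pPQ eQ project_lin; exists t0; rewrite t00.
    by [].
  have Dq0 := D0; rewrite eD in Dq0.
  have cs : crosspar (pedge M (A, B)) (pedge M (C, D)) = s0.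
    apply: (mulfI Dq0); case: eS => [->|e0]; last by rewrite e0 eqxx in Dq0.
    by rewrite eAC /det3 !mxE; ring.
  have ct : crosspar (pedge M (C, D)) (pedge M (A, B)) = t0.
    apply: (mulfI Dq0); case: eT => [->|e0]; last by rewrite e0 eqxx in Dq0.
    by rewrite eAC /det3 !mxE; ring.
  have cX : crosspoint (pedge M (A, B)) (pedge M (C, D)) = project M P.
    rewrite /crosspoint cs eP project_lin /=; apply/rowP => i; rewrite !mxE; ring.
  pose be := det3 u0 a w; pose ga := det3 u0 c w.
  have be0 : be != 0.
    rewrite /be -dot_cross; apply: wa; apply: contraNneq Dq0 => h.
    have -> : det3 c a u0 = - dot (cross u0 a) c by rewrite dot_cross /det3; ring.
    by rewrite h dotC dot0r oppr0.
  have ga0 : ga != 0.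
    rewrite /ga -dot_cross; apply: wc; apply: contraNneq Dq0 => h.
    have -> : det3 c a u0 = dot (cross u0 c) a by rewrite dot_cross /det3; ring.
    by rewrite h dotC dot0r.
  have [|e0 e00 he] := @sign_small [:: (t0, be); (1 - t0, - be); (s0, ga); (1 - s0, - ga)]
     _ (det3 c a w) _ Dq0 k0.
    by move=> x; rewrite !inE => /or4P[] /eqP-> //=; lra.
  exists e0 => // e ee hgen; rewrite quad_sides //.
  set u' := u0 + e *: w.
  have Eg1 : det3 (A - C) (B - C) u' = t0 * (det3 c a u0 + e * det3 c a w) + e * k * be.
    rewrite [B - C](_ : _ = A - C + a); last by rewrite /a; apply/rowP => i; rewrite !mxE; ring.
    by rewrite eAC /u' /be /det3 !mxE; ring.
  have Eg3 : det3 (B - D) (A - D) u' = (1 - t0) * (det3 c a u0 + e * det3 c a w) + e * k * - be.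
    rewrite [B - D](_ : _ = A - C + a - c); last by rewrite /a /c; apply/rowP => i; rewrite !mxE; ring.
    rewrite [A - D](_ : _ = A - C - c); last by rewrite /c; apply/rowP => i; rewrite !mxE; ring.
    by rewrite eAC /u' /be /det3 !mxE; ring.
  have Eg4 : det3 (A - D) (A - C) u' = s0 * (det3 c a u0 + e * det3 c a w) + e * k * ga.
    rewrite [A - D](_ : _ = A - C - c); last by rewrite /c; apply/rowP => i; rewrite !mxE; ring.
    by rewrite eAC /u' /ga /det3 !mxE; ring.
  have Eg2 : det3 (B - C) (B - D) u' = (1 - s0) * (det3 c a u0 + e * det3 c a w) + e * k * - ga.
    rewrite [B - D](_ : _ = A - C + a - c); last by rewrite /a /c; apply/rowP => i; rewrite !mxE; ring.
    rewrite [B - C](_ : _ = A - C + a); last by rewrite /a; apply/rowP => i; rewrite !mxE; ring.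
    by rewrite eAC /u' /ga /det3 !mxE; ring.
  have ED : det3 (A - C) (B - C) (B - D) = k * det3 c a u0.
    rewrite [B - D](_ : _ = A - C + a - c); last by rewrite /a /c; apply/rowP => i; rewrite !mxE; ring.
    rewrite [B - C](_ : _ = A - C + a); last by rewrite /a; apply/rowP => i; rewrite !mxE; ring.
    by rewrite eAC /det3 !mxE; ring.
  rewrite ED ifs_sign // Eg1 Eg2 Eg3 Eg4.
  have h1 := he e ee (t0, be); have h3 := he e ee (1 - t0, - be).
  have h4 := he e ee (s0, ga); have h2 := he e ee (1 - s0, - ga).
  rewrite !inE !eqxx ?orbT /= in h1 h2 h3 h4.
  rewrite h1 // h2 // h3 // h4 // /crosscount D0 cs ct cX eD /= asboolT // andbT.
  rewrite -!projectB !pcr_project // -/a -/c -/u0.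
  have -> : det3 c w u0 = ga by rewrite /ga /det3; ring.
  have -> : det3 a w u0 = be by rewrite /be /det3; ring.
  (* [halfopen] in lexicographic form: an end is included exactly when the first-order term pushes
     the crossing inside the edge. *)
  have ho (t b : R) : b != 0 -> 0 <= t -> t <= 1 ->
     halfopen (0 < b * det3 c a u0) t = ((0 < t) || (t == 0) && (0 < b * det3 c a u0)) &&
     ((0 < 1 - t) || (1 - t == 0) && (0 < - b * det3 c a u0)).
    move=> b0 ht0 ht1; have bD : b * det3 c a u0 != 0 by rewrite mulf_neq0.
    rewrite /halfopen mulNr oppr_gt0 subr_gt0 subr_eq0 (eq_sym 1).
    case: (ltgtP (b * det3 c a u0) 0) bD => // _ _; rewrite ?andbT ?andbF ?orbF.
      by rewrite [(t < 1) || _]orbC -le_eqVlt.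
    by rewrite orbC (eq_sym t) -le_eqVlt.
  rewrite !ho //; congr (if _ then _ else _).
  by rewrite -!andbA; do !bool_congr.
(* No point of the first edge is above a point of the second. Near [u0] the parallelogram is missed,
   and since lifts are unique, [above] fails where the projections meet. *)
- have [//|hs'] := above_or_separated hs axis_neq0.
  have [n hn] := hs'.
  have [//|e0 e00 he] := @small_pos R _ [:: u0] (fun=> dot n (- u0)) (fun=> - dot n w).
    by move=> _ _; apply: hn; rewrite !inE eqxx ?orbT.
  exists e0 => // e /andP[e_gt0 ee0] _.
  rewrite (@quad_neg _ n); last 2 first.
  + by move=> X h; apply: hn; rewrite !inE in h *; case/or4P: h => ->; rewrite ?orbT.
  + have := he e u0; rewrite mem_head dotDr dotZr dotNr (ltW e_gt0) ee0 => /(_ isT isT); lra.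
  rewrite /crosscount; case: ifP => // /and4P[D0 hb1 hb2 /asboolP[P [Q [cP cQ XP XQ hPQ]]]].
  exfalso; move: XP XQ; set X := crosspoint _ _ => XP XQ.
  have ho (b : bool) (t : R) : halfopen b t -> 0 <= t <= 1.
    by rewrite /halfopen; case: b => /andP[t0 t1]; rewrite ?t0 ?t1 ltW.
  have /andP[sa sb] := ho _ _ hb1; have /andP[ta tb] := ho _ _ hb2.
  set s0 := crosspar (pedge M (A, B)) _ in sa sb; set t0 := crosspar (pedge M (C, D)) _ in ta tb.
  pose P0 := (1 - s0) *: A + s0 *: B; pose Q0 := (1 - t0) *: C + t0 *: D.
  have hP0 : segment A B P0 by exists s0; rewrite sa.
  have hQ0 : segment C D Q0 by exists t0; rewrite ta.
  have XP0 : project M P0 = X.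
    by rewrite /P0 project_lin /X /crosspoint -/s0 /=; apply/rowP => i; rewrite !mxE; ring.
  have XQ0 : project M Q0 = X.
    rewrite /Q0 project_lin /X -crosspoint_sym // /crosspoint -/t0 /=; apply/rowP => i; rewrite !mxE; ring.
  have [||_ U1 U2] := hX X.
  + by rewrite -XP0 /P0 project_lin; exists s0; rewrite sa.
  + by rewrite -XQ0 /Q0 project_lin; exists t0; rewrite ta.
  apply: no; exists P0, Q0, (height M P - height M Q); split=> //; first by rewrite subr_gt0.
  rewrite -(U1 P P0) //; last exact: inA.
  rewrite -(U2 Q Q0) //; last exact: inC.
  by apply: project_axis => //; rewrite XP XQ.
Qed.

End LocalCount.

(** * The linking number as a sum over crossings *)

Section DiagramFormula.
Variable R : realType.
Notation space := 'rV[R]_3.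
Notation plane := 'rV[R]_2.
Implicit Types (M : 'M[R]_3) (s : seq space) (L : seq plane) (X : plane) (e f : plane * plane).

Lemma segment_dir (A B C D : plane) : segment A B C -> segment A B D -> C != D ->
  exists2 k : R, k != 0 & D - C = k *: (B - A).
Proof.
case=> c [_ ->] [d [_ ->]] CD; exists (d - c).
  by apply: contraNneq CD => /eqP; rewrite subr_eq0 => /eqP->.
by apply/rowP => i; rewrite !mxE; ring.
Qed.

Lemma crosspar_eq e f (s t : R) : det_edges e f != 0 ->
  e.1 + s *: (e.2 - e.1) = f.1 + t *: (f.2 - f.1) -> crosspar e f = s.
Proof.
move=> D0 h; have hE : e.1 - f.1 = t *: (f.2 - f.1) - s *: (e.2 - e.1).
  by apply/rowP => i; have /rowP/(_ i) := h; rewrite !mxE => h'; lra.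
rewrite /crosspar; apply: (canLR (mulfK D0)); rewrite hE /det_edges /pcr !mxE; ring.
Qed.

Lemma segmentE (A B X : plane) : segment A B X <->
  exists t : R, 0 <= t <= 1 /\ X = A + t *: (B - A).
Proof.
by split=> -[t [ht ->]]; exists t; split=> //; apply/rowP => i; rewrite !mxE; ring.
Qed.

Lemma cross_unique e f X Y : det_edges e f != 0 -> segment e.1 e.2 X -> segment f.1 f.2 X ->
  segment e.1 e.2 Y -> segment f.1 f.2 Y -> X = Y.
Proof.
move=> D0 /segmentE[s [_ hX]] /segmentE[t [_ hX']] /segmentE[s' [_ hY]] /segmentE[t' [_ hY']].
rewrite hX hY -(@crosspar_eq e f s t) -?hX -?hX' // -(@crosspar_eq e f s' t') -?hY -?hY' //.
Qed.

(** The condition of [passes_over] for any list of edges, so that it applies to both orders of the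
    components and to sequences not yet packed into a link. *)
Definition pass_above M (E : seq (space * space)) e f : Prop := exists p q P Q,
    [/\ p \in E, q \in E,
        (project M @` segment p.1 p.2 `<=` segment e.1 e.2),
        (project M @` segment q.1 q.2 `<=` segment f.1 f.2) &
        [/\ segment p.1 p.2 P, segment q.1 q.2 Q, project M P = project M Q &
            height M Q < height M P]].

Lemma project_segment M (A B : space) :
  project M @` segment A B = segment (project M A) (project M B).
Proof.
apply/seteqP; split=> [x [y [t [ht ->]] <-]|x [t [ht ->]]].
  by exists t; split=> //; rewrite project_lin.
by exists ((1 - t) *: A + t *: B); [exists t|rewrite project_lin].
Qed.

Section OneSide.
Variables (L1 L2 : seq plane) (s1 s2 : seq space) (M : 'M[R]_3).
Hypotheses (gp : general_position L1 L2)
  (sub1 : subdivides L1 (map (project M) s1)) (sub2 : subdivides L2 (map (project M) s2)).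

Lemma gp_uniq : [/\ uniq L1, (1 < size L1)%N & (2 < size L1)%N].
Proof.
by case: gp => h _; rewrite cat_uniq => /and3P[u _ _] _ _; split=> //; exact: ltnW.
Qed.

Lemma sub_neq p : p \in edges s1 -> project M p.1 != project M p.2.
Proof.
move=> hp; have [u h1 _] := gp_uniq.
have := subdivides_neq (fun e he => edges_neq u h1 he) sub1.
by rewrite edges_map => /(_ _ (map_f _ hp)).
Qed.

Lemma sub_edge p : p \in edges s1 -> exists2 e, e \in edges L1 &
  segment (project M p.1) (project M p.2) `<=` segment e.1 e.2.
Proof.
move=> hp; have := subdivides_sub sub1; rewrite edges_map => h.
by have [e he hs] := h _ (map_f _ hp); exists e.
Qed.

Lemma lift_exists e X : e \in edges L1 -> open_segment e.1 e.2 X ->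
  exists2 P, carrier s1 P & project M P = X.
Proof.
move=> he eX; apply: contrapT => no; have [u _ _] := gp_uniq.
have := subdivides_sum (onhalf_additive X) sub1; rewrite edges_map big_map /=.
rewrite big_seq big1 => [/eqP|p hp]; last first.
  rewrite /onhalf; case: asboolP => // -[t [/andP[t0 t1] eXp]]; case: no.
  exists ((1 - t) *: p.1 + t *: p.2); last by rewrite project_lin.
  by exists p => //; exists t; rewrite t0 ltW.
rewrite (big_rem e) //= eq_sym gt_eqF // ltr_pwDl //.
  rewrite /onhalf asboolT //; case: eX => t [/andP[t0 t1] ->].
  by exists t; rewrite ltW.
by apply: sumr_ge0 => q _; rewrite /onhalf; case: asboolP.
Qed.

End OneSide.

Section BothSides.
Variables (L1 L2 : seq plane) (s1 s2 : seq space) (M : 'M[R]_3).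
Hypotheses (gp : general_position L1 L2)
  (sub1 : subdivides L1 (map (project M) s1)) (sub2 : subdivides L2 (map (project M) s2)).

(** [p] projects into an edge of [L2], which shares at most one point with [e], while the projected
    ends of [p] are distinct. *)
Lemma sub_foreign e p : e \in edges L1 -> p \in edges s2 ->
  ~ (project M @` segment p.1 p.2 `<=` segment e.1 e.2).
Proof.
move=> he hp hs; rewrite project_segment in hs.
have [f hf hpf] := sub_edge sub2 hp; have ne := sub_neq (gp_sym gp) sub2 hp.
have hends (A B : plane) : segment A B A /\ segment A B B.
  by split; apply/segmentE; [exists 0|exists 1]; rewrite ?lexx ler01; split=> //;
    rewrite ?scale0r ?addr0 // scale1r addrC subrK.
have [h1 h2] := hends (project M p.1) (project M p.2).
have [D0 _ _] := gp_cross gp he hf (hs _ h1) (hpf _ h1).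
by move: ne; rewrite (cross_unique D0 (hs _ h1) (hpf _ h1) (hs _ h2) (hpf _ h2)) eqxx.
Qed.
End BothSides.

Section Passing.
Variables (L1 L2 : seq plane) (s1 s2 : seq space) (M : 'M[R]_3).
Hypotheses (gp : general_position L1 L2)
  (sub1 : subdivides L1 (map (project M) s1)) (sub2 : subdivides L2 (map (project M) s2)).

(** An edge projecting into [e] comes from the first component by [sub_foreign], and an edge of that
    component with a point above [X] projects into [e], the only edge of [L1] through [X]. The
    condition thus depends on the points above [X] alone. *)
Lemma pass_aboveP (E : seq (space * space)) e f X : E =i edges s1 ++ edges s2 ->
  e \in edges L1 -> f \in edges L2 -> segment e.1 e.2 X -> segment f.1 f.2 X ->
  (pass_above M E e f <-> above s1 s2 M X).
Proof.
move=> EE he hf eX fX; have [D0 _ _] := gp_cross gp he hf eX fX.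
split=> [[p [q [P [Q [hp hq pe qf [hP hQ PQ hh]]]]]]|[P [Q [[p hp hP] [q hq hQ] XP XQ hh]]]].
- have pXe : segment e.1 e.2 (project M P) by apply: pe; exists P.
  have qXf : segment f.1 f.2 (project M P) by rewrite PQ; apply: qf; exists Q.
  have XP := cross_unique D0 eX fX pXe qXf.
  exists P, Q; split=> //; last by rewrite -PQ.
  + exists p => //; move: hp; rewrite EE mem_cat => /orP[//|hp]; exfalso.
    exact: (sub_foreign gp sub2 he hp).
  + exists q => //; move: hq; rewrite EE mem_cat => /orP[hq|//]; exfalso.
    exact: (sub_foreign (gp_sym gp) sub1 hf hq).
- exists p, q, P, Q; split; rewrite ?EE ?mem_cat ?hp ?hq ?orbT //.
  + have [e' he' hs] := sub_edge sub1 hp; rewrite project_segment.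
    suff <- : e' = e by [].
    apply: (gp_cross_uniq gp he hf he' eX fX); apply: hs.
    by rewrite -XP -project_segment; exists P.
  + have [f' hf' hs] := sub_edge sub2 hq; rewrite project_segment.
    suff <- : f' = f by [].
    apply: (gp_cross_uniq (gp_sym gp) hf he hf' fX eX); apply: hs.
    by rewrite -XQ -project_segment; exists Q.
  + by split=> //; rewrite XP XQ.
Qed.

End Passing.

Definition crossterm (D : diagram R) e f : int :=
  if `[< crossing D e f >] && over D e f then sgz (det_edges e f) else 0.

Section Links.
Variables (K : link2 R) (D : diagram R) (M : 'M[R]_3).
Hypotheses (gp : general_position (line1 D) (line2 D)) (hM : is_frame M)
  (sub1 : subdivides (line1 D) (map (project M) (comp1 K)))
  (sub2 : subdivides (line2 D) (map (project M) (comp2 K)))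
  (hov : forall e f, crossing D e f -> (over D e f <-> passes_over M K e f)).

Let us1 : uniq (comp1 K). Proof. by case: (comp1_knot K). Qed.
Let us2 : uniq (comp2 K). Proof. by case: (comp2_knot K). Qed.

Lemma crossing12 e f X : e \in edges (line1 D) -> f \in edges (line2 D) ->
  segment e.1 e.2 X -> segment f.1 f.2 X -> crossing D e f /\ crossing D f e.
Proof.
move=> he hf eX fX; have [_ oe of_] := gp_cross gp he hf eX fX.
have ne : e != f.
  apply/eqP => E; have [h1 _] := mem_edges he; have [h2 _] := mem_edges hf.
  by rewrite -E in h2; exact: (gp_disjoint gp h1 h2).
split; split; rewrite /diagram_edges ?mem_cat ?he ?hf ?orbT //; try by exists X.
by rewrite eq_sym.
Qed.

Lemma over_above e f X : e \in edges (line1 D) -> f \in edges (line2 D) ->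
  segment e.1 e.2 X -> segment f.1 f.2 X ->
  (over D e f <-> above (comp1 K) (comp2 K) M X) /\
  (over D f e <-> above (comp2 K) (comp1 K) M X).
Proof.
move=> he hf eX fX; have [c1 c2] := crossing12 he hf eX fX.
rewrite (propext (hov c1)) (propext (hov c2)); split.
  exact: (pass_aboveP gp sub1 sub2 _ he hf eX fX).
apply: (pass_aboveP (gp_sym gp) sub2 sub1 _ hf he fX eX).
by move=> x; rewrite !mem_cat orbC.
Qed.

(** Each component has one point above [X], and these two points have different heights as the
    components are disjoint. *)
Lemma over_sym e f X : e \in edges (line1 D) -> f \in edges (line2 D) ->
  segment e.1 e.2 X -> segment f.1 f.2 X -> over D f e = ~~ over D e f.
Proof.
move=> he hf eX fX; have [_ oe of_] := gp_cross gp he hf eX fX.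
have [h1 h2] := over_above he hf eX fX.
have [P cP XP] := lift_exists gp sub1 he oe.
have [Q cQ XQ] := lift_exists (gp_sym gp) sub2 hf of_.
have U1 := fun P P' => @lift_unique R _ _ _ _ _ _ X P P' gp sub1 us1 he hf eX fX.
have U2 := fun P P' => @lift_unique R _ _ _ _ _ _ X P P' (gp_sym gp) sub2 us2 hf he fX eX.
have PQ : height M P <> height M Q.
  move=> h; have := @project_axis R M P Q hM; rewrite XP XQ h subrr scale0r.
  move=> /(_ erefl) /subr0_eq E; have := comp_disjoint K.
  by move=> /seteqP[/(_ P) + _]; apply; split=> //; rewrite E.
have a1 : above (comp1 K) (comp2 K) M X <-> height M Q < height M P.
  split=> [[P' [Q' [c1 c2 X1 X2]]]|h]; last by exists P, Q.
  by rewrite (U1 P' P) // (U2 Q' Q).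
have a2 : above (comp2 K) (comp1 K) M X <-> height M P < height M Q.
  split=> [[P' [Q' [c1 c2 X1 X2]]]|h]; last by exists Q, P.
  by rewrite (U1 Q' P) // (U2 P' Q).
have -> : over D f e = (height M P < height M Q) by apply/idP/idP => [/h2/a2|/a2/h2].
have -> : over D e f = (height M Q < height M P) by apply/idP/idP => [/h1/a1|/a1/h1].
by rewrite -leNgt lt_neqAle; case: eqP.
Qed.

(** In the diagram itself crossings are interior to the edges, where [halfopen] holds under both
    conventions. *)
Lemma crosscount_crossterm w e f : e \in edges (line1 D) -> f \in edges (line2 D) ->
  crosscount (above (comp1 K) (comp2 K) M) w e f = crossterm D e f.
Proof.
move=> he hf; rewrite /crossterm; case: asboolP => /= [[_ _ _ [X [oe of_]]]|nc].
- have eX := open_sub oe; have fX := open_sub of_.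
  have [D0 _ _] := gp_cross gp he hf eX fX.
  have [h1 _] := over_above he hf eX fX.
  case: (oe) => s [/andP[s0 s1] eS]; case: (of_) => t [/andP[t0 t1] eT].
  have eS' : X = e.1 + s *: (e.2 - e.1) by rewrite eS; apply/rowP => i; rewrite !mxE; ring.
  have eT' : X = f.1 + t *: (f.2 - f.1) by rewrite eT; apply/rowP => i; rewrite !mxE; ring.
  have cs : crosspar e f = s by apply: (crosspar_eq D0 (t := t)); rewrite -eS' -eT'.
  have D1 : det_edges f e != 0 by rewrite det_edges_sym oppr_eq0.
  have ct : crosspar f e = t by apply: (crosspar_eq D1 (t := s)); rewrite -eS' -eT'.
  have ho (b : bool) (r : R) : 0 < r -> r < 1 -> halfopen b r.
    by rewrite /halfopen; case: b => r0 r1; rewrite ?r0 ?r1 ?ltW.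
  rewrite /crosscount /crosspoint cs ct D0 !ho //= -eS'.
  by case: asboolP => [/h1->|h] //; case: ifP => // /h1.
- rewrite /crosscount; case: ifP => // /and4P[D0 hb1 hb2 _].
  have ho (b : bool) (t : R) : halfopen b t -> 0 <= t <= 1.
    by rewrite /halfopen; case: b => /andP[t0 t1]; rewrite ?t0 ?t1 ltW.
  case: nc; apply: (proj1 (@crossing12 e f (crosspoint e f) he hf _ _)); apply/segmentE.
    by exists (crosspar e f); split=> //; apply: ho hb1.
  by exists (crosspar f e); split; [apply: ho hb2|rewrite -crosspoint_sym].
Qed.

Lemma lkn_crossterm : lkn (comp1 K) (comp2 K) =
  \sum_(e <- edges (line1 D)) \sum_(f <- edges (line2 D)) crossterm D e f.
Proof.
pose u0 := axis M; pose s1 := comp1 K; pose s2 := comp2 K.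
have [w [e1 [hw e10 gw]]] := generic_dir_near (diffs s1 s2)
   [seq cross u0 (p.2 - p.1) | p <- edges s1 ++ edges s2] u0.
have hK := link_apart K.
have hX p q X : p \in edges s1 -> q \in edges s2 ->
    segment (project M p.1) (project M p.2) X ->
    segment (project M q.1) (project M q.2) X ->
    [/\ det_edges (pedge M p) (pedge M q) != 0,
     forall P P', carrier s1 P -> carrier s1 P' -> project M P = X -> project M P' = X -> P = P' &
     forall P P', carrier s2 P -> carrier s2 P' -> project M P = X -> project M P' = X -> P = P'].
  move=> hp hq pX qX.
  have [e he hpe] := sub_edge sub1 hp; have [f hf hqf] := sub_edge sub2 hq.
  have eX := hpe _ pX; have fX := hqf _ qX.
  have [D0 _ _] := gp_cross gp he hf eX fX; split.
  - have hends (A B : plane) : segment A B A /\ segment A B B.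
      by split; apply/segmentE; [exists 0|exists 1]; rewrite ?lexx ler01; split=> //;
        rewrite ?scale0r ?addr0 // scale1r addrC subrK.
    have [p1 p2] := hends (project M p.1) (project M p.2).
    have [q1 q2] := hends (project M q.1) (project M q.2).
    have [k k0 ek] := segment_dir (hpe _ p1) (hpe _ p2) (sub_neq gp sub1 hp).
    have [l l0 el] := segment_dir (hqf _ q1) (hqf _ q2) (sub_neq (gp_sym gp) sub2 hq).
    rewrite /det_edges /= ek el.
    have -> : pcr (l *: (f.2 - f.1)) (k *: (e.2 - e.1)) = l * k * det_edges e f.
      by rewrite /det_edges /pcr !mxE; ring.
    by rewrite !mulf_neq0.
  - by move=> P P'; exact: (lift_unique gp sub1 us1 he hf eX fX).
  - by move=> P P'; exact: (lift_unique (gp_sym gp) sub2 us2 hf he fX eX).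
have [e2 e20 h2] : exists2 e0 : R, 0 < e0 & forall t : R, 0 < t < e0 ->
    forall p, p \in edges s1 -> forall q, q \in edges s2 ->
    (det3 (p.1 - q.1) (p.2 - q.2) (u0 + t *: w) = 0 -> cross (p.1 - q.1) (p.2 - q.2) = 0) ->
    quad (u0 + t *: w) p.1 p.2 q.1 q.2 =
    crosscount (above s1 s2 M) (project M w) (pedge M p) (pedge M q).
  apply: eps_all => p hp; apply: eps_all => q hq; apply: local_count => //.
  - exact: hK.
  - by apply: hw; apply: (map_f (fun p => cross u0 (p.2 - p.1))); rewrite mem_cat hp.
  - by apply: hw; apply: (map_f (fun p => cross u0 (p.2 - p.1))); rewrite mem_cat hq orbT.
  - by move=> X; exact: hX.
pose t := Num.min e1 e2 / 2.
have m0 : 0 < Num.min e1 e2 by rewrite lt_min e10.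
have [m1 m2] : Num.min e1 e2 <= e1 /\ Num.min e1 e2 <= e2.
  by rewrite !ge_min !lexx orbT.
have {}gw : generic_dir (u0 + t *: w) (diffs s1 s2) by apply: gw; rewrite /t; lra.
rewrite (lknE hK gw) /lkd.
have -> : \sum_(p <- edges s1) \sum_(q <- edges s2) quad (u0 + t *: w) p.1 p.2 q.1 q.2 =
    \sum_(p <- edges s1) \sum_(q <- edges s2)
      crosscount (above s1 s2 M) (project M w) (pedge M p) (pedge M q).
  apply: eq_big_seq => p hp; apply: eq_big_seq => q hq; apply: h2 => //.
    by rewrite /t; lra.
  have [? ?] := mem_edges hp; have [? ?] := mem_edges hq.
  move=> h0; apply/eqP; apply: contraPT h0 => c0; apply/eqP.
  by apply: gw => //; rewrite mem_cat diffsP.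
(* Additivity replaces the projected edges by those of the diagram, one component at a time. *)
transitivity (\sum_(p <- edges s1) \sum_(f <- edges (line2 D))
      crosscount (above s1 s2 M) (project M w) (pedge M p) f).
  apply: eq_bigr => p _.
  have := subdivides_sum (crosscount_additive2 (above s1 s2 M) (project M w) (pedge M p)) sub2.
  rewrite edges_map big_map => ->; by apply: eq_bigr => -[].
rewrite exchange_big [RHS]exchange_big /=; apply: eq_big_seq => f hf.
have := subdivides_sum (crosscount_additive1 (above s1 s2 M) (project M w) f) sub1.
rewrite edges_map big_map /pedge /= => ->; apply: eq_big_seq => -[A B] hAB /=.
exact: crosscount_crossterm.
Qed.

End Links.
End DiagramFormula.

(** * Crossing changes *)

Section CrossingChange.
Variable R : realType.
Notation plane := 'rV[R]_2.
Implicit Types (e f : plane * plane) (D : diagram R) (K : link2 R).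

(** [f.1] is the crossing point moved back along [f], so the oriented area is a positive multiple of
    [det_edges e f]. *)
Lemma orient_det e f X : open_segment e.1 e.2 X -> open_segment f.1 f.2 X ->
  clockwise e.1 e.2 f.1 = (det_edges e f < 0).
Proof.
case=> s [_ eX] [t [/andP[t0 _] fX]]; rewrite /clockwise.
have -> : orient e.1 e.2 f.1 = t * det_edges e f.
  have h : f.1 - e.1 = s *: (e.2 - e.1) - t *: (f.2 - f.1).
    have E : (1 - s) *: e.1 + s *: e.2 = (1 - t) *: f.1 + t *: f.2 by rewrite -eX.
    apply/rowP => i; have /rowP/(_ i) := E; rewrite !mxE => h'; lra.
  by rewrite orientE h /det_edges /pcr !mxE; ring.
by rewrite pmulr_rlt0.
Qed.

Lemma diagram_crossterm K D : diagram_of K D -> lk K =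
  - \sum_(e <- edges (line1 D)) \sum_(f <- edges (line2 D)) crossterm D e f.
Proof. by case=> gp [M [hM s1 s2 ho]]; rewrite /lk (lkn_crossterm gp hM s1 s2 ho). Qed.

Lemma diagram_over_sym K D e f : diagram_of K D -> e \in edges (line1 D) ->
  f \in edges (line2 D) -> crossing D e f -> over D f e = ~~ over D e f.
Proof.
case=> gp [M [hM s1 s2 ho]] he hf [_ _ _ [X [oe of_]]].
exact: (over_sym gp hM s1 s2 ho he hf (open_sub oe) (open_sub of_)).
Qed.

Lemma crossing_sym D e f : crossing D e f -> crossing D f e.
Proof.
by case=> h1 h2 h3 [X [h4 h5]]; split=> //; [rewrite eq_sym|exists X].
Qed.

Lemma crossterm_flip D D' e f : crossing D e f ->
  line1 D' = line1 D -> line2 D' = line2 D -> over D' e f = ~~ over D e f ->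
  crossterm D e f - crossterm D' e f =
  (if over D e f then 1 else -1) * sgz (det_edges e f).
Proof.
move=> c l1 l2 oo; have c' : crossing D' e f.
  by case: c => h1 h2 h3 h4; split=> //; rewrite /diagram_edges l1 l2.
rewrite /crossterm !asboolT // oo /=; case: (over D e f) => /=.
  by rewrite subr0 mul1r.
by rewrite sub0r mulN1r.
Qed.

Lemma sum_flip (r r' : seq (plane * plane)) (F G : plane * plane -> plane * plane -> int) e f :
  uniq r -> uniq r' -> e \in r -> f \in r' ->
  (forall g h, g \in r -> h \in r' -> (g, h) != (e, f) -> F g h = G g h) ->
  \sum_(g <- r) \sum_(h <- r') F g h - \sum_(g <- r) \sum_(h <- r') G g h =
  F e f - G e f.
Proof.
move=> ur ur' er fr FG; rewrite (bigD1_seq e) //= [X in _ - X](bigD1_seq e) //=.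
rewrite (bigD1_seq f) //= [\sum_(h <- r') G e h](bigD1_seq f) //=.
have -> : \sum_(h <- r' | h != f) F e h = \sum_(h <- r' | h != f) G e h.
  rewrite big_seq_cond [RHS]big_seq_cond; apply: eq_bigr => h /andP[hr hf].
  by apply: FG => //; rewrite xpair_eqE (negPf hf) andbF.
have -> : \sum_(g <- r | g != e) \sum_(h <- r') F g h =
          \sum_(g <- r | g != e) \sum_(h <- r') G g h.
  rewrite big_seq_cond [RHS]big_seq_cond; apply: eq_bigr => g /andP[gr ge].
  by apply: eq_big_seq => h hr; apply: FG => //; rewrite xpair_eqE (negPf ge).
by ring.
Qed.

(** The sum runs over pairs in [line1] times [line2]: a change at a self-crossing affects no term,
    any other exactly one, [(e, f)] or [(f, e)] according to which edge is on the first line. *)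
Lemma lk_crossing (Kp Km : link2 R) (Dp Dm : diagram R) (e f : edge R) :
  diagram_of Kp Dp -> diagram_of Km Dm -> crossing_change Dp Dm e f ->
  crossing_sign Dp e f = 1 ->
  lk Kp - lk Km = if different_components Dp e f then 1 else 0.
Proof.
move=> dp dm [c l1 l2 [o1 o2] orest] sgn.
rewrite (diagram_crossterm dp) (diagram_crossterm dm) l1 l2 opprK addrC.
have gp : general_position (line1 Dp) (line2 Dp) by case: dp.
have [[u1 u2] s12] : (uniq (line1 Dp) /\ uniq (line2 Dp)) /\ True.
  by case: gp => _ _; rewrite cat_uniq => /and3P[-> _ ->].
have disj g : g \in edges (line1 Dp) -> g \in edges (line2 Dp) -> False.
  by move=> /mem_edges[h1 _] /mem_edges[h2 _]; exact: (gp_disjoint gp h1 h2).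
have same g h : (g, h) != (e, f) -> (g, h) != (f, e) -> crossterm Dp g h = crossterm Dm g h.
  move=> n1 n2; rewrite /crossterm.
  have -> : crossing Dm g h = crossing Dp g h.
    by rewrite /crossing /diagram_edges l1 l2.
  by case: asboolP => // cgh; rewrite orest.
case: (c) => he hf _ [X [oe of_]].
have opp : \sum_(g <- edges (line1 Dp)) \sum_(h <- edges (line2 Dp)) crossterm Dm g h -
  \sum_(g <- edges (line1 Dp)) \sum_(h <- edges (line2 Dp)) crossterm Dp g h =
  if different_components Dp e f then 1 else 0; last by [].
rewrite /different_components.
have [he1|he1] := boolP (e \in edges (line1 Dp)); have [hf1|hf1] := boolP (f \in edges (line1 Dp)) => /=.
- apply/eqP; rewrite subr_eq0; apply/eqP; apply: eq_big_seq => g hg; apply: eq_big_seq => h hh.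
  rewrite same //; apply/negP; rewrite xpair_eqE => /andP[_ /eqP E]; rewrite E in hh.
    exact: disj hf1 hh.
  exact: disj he1 hh.
- have hf2 : f \in edges (line2 Dp) by move: hf; rewrite mem_cat (negPf hf1).
  rewrite (sum_flip (e := e) (f := f)) ?uniq_edges //; last first.
    move=> g h hg hh n1; rewrite same //; apply/negP; rewrite xpair_eqE => /andP[/eqP E _].
    by rewrite E in hg; exact: disj hg hf2.
  rewrite -opprB (crossterm_flip c l1 l2 o1); move: sgn; rewrite /crossing_sign.
  case: (over Dp e f).
    by rewrite (orient_det oe of_); case: ifP => // h _; rewrite ltr0_sgz.
  by rewrite (orient_det of_ oe) det_edges_sym oppr_lt0; case: ifP => // h _; rewrite gtr0_sgz.
- have he2 : e \in edges (line2 Dp) by move: he; rewrite mem_cat (negPf he1).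
  rewrite (sum_flip (e := f) (f := e)) ?uniq_edges //; last first.
    move=> g h hg hh n1; rewrite same //; apply/negP; rewrite xpair_eqE => /andP[/eqP E _].
    by rewrite E in hg; exact: disj hg he2.
  rewrite -opprB (crossterm_flip (crossing_sym c) l1 l2 o2); move: sgn; rewrite /crossing_sign.
  rewrite (diagram_over_sym dp hf1 he2 (crossing_sym c)); case: (over Dp f e) => /=.
    by rewrite (orient_det of_ oe); case: ifP => // h _; rewrite ltr0_sgz.
  by rewrite (orient_det oe of_) det_edges_sym oppr_lt0; case: ifP => // h _; rewrite gtr0_sgz.
- apply/eqP; rewrite subr_eq0; apply/eqP; apply: eq_big_seq => g hg; apply: eq_big_seq => h hh.
  rewrite same //; apply/negP; rewrite xpair_eqE => /andP[/eqP E _]; rewrite E in hg.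
    by rewrite hg in he1.
  by rewrite hg in hf1.
Qed.

End CrossingChange.

(** * Vertex moves of links *)

Section TriangleMoves.
Variable R : realType.
Notation space := 'rV[R]_3.
Implicit Types (A B C D X Y P Q : space) (s o t : seq space).

Definition valid s o : Prop := [/\ is_knot s, is_knot o & carrier s `&` carrier o = set0].

Lemma halfopen_sub A B X : half_open_segment A B X -> segment A B X.
Proof. by case=> t [/andP[t0 t1] ->]; exists t; rewrite t0 ltW. Qed.

Lemma halfopen_start A B : half_open_segment A B A.
Proof. by exists 0; rewrite lexx ltr01 subr0 scale1r scale0r addr0. Qed.

Lemma halfopen_end A B : A != B -> ~ half_open_segment A B B.
Proof.
move=> AB [t [/andP[t0 t1] e]]; have : 1 = t.
  by apply: (segment_paramE AB _ e); rewrite subrr scale0r add0r scale1r.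
by move=> E; rewrite -E ltxx in t1.
Qed.

Lemma carrier_cons2 A C B t :
  carrier [:: A, C, B & t] = segment A C `|` segment C B `|` [set x | exists2 e, e \in arcs B t A & segment e.1 e.2 x].
Proof.
rewrite /carrier edges_cons !arcs_cons; apply/seteqP; split=> x.
  case=> e; rewrite !inE => /or3P[/eqP->|/eqP->|he] hx; [by left; left|by left; right|].
  by right; exists e.
case=> [[hx|hx]|[e he hx]].
- by exists (A, C) => //; rewrite mem_head.
- by exists (C, B) => //; rewrite !inE eqxx orbT.
- by exists e => //; rewrite !inE he !orbT.
Qed.

Lemma carrier_cons1 A B t :
  carrier [:: A, B & t] = segment A B `|` [set x | exists2 e, e \in arcs B t A & segment e.1 e.2 x].
Proof.
rewrite /carrier edges_cons !arcs_cons; apply/seteqP; split=> x.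
  by case=> e; rewrite !inE => /orP[/eqP->|he] hx; [left|right; exists e].
case=> [hx|[e he hx]]; first by exists (A, B) => //; rewrite mem_head.
by exists e => //; rewrite !inE he !orbT.
Qed.

Lemma triangle_vertex A B C : [/\ triangle A B C A, triangle A B C B & triangle A B C C].
Proof.
split; [exists 1, 0, 0|exists 0, 1, 0|exists 0, 0, 1]; split; rewrite ?ler01 ?lexx //;
  rewrite ?addr0 ?add0r // ?scale0r ?scale1r ?addr0 ?add0r //.
Qed.

Lemma segment_triangle A B C : [/\ segment A C `<=` triangle A B C,
  segment C B `<=` triangle A B C & segment A B `<=` triangle A B C].
Proof.
split=> x [t [/andP[t0 t1] ->]]; have t2 : 0 <= 1 - t by lra.
- exists (1 - t), 0, t; split; rewrite ?lexx //; first by rewrite addr0 subrK.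
  by rewrite scale0r addr0.
- exists 0, t, (1 - t); split; rewrite ?lexx //; first by rewrite add0r addrC subrK.
  by rewrite scale0r add0r addrC.
- exists (1 - t), t, 0; split; rewrite ?lexx //; first by rewrite addr0 subrK.
  by rewrite scale0r addr0.
Qed.

(** [arcs B t A] lists the edges outside the triangle; they may touch it at [A] and [B], where they
    are attached. *)
Definition clear A B C t o : Prop :=
  (forall e x, e \in arcs B t A -> segment e.1 e.2 x -> triangle A B C x -> x = A \/ x = B) /\
  (forall x, triangle A B C x -> ~ carrier o x).

Definition noncollinear A B C : Prop := cross (B - A) (C - A) != 0.

Lemma noncollinear_neq A B C : noncollinear A B C -> [/\ A != B, A != C & B != C].
Proof.
rewrite /noncollinear => h; split; apply: contraNneq h => ->.
- by apply/eqP/rowP; apply: ord3P; rewrite !mxE /= ; ring.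
- by apply/eqP/rowP; apply: ord3P; rewrite !mxE /= ; ring.
- by apply/eqP/rowP; apply: ord3P; rewrite !mxE /= ; ring.
Qed.

Lemma noncollinear_comb A B C (b c : R) : noncollinear A B C ->
  b *: (B - A) + c *: (C - A) = 0 -> b = 0 /\ c = 0.
Proof.
move=> h /rowP e; have e0 := e 0; have e1 := e 1; have e2 := e ord_max.
rewrite !mxE in e0 e1 e2.
have aux (x y z x' y' z' : R) : b * x + c * x' = 0 -> b * y + c * y' = 0 ->
    b * (x * y' - y * x') = 0 /\ c * (x * y' - y * x') = 0.
  move=> h1 h2; split.
    rewrite (_ : _ * _ = (b * x + c * x') * y' - (b * y + c * y') * x'); last by ring.
    by rewrite h1 h2 !mul0r subrr.
  rewrite (_ : _ * _ = x * (b * y + c * y') - y * (b * x + c * x')); last by ring.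
  by rewrite h1 h2 !mulr0 subrr.
have [a1 a2] := aux _ _ 0 _ _ 0 e0 e1; have [b1 b2] := aux _ _ 0 _ _ 0 e1 e2.
have [c1 c2] := aux _ _ 0 _ _ 0 e2 e0.
have z (k : R) : k *: cross (B - A) (C - A) = 0 -> k = 0.
  by move/eqP; rewrite scaler_eq0 (negPf h) orbF => /eqP.
by split; apply: z; apply/rowP; apply: ord3P; rewrite !mxE /=.
Qed.

Lemma halfopen_AC A B C X : noncollinear A B C -> half_open_segment A C X ->
  half_open_segment C B X -> False.
Proof.
move=> nc [u [/andP[u0 u1] ->]] [v [/andP[v0 v1] e]].
have [|h1 h2] := @noncollinear_comb A B C v (1 - v - u) nc.
  apply: subr0_eq; rewrite subr0.
  have /rowP E := e; apply/rowP => i; have := E i; rewrite !mxE; clear; lra.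
lra.
Qed.

(** By [clear], a new edge and an old one could meet only at [A] or [B]. In the half-open convention
    [A] belongs only to the edge starting there, and [B] does not belong to the edge ending
    there. *)
Lemma valid_insert A B C t o : valid [:: A, B & t] o -> noncollinear A B C ->
  clear A B C t o -> valid [:: A, C, B & t] o.
Proof.
move=> [[sz us hs] ho dis] nc [cl1 cl2].
have [AB AC BC] := noncollinear_neq nc.
have [sAC sCB sAB] := segment_triangle A B C.
have us' := us; rewrite /= inE negb_or in us'.
case/andP: us' => /andP[_ At] /andP[Bt ut].
have Pe e : e \in arcs B t A -> e \in edges [:: A, B & t].
  by rewrite edges_cons arcs_cons inE => ->; rewrite orbT.
have ABe : (A, B) \in edges [:: A, B & t] by rewrite edges_cons arcs_cons mem_head.
have notA e : e \in arcs B t A -> e <> (A, B).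
  move=> he E; have : uniq (edges [:: A, B & t]) by exact: uniq_edges.
  by rewrite edges_cons arcs_cons /= -E he.
have crossA e X : e \in arcs B t A -> half_open_segment A C X -> half_open_segment e.1 e.2 X -> False.
  move=> he hX eX; have [E|E] := cl1 _ _ he (halfopen_sub eX) (sAC _ (halfopen_sub hX)); subst X.
    apply: (notA _ he); apply: hs (Pe _ he) ABe _.
    by exists A; split=> //; exact: halfopen_start.
  have := halfopen_AC nc hX; case: hX => u [/andP[u0 u1] e1] _.
  have [|_ h2] := @noncollinear_comb A B C (- 1) u nc; last by rewrite h2 in e1; move: AB; rewrite e1 subr0 scale1r scale0r addr0 eqxx.
  have /rowP E := e1; apply/rowP => i; have := E i; rewrite !mxE; clear; lra.
have crossB e X : e \in arcs B t A -> half_open_segment C B X -> half_open_segment e.1 e.2 X -> False.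
  move=> he hX eX; have [E|E] := cl1 _ _ he (halfopen_sub eX) (sCB _ (halfopen_sub hX)); subst X.
    case: hX => u [/andP[u0 u1] e1].
    have [|_ h2] := @noncollinear_comb A B C u (1 - u) nc; last by move: u1 h2; clear; lra.
    by have /rowP E := e1; apply/rowP => i; have := E i; rewrite !mxE; clear; lra.
  by rewrite eq_sym in BC; exact: (halfopen_end BC hX).
have Ct : C \notin t.
  apply/negP => Ct; have /mapP[e he eC] : C \in map fst (arcs B t A).
    rewrite /arcs -/unzip1 unzip1_zip ?size_rcons // inE Ct orbT //.
  have [] := cl1 e C he; rewrite ?eC; first exact: (proj1 (segment_ends _ _)).
  - by case: (triangle_vertex A B e.1).
  - by move=> E; rewrite eC E eqxx in AC.
  - by move=> E; rewrite eC E eqxx in BC.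
split=> //.
- split=> //=.
  + by rewrite !inE !negb_or AC AB At (eq_sym C) BC Ct Bt ut.
  + move=> e f; rewrite edges_cons !arcs_cons !inE.
    move=> /or3P[/eqP->|/eqP->|he] /or3P[/eqP->|/eqP->|hf] [X [h1 h2]] //=.
    * by case: (halfopen_AC nc h1 h2).
    * by case: (crossA _ _ hf h1 h2).
    * by case: (halfopen_AC nc h2 h1).
    * by case: (crossB _ _ hf h1 h2).
    * by case: (crossA _ _ he h2 h1).
    * by case: (crossB _ _ he h2 h1).
    * by apply: hs (Pe _ he) (Pe _ hf) _; exists X.
- apply/seteqP; split=> // x; rewrite carrier_cons2 => -[[[h|h]|h] xo].
  + by case: (cl2 x (sAC _ h)).
  + by case: (cl2 x (sCB _ h)).
  + by rewrite -dis; split=> //; rewrite carrier_cons1; right.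
Qed.

Lemma valid_remove A B C t o : valid [:: A, C, B & t] o -> noncollinear A B C ->
  t != [::] -> clear A B C t o -> valid [:: A, B & t] o.
Proof.
move=> [[sz us hs] ho dis] nc t0 [cl1 cl2].
have [AB AC BC] := noncollinear_neq nc.
have [sAC sCB sAB] := segment_triangle A B C.
have Pe e : e \in arcs B t A -> e \in edges [:: A, C, B & t].
  by rewrite edges_cons !arcs_cons !inE => ->; rewrite !orbT.
have ACe : (A, C) \in edges [:: A, C, B & t] by rewrite edges_cons arcs_cons mem_head.
have notA e : e \in arcs B t A -> e <> (A, C).
  move=> he E; have : uniq (edges [:: A, C, B & t]) by exact: uniq_edges.
  by rewrite edges_cons !arcs_cons /= inE -E he orbT.
have crossA e X : e \in arcs B t A -> half_open_segment A B X -> half_open_segment e.1 e.2 X -> False.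
  move=> he hX eX; have [E|E] := cl1 _ _ he (halfopen_sub eX) (sAB _ (halfopen_sub hX)); subst X.
    apply: (notA _ he); apply: hs (Pe _ he) ACe _.
    by exists A; split=> //; exact: halfopen_start.
  exact: (halfopen_end AB hX).
split=> //.
- split.
  + by case: t t0 {us sz hs dis cl1 Pe ACe notA crossA}.
  + by move: us => /= /and3P[]; rewrite !inE !negb_or => /and3P[_ -> ->] _ ->.
  + move=> e f; rewrite edges_cons !arcs_cons !inE.
    move=> /orP[/eqP->|he] /orP[/eqP->|hf] [X [h1 h2]] //=.
    * by case: (crossA _ _ hf h1 h2).
    * by case: (crossA _ _ he h2 h1).
    * by apply: hs (Pe _ he) (Pe _ hf) _; exists X.
- apply/seteqP; split=> // x; rewrite carrier_cons1 => -[[h|h] xo].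
  + by case: (cl2 x (sAB _ h)).
  + by rewrite -dis; split=> //; rewrite carrier_cons2; right.
Qed.

Lemma valid_rot m s o : valid s o -> valid (rot m s) o.
Proof.
case=> [[sz us hs] ho dis]; split=> //; last by rewrite carrier_rot.
by split; rewrite ?size_rot ?rot_uniq // => e f; rewrite !mem_edges_rot; exact: hs.
Qed.

Lemma valid_sym s o : valid s o -> valid o s.
Proof. by case=> h1 h2 h3; split=> //; rewrite setIC. Qed.

Lemma clear_move A B C t o : clear A B C t o ->
  triangle_move [:: A, C, B & t] [:: A, B & t] o.
Proof.
move=> [cl1 cl2]; exists A, C, B, t; split=> //.
have [sAC sCB sAB] := segment_triangle A B C.
apply/seteqP; split=> x.
  case=> -[]; rewrite ?carrier_cons2; last by move=> xo /cl2.
  case=> [//|[e he ex] xT]; have [->|->] := cl1 _ _ he ex xT.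
    by left; exact: (proj1 (segment_ends _ _)).
  by right; exact: (proj2 (segment_ends _ _)).
move=> h; split; last by case: h; [exact: sAC|exact: sCB].
by left; rewrite carrier_cons2; left.
Qed.

End TriangleMoves.

(** * Invariants insensitive to crossing changes *)

Section Invariants.
Variable R : realType.
Notation space := 'rV[R]_3.
Implicit Types (A B C D X Y P Q : space) (s o t : seq space) (K : link2 R).

(* The difference of two functions satisfying the axioms of lk. *)
Definition null_invariant (g : link2 R -> int) : Prop :=
  [/\ forall K K', isotopic K K' -> g K = g K',
      forall K, trivial_link K -> g K = 0 &
      forall (Kp Km : link2 R) (Dp Dm : diagram R) (e f : edge R),
        diagram_of Kp Dp -> diagram_of Km Dm -> crossing_change Dp Dm e f ->
        crossing_sign Dp e f = 1 -> crossing_sign Dm e f = -1 -> g Kp = g Km].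

Variable g : link2 R -> int.

Definition mklink s o (h : valid s o) : link2 R :=
  let: And3 h1 h2 h3 := h in Link2 h1 h2 h3.

(** Vertex moves are described on sequences, before these are known to form a link; [0] is a default
    for the others. *)
Definition value s o : int :=
  if pselect (valid s o) is left h then g (mklink h) else 0.

Lemma valueE s o (h : valid s o) : value s o = g (mklink h).
Proof.
rewrite /value; case: pselect => // h'; congr (g (mklink _)).
exact: Prop_irrelevance.
Qed.

Lemma valueK K : g K = value (comp1 K) (comp2 K).
Proof.
have h : valid (comp1 K) (comp2 K) by case: K.
by rewrite (valueE h); congr g; case: K h => s o h1 h2 h3 [h1' h2' h3'] /=;
   congr Link2; exact: Prop_irrelevance.
Qed.

Hypothesis hg : null_invariant g.

Lemma isotopic_move K K' : same_link K K' \/ elementary_move K K' -> isotopic K K'.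
Proof. exact: Relation_Operators.rst_step. Qed.

Lemma value_rot m s o : valid s o -> value (rot m s) o = value s o.
Proof.
move=> h; rewrite (valueE h) (valueE (valid_rot m h)); case: hg => iso _ _.
apply/esym/iso/isotopic_move; left; exists m, 0%N.
by case: h (valid_rot m h) => ? ? ? [? ? ?] /=; rewrite rot0.
Qed.

Lemma value_tri A B C t o : valid [:: A, C, B & t] o -> valid [:: A, B & t] o ->
  clear A B C t o -> value [:: A, C, B & t] o = value [:: A, B & t] o.
Proof.
move=> h1 h2 cl; rewrite (valueE h1) (valueE h2); case: hg => iso _ _.
apply/iso/isotopic_move; right; left.
by case: h1 h2 => ? ? ? [? ? ?] /=; split=> //; exact: clear_move.
Qed.

(* A vertex move is the composition of two triangle moves. *)
Lemma value_vertex A B C C' t o : valid [:: A, C, B & t] o ->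
  noncollinear A C C' -> noncollinear C' B C ->
  clear A C C' (B :: t) o -> clear C' B C (rcons t A) o ->
  valid [:: A, C', B & t] o /\ value [:: A, C, B & t] o = value [:: A, C', B & t] o.
Proof.
move=> v nc1 nc2 cl1 cl2.
(* [C'] is inserted between [A] and [C], then [C] is removed between [C'] and [B]; rotations bring
   the relevant edge to the head. *)
have v1 := valid_insert v nc1 cl1.
have v2 := valid_rot 1 v1; rewrite rot1_cons /= in v2.
have v3 : valid [:: C', B & rcons t A] o by apply: valid_remove v2 nc2 _ cl2; case: (t).
have := valid_rot (size t).+2 v3.
have rE : rot (size t).+2 [:: C', B & rcons t A] = [:: A, C', B & t].
  have -> : [:: C', B & rcons t A] = [:: C', B & t] ++ [:: A] by rewrite /= cats1.
  exact: (rot_size_cat [:: C', B & t] [:: A]).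
rewrite rE => v4; split; first exact: v4.
rewrite -(value_tri v1 v cl1) -(value_rot 1 v1) rot1_cons /= (value_tri v2 v3 cl2).
by rewrite -rE value_rot.
Qed.

End Invariants.

(** * General position in space *)

Section SpatialPosition.
Variable R : realType.
Notation space := 'rV[R]_3.
Implicit Types (A B C D X Y Z W P Q N : space) (s o t V : seq space).

Definition vol X Y Z W : R := det3 (Y - X) (Z - X) (W - X).

Lemma vol_rot X Y Z W : vol Y Z W X = - vol X Y Z W.
Proof. by rewrite /vol /det3 !mxE; ring. Qed.

Lemma vol_swap X Y Z W : vol Y X Z W = - vol X Y Z W.
Proof. by rewrite /vol /det3 !mxE; ring. Qed.

Lemma vol_swap23 X Y Z W : vol X Z Y W = - vol X Y Z W.
Proof. by rewrite /vol /det3 !mxE; ring. Qed.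

Lemma vol_swap34 X Y Z W : vol X Y W Z = - vol X Y Z W.
Proof. by rewrite /vol /det3 !mxE; ring. Qed.

Lemma vol_neq12 X Y Z W : (vol Y X Z W != 0) = (vol X Y Z W != 0).
Proof. by rewrite vol_swap oppr_eq0. Qed.

Lemma vol_neq23 X Y Z W : (vol X Z Y W != 0) = (vol X Y Z W != 0).
Proof. by rewrite vol_swap23 oppr_eq0. Qed.

Lemma vol_neq34 X Y Z W : (vol X Y W Z != 0) = (vol X Y Z W != 0).
Proof. by rewrite vol_swap34 oppr_eq0. Qed.

Lemma vol_affine X Y Z (a b c : R) A B C : a + b + c = 1 ->
  vol (a *: A + b *: B + c *: C) X Y Z = a * vol A X Y Z + b * vol B X Y Z + c * vol C X Y Z.
Proof.
move=> h; have {h}-> : a = 1 - b - c by lra.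
by rewrite /vol /det3 !mxE; ring.
Qed.

Lemma vol_segment X Y Z A B (t : R) :
  vol ((1 - t) *: A + t *: B) X Y Z = (1 - t) * vol A X Y Z + t * vol B X Y Z.
Proof. by rewrite /vol /det3 !mxE; ring. Qed.

Definition gen V : Prop :=
  [/\ uniq V,
      forall X Y Z, X \in V -> Y \in V -> Z \in V -> uniq [:: X; Y; Z] -> noncollinear X Y Z &
      forall X Y Z W, X \in V -> Y \in V -> Z \in V -> W \in V ->
        uniq [:: X; Y; Z; W] -> vol X Y Z W != 0].

Lemma gen_sub V V' : uniq V' -> {subset V' <= V} -> gen V -> gen V'.
Proof.
move=> u S [_ h1 h2]; split=> // [X Y Z /S ? /S ? /S ?|X Y Z W /S ? /S ? /S ? /S ?].
  exact: h1.
exact: h2.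
Qed.

Lemma gen_perm V V' : perm_eq V V' -> gen V -> gen V'.
Proof.
move=> p g; apply: gen_sub (g) => [|x]; last by rewrite (perm_mem p).
by rewrite -(perm_uniq p); case: g.
Qed.

Lemma segment_disjoint P Q P' Q' X : vol P Q P' Q' != 0 ->
  segment P Q X -> segment P' Q' X -> False.
Proof.
move=> /eqP v [a [_ eX]] [b [_ eX']]; apply: v.
have : vol X Q P' Q' = 0 by rewrite eX' /vol /det3 !mxE; ring.
rewrite {1}eX vol_segment => h1.
have : vol P X P' Q' = 0 by rewrite eX' /vol /det3 !mxE; ring.
rewrite vol_swap {1}eX vol_segment => h2.
have z1 : vol Q Q P' Q' = 0 by rewrite /vol /det3 !mxE; ring.
have z2 : vol P P P' Q' = 0 by rewrite /vol /det3 !mxE; ring.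
rewrite z1 in h1; rewrite z2 (vol_swap P Q) in h2.
move: h1 h2; clear; move=> h1 h2; lra.
Qed.

Lemma triangleC A B C : triangle B A C = triangle A B C.
Proof.
by apply/seteqP; split=> x [a [b [c [a0 b0 c0 s1 ->]]]];
  exists b, a, c; split=> //; by [rewrite (addrC b) | congr (_ + _); exact: addrC].
Qed.

Lemma triangle_segment_vertex A B C Q X : vol A B C Q != 0 ->
  triangle A B C X -> segment A Q X -> X = A.
Proof.
move=> v [a [b [c [_ _ _ s1 eX]]]] [t [_ eX']].
have : vol X A B C = 0 by rewrite eX vol_affine // /vol /det3 !mxE; ring.
rewrite {1}eX' vol_segment => h.
have z : vol A A B C = 0 by rewrite /vol /det3 !mxE; ring.
rewrite z vol_rot vol_rot vol_rot in h.
have t0 : t = 0.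
  have /eqP : t * vol A B C Q = 0 by move: h; clear; lra.
  by rewrite mulf_eq0 (negPf v) orbF => /eqP.
by rewrite eX' t0 subr0 scale1r scale0r addr0.
Qed.

(** Edges with four different ends are disjoint because their volume is nonzero; consecutive edges
    are not collinear, so they share only a vertex, which one of the half-open edges omits. *)
Lemma gen_knot V s : gen V -> {subset s <= V} -> uniq s -> (2 < size s)%N -> is_knot s.
Proof.
move=> [_ g3 g4] S us sz; split=> // e f he hf [X [hX hX']].
have [e1 e2] := mem_edges he; have [f1 f2] := mem_edges hf.
have ne := edges_neq us (ltnW sz) he; have nf := edges_neq us (ltnW sz) hf.
have [E|n11] := eqVneq e.1 f.1; first exact: (edges_inj1 us he hf E).
have [E|n22] := eqVneq e.2 f.2; first exact: (edges_inj2 us he hf E).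
have share (p q : space * space) : p \in edges s -> q \in edges s -> q.2 = p.1 ->
    half_open_segment p.1 p.2 X -> half_open_segment q.1 q.2 X -> False.
  move=> hp hq E [u [/andP[u0 u1] eX]] [w [/andP[w0 w1] eX']].
  have [p1 p2] := mem_edges hp; have [q1 q2] := mem_edges hq.
  have np := edges_neq us (ltnW sz) hp; have nq := edges_neq us (ltnW sz) hq.
  have npq : q.1 != p.2.
    apply/eqP => F; have := @edges_flip _ _ s p.1 p.2 us sz.
    by rewrite -surjective_pairing => /(_ hp); rewrite -F -E -surjective_pairing hq.
  have nc : noncollinear p.1 p.2 q.1.
    by apply: g3; rewrite ?S //= !inE negb_or np -E (eq_sym q.2) nq eq_sym npq.
  have [|_ h2] := @noncollinear_comb _ p.1 p.2 q.1 u (- (1 - w)) nc.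
    apply: subr0_eq; have /rowP h : X = X by []; rewrite {1}eX eX' E in h.
    by apply/rowP => i; have := h i; rewrite !mxE; clear; lra.
  by move: h2 w1; clear; lra.
have [E|n12] := eqVneq e.1 f.2; first by case: (share e f he hf (esym E) hX hX').
have [E|n21] := eqVneq e.2 f.1; first by case: (share f e hf he E hX' hX).
exfalso; apply: (@segment_disjoint e.1 e.2 f.1 f.2 X _ (halfopen_sub hX) (halfopen_sub hX')).
by apply: g4; rewrite ?S //= !inE !negb_or ne n11 n12 n21 n22 nf.
Qed.

Lemma gen_valid s o : gen (s ++ o) -> (2 < size s)%N -> (2 < size o)%N -> valid s o.
Proof.
move=> g s2 o2; have [u g3 g4] := g; move: u; rewrite cat_uniq => /and3P[us /hasPn h uo].
have Ss : {subset s <= s ++ o} by move=> x hx; rewrite mem_cat hx.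
have So : {subset o <= s ++ o} by move=> x hx; rewrite mem_cat hx orbT.
split; [exact: gen_knot g Ss us s2|exact: gen_knot g So uo o2|].
apply/seteqP; split=> // X [[e he hX] [f hf hX']].
have [e1 e2] := mem_edges he; have [f1 f2] := mem_edges hf.
have ne := edges_neq us (ltnW s2) he; have nf := edges_neq uo (ltnW o2) hf.
have d x y : x \in s -> y \in o -> x != y.
  by move=> hx hy; apply: contraTneq hx => ->; exact: h.
exfalso; apply: (@segment_disjoint e.1 e.2 f.1 f.2 X _ hX hX').
by apply: g4; rewrite ?mem_cat ?e1 ?e2 ?f1 ?f2 ?orbT //= !inE !negb_or ne (d _ _ e1 f1) (d _ _ e1 f2)
  (d _ _ e2 f1) (d _ _ e2 f2) nf.
Qed.

Lemma arcs_rcons A s B C : arcs A (rcons s B) C = rcons (arcs A s B) (B, C).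
Proof. by rewrite /arcs -rcons_cons zip_rcons // size_rcons. Qed.

Lemma mem_arcs A s B e : e \in arcs A s B -> e.1 \in A :: s /\ e.2 \in rcons s B.
Proof.
move=> h; split.
  by rewrite -(unzip1_zip (s := A :: s) (t := rcons s B)) ?size_rcons // map_f.
by rewrite -(unzip2_zip (s := A :: s) (t := rcons s B)) ?size_rcons // map_f.
Qed.

Variable g : link2 R -> int.
Hypothesis hg : null_invariant g.

(* A vertex move C -> C' which sweeps no edge is an isotopy. *)
Lemma value_sweep A B C C' t o : valid [:: A, C, B & t] o ->
  noncollinear A C C' -> noncollinear C' B C ->
  (forall X Y, X \in [:: A, B & t] -> Y \in [:: A, B & t] -> X != Y -> vol C C' X Y != 0) ->
  (forall N e x, N \in [:: A; B] -> (e \in arcs B t A) || (e \in edges o) -> e.1 != N -> e.2 != N ->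
     triangle N C C' x -> segment e.1 e.2 x -> False) ->
  valid [:: A, C', B & t] o /\
  value g [:: A, C, B & t] o = value g [:: A, C', B & t] o.
Proof.
move=> v nc1 nc2 hv off; have [[sz us _] _ dis] := v.
have us' := us; rewrite /= !inE !negb_or in us'.
case/and3P: us' => /and3P[AC AB At] /andP[CB Ct] /andP[Bt ut].
have inO e (x : space) : e \in edges o -> e.1 \notin [:: A, C, B & t] /\ e.2 \notin [:: A, C, B & t].
  move=> he; have dj y : y \in [:: A, C, B & t] -> y \in o -> False.
    move=> ys yo; have /mapP[p hp ep] : y \in map fst (edges [:: A, C, B & t]) by rewrite edges1.
    have /mapP[q hq eq] : y \in map fst (edges o) by rewrite edges1.
    have : (carrier [:: A, C, B & t] `&` carrier o) y.
      split; [exists p => //; rewrite ep|exists q => //; rewrite eq]; exact: (proj1 (segment_ends _ _)).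
    by rewrite dis.
  by have [h1 h2] := mem_edges he; split; apply/negP => h; apply: (dj _ h).
apply: value_vertex => //; split.
- move=> e x; rewrite arcs_cons inE => /orP[/eqP->|he] ex xT /=.
    right; apply: (@triangle_segment_vertex C A C' B) ex; last by rewrite triangleC.
    rewrite vol_neq23; apply: hv; rewrite ?inE ?eqxx ?orbT //.
  have [h1 h2] := mem_arcs he.
  have nA : e.1 != A by apply: contraTneq h1 => ->; rewrite inE negb_or AB.
  have [eA|neA] := eqVneq e.2 A.
    left; rewrite eA segmentC in ex; apply: (@triangle_segment_vertex A C C' e.1) xT ex.
    rewrite vol_neq12 vol_neq23.
    by apply: hv; rewrite ?inE ?eqxx //; [move: h1; rewrite inE => ->; rewrite orbT|rewrite eq_sym].
  by case: (off A e x _ _ nA neA xT ex); rewrite ?he ?inE ?eqxx.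
- move=> x xT [e he ex]; have [h1 h2] := inO e x he.
  by case: (off A e x _ _ _ _ xT ex); rewrite ?he ?orbT ?inE ?eqxx //;
    [apply: contraNneq h1 => ->|apply: contraNneq h2 => ->]; rewrite mem_head.
- move=> e x; rewrite arcs_rcons mem_rcons inE => /orP[/eqP->|he] ex xT /=.
    left; rewrite segmentC in ex; apply: (@triangle_segment_vertex C' B C A) xT ex.
    by rewrite vol_neq23 vol_neq12; apply: hv; rewrite ?inE ?eqxx ?orbT // eq_sym.
  have [h1 h2] := mem_arcs he.
  have xT' : triangle B C C' x by rewrite triangleAC -triangleC.
  have nB : e.2 != B by apply: contraTneq h2 => ->; rewrite mem_rcons inE negb_or eq_sym AB.
  have [eB|neB] := eqVneq e.1 B.
    right; rewrite eB in ex; apply: (@triangle_segment_vertex B C C' e.2) xT' ex.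
    rewrite vol_neq12 vol_neq23; apply: hv; rewrite ?[B == _]eq_sym //.
      by rewrite !inE eqxx orbT.
    by move: h2; rewrite mem_rcons !inE (negPf nB).
  by case: (off B e x _ _ neB nB xT' ex); rewrite ?he ?inE ?eqxx ?orbT.
- move=> x xT [e he ex]; have [h1 h2] := inO e x he.
  have xT' : triangle B C C' x by rewrite triangleAC -triangleC.
  by case: (off B e x _ _ _ _ xT' ex); rewrite ?he ?orbT ?inE ?eqxx ?orbT //;
    [apply: contraNneq h1 => ->|apply: contraNneq h2 => ->]; rewrite !inE eqxx !orbT.
Qed.

End SpatialPosition.

(** * Vertex moves along the line of sight *)

Section VerticalMove.
Variable R : realType.
Notation space := 'rV[R]_3.
Notation plane := 'rV[R]_2.
Implicit Types (A B C D X Y Z W P Q N : space) (s o t V : seq space).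

Lemma no_double_cross (A B C D X Y : plane) : orient A B C != 0 ->
  open_segment A B X -> open_segment C D X ->
  open_segment A C Y -> open_segment B D Y -> False.
Proof.
move=> /eqP o0 [a [/andP[a0 a1] eX]] [c [/andP[c0 c1] eX']] [b [/andP[b0 b1] eY]] [d [/andP[d0 d1] eY']].
(* Eliminating [D] from the equations of the two crossings leaves [k] times [B - A] plus [l] times
   [C - A] equal to zero, with [k] positive. *)
apply: o0; pose k := d * a + c * (1 - d); pose l := - (d * (1 - c) + c * b).
have k0 : 0 < k by rewrite /k addr_gt0 // mulr_gt0 // subr_gt0.
have h i : k * (B 0 i - A 0 i) + l * (C 0 i - A 0 i) = 0.
  have /rowP/(_ i) e1 : (1 - a) *: A + a *: B - ((1 - c) *: C + c *: D) = 0 by rewrite -eX -eX' subrr.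
  have /rowP/(_ i) e2 : (1 - b) *: A + b *: C - ((1 - d) *: B + d *: D) = 0 by rewrite -eY -eY' subrr.
  rewrite !mxE in e1 e2.
  transitivity (d * ((1 - a) * A 0 i + a * B 0 i - ((1 - c) * C 0 i + c * D 0 i))
    - c * ((1 - b) * A 0 i + b * C 0 i - ((1 - d) * B 0 i + d * D 0 i))).
    by rewrite /k /l; ring.
  by rewrite e1 e2 !mulr0 subrr.
apply: (mulfI (lt0r_neq0 k0)); rewrite mulr0 /orient.
rewrite [LHS](_ : _ = (k * (B 0 0 - A 0 0) + l * (C 0 0 - A 0 0)) * (C 0 1 - A 0 1)
  - (k * (B 0 1 - A 0 1) + l * (C 0 1 - A 0 1)) * (C 0 0 - A 0 0)); last by ring.
by rewrite !h !mul0r subrr.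
Qed.

Lemma open_share (A B C T : plane) : orient A B C != 0 ->
  open_segment A B T -> open_segment A C T -> False.
Proof.
move=> /eqP o0 [a [/andP[a0 a1] ea]] [b [/andP[b0 b1] eb]]; apply: o0.
have h i : a * (B 0 i - A 0 i) = b * (C 0 i - A 0 i).
  have /rowP/(_ i) : (1 - a) *: A + a *: B = (1 - b) *: A + b *: C by rewrite -ea.
  by rewrite !mxE => h; lra.
apply: (mulfI (lt0r_neq0 a0)); rewrite mulr0 /orient mulrBr !mulrA !h; ring.
Qed.

Section PassVol.
Variables (M : 'M[R]_3) (s o : seq space).
Hypotheses (hM : is_frame M) (us : uniq s) (uo : uniq o)
  (gp : general_position (map (project M) s) (map (project M) o)).

Lemma project_inj : {in s ++ o &, injective (project M)}.
Proof. by apply: uniq_map_inj; case: gp => _ _; rewrite map_cat. Qed.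

Lemma project_collinear X Y Z : X \in s ++ o -> Y \in s ++ o -> Z \in s ++ o -> X != Y ->
  segment (project M X) (project M Y) (project M Z) -> Z = X \/ Z = Y.
Proof.
move=> hX hY hZ XY hs.
have m P : P \in s ++ o -> project M P \in map (project M) s ++ map (project M) o.
  by move=> h; rewrite -map_cat map_f.
have ne : project M X != project M Y by apply: contra XY => /eqP /project_inj -> .
by case: (gp_orient gp (m _ hX) (m _ hY) (m _ hZ) ne hs) => /project_inj -> //; [left|right].
Qed.

Lemma project_orient X Y Z : X \in s ++ o -> Y \in s ++ o -> Z \in s ++ o ->
  uniq [:: X; Y; Z] -> orient (project M X) (project M Y) (project M Z) != 0.
Proof.
move=> hX hY hZ u.
have m P : P \in s ++ o -> project M P \in map (project M) s ++ map (project M) o.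
  by move=> h; rewrite -map_cat map_f.
case: gp => _ _ _ h _; apply: h; rewrite ?m //.
rewrite -[[:: _; _; _]]/(map (project M) [:: X; Y; Z]) map_inj_in_uniq //.
by move=> x y; rewrite !inE => /or3P[]/eqP-> /or3P[]/eqP->; apply: project_inj.
Qed.

Lemma mem_edges_cat (e : space * space) : e \in edges s ++ edges o ->
  [/\ e.1 \in s ++ o, e.2 \in s ++ o & e.1 != e.2].
Proof.
have [s2 o2] : (2 < size s)%N /\ (2 < size o)%N by case: gp; rewrite !size_map.
rewrite mem_cat !mem_cat => /orP[] he; have [-> ->] := mem_edges he; rewrite ?orbT.
  by rewrite (edges_neq us (ltnW s2) he).
by rewrite (edges_neq uo (ltnW o2) he).
Qed.

Lemma edge_above p e : p \in edges s ++ edges o -> e \in edges s ++ edges o ->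
  project M @` segment p.1 p.2 `<=` segment (project M e.1) (project M e.2) ->
  segment p.1 p.2 = segment e.1 e.2.
Proof.
move=> /mem_edges_cat[p1 p2 pn] /mem_edges_cat[e1 e2 en]; rewrite project_segment => h.
have [h1 h2] : (p.1 = e.1 \/ p.1 = e.2) /\ (p.2 = e.1 \/ p.2 = e.2).
  split; apply: project_collinear => //; apply: h; apply/segmentE.
    by exists 0; rewrite lexx ler01 scale0r addr0.
  by exists 1; rewrite lexx ler01 scale1r addrC subrK.
case: h1 h2 pn => -> [] ->; rewrite ?eqxx // segmentC //.
Qed.

(** For points of the edges with [P - Q = k *: axis M], the volume is [k] times the determinant of
    the two directions with the axis. Comparing the two signs therefore tells which edge is
    higher. *)
Lemma pass_vol p q (X : plane) : p \in edges s ++ edges o -> q \in edges s ++ edges o ->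
  open_segment (project M p.1) (project M p.2) X ->
  open_segment (project M q.1) (project M q.2) X ->
  det3 (p.2 - p.1) (q.2 - q.1) (axis M) != 0 ->
  (pass_above M (edges s ++ edges o) (pedge M p) (pedge M q) <->
   0 < vol p.1 p.2 q.1 q.2 * det3 (p.2 - p.1) (q.2 - q.1) (axis M)).
Proof.
move=> hp hq pX qX D0.
have key P Q k : segment p.1 p.2 P -> segment q.1 q.2 Q -> P - Q = k *: axis M ->
    (0 < vol p.1 p.2 q.1 q.2 * det3 (p.2 - p.1) (q.2 - q.1) (axis M)) = (0 < k).
  move=> [a [_ eP]] [b [_ eQ]] PQ.
  have -> : vol p.1 p.2 q.1 q.2 = k * det3 (p.2 - p.1) (q.2 - q.1) (axis M).
    have -> : k * det3 (p.2 - p.1) (q.2 - q.1) (axis M) = det3 (p.2 - p.1) (q.2 - q.1) (P - Q).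
      by rewrite PQ /det3 !mxE; ring.
    by rewrite eP eQ /vol /det3 !mxE; ring.
  by rewrite -mulrA pmulr_lgt0 // -expr2 exprn_even_gt0.
split.
- case=> p' [q' [P [Q [hp' hq' hpp hqq [hP hQ PQ hh]]]]].
  rewrite (edge_above hp' hp hpp) in hP; rewrite (edge_above hq' hq hqq) in hQ.
  by rewrite (key _ _ _ hP hQ (project_axis hM PQ)) subr_gt0.
- case: pX => a [/andP[a0 a1] eX]; case: qX => b [/andP[b0 b1] eX'].
  pose P := (1 - a) *: p.1 + a *: p.2; pose Q := (1 - b) *: q.1 + b *: q.2.
  have hP : segment p.1 p.2 P by exists a; rewrite !ltW.
  have hQ : segment q.1 q.2 Q by exists b; rewrite !ltW.
  have PQ : project M P = project M Q by rewrite /P /Q !project_lin -eX -eX'.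
  rewrite (key _ _ _ hP hQ (project_axis hM PQ)) subr_gt0 => hh.
  by exists p, q, P, Q; split=> //; rewrite project_segment.
Qed.
End PassVol.

Section Base.
Variables (M : 'M[R]_3) (C C' : space) (r o : seq space).
Hypotheses (hM : is_frame M) (CC' : C != C') (pC : project M C' = project M C)
  (gp : general_position (map (project M) (C :: r)) (map (project M) o))
  (g1 : gen ((C :: r) ++ o)) (g2 : gen ((C' :: r) ++ o)).

Let V := (C :: r) ++ o.
Definition slide x := if x == C then C' else x.

Lemma slide_project x : project M (slide x) = project M x.
Proof. by rewrite /slide; case: eqP => [->|]. Qed.

Let uV : uniq V. Proof. by case: g1. Qed.
Let uV' : uniq ((C' :: r) ++ o). Proof. by case: g2. Qed.

Lemma slide_id x : x \in r ++ o -> slide x = x.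
Proof.
move=> h; rewrite /slide; case: eqP => // E.
by move: uV; rewrite /V /= -E h.
Qed.

Lemma slide_map : map slide (C :: r) = C' :: r /\ map slide o = o.
Proof.
split.
  rewrite /= {1}/slide eqxx; congr (_ :: _).
  by rewrite -[RHS]map_id; apply/eq_in_map => x hx; rewrite slide_id // mem_cat hx.
by rewrite -[RHS]map_id; apply/eq_in_map => x hx; rewrite slide_id // mem_cat hx orbT.
Qed.

Let E := edges (C :: r) ++ edges o.
Let E' := edges (C' :: r) ++ edges o.

Lemma slide_edges : E' = map (fun e => (slide e.1, slide e.2)) E.
Proof.
by rewrite /E /E' map_cat -!edges_map (proj1 slide_map) (proj2 slide_map).
Qed.

Lemma gp' : general_position (map (project M) (C' :: r)) (map (project M) o).
Proof. by rewrite /= pC. Qed.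

Let sz : (2 < size (C :: r))%N /\ (2 < size o)%N.
Proof. by case: gp; rewrite !size_map. Qed.

Let us : uniq (C :: r). Proof. by move: uV; rewrite /V cat_uniq => /and3P[]. Qed.
Let us' : uniq (C' :: r). Proof. by move: uV'; rewrite cat_uniq => /and3P[]. Qed.
Let uo : uniq o. Proof. by move: uV; rewrite /V cat_uniq => /and3P[]. Qed.

Lemma valid1 : valid (C :: r) o. Proof. by case: sz; exact: gen_valid. Qed.
Lemma valid2 : valid (C' :: r) o. Proof. by case: sz => *; apply: gen_valid. Qed.

Definition flips X Y Z W := vol X Y Z W * vol (slide X) (slide Y) (slide Z) (slide W) < 0.

Definition crossing4 X Y Z W := exists T : plane,
  open_segment (project M X) (project M Y) T /\ open_segment (project M Z) (project M W) T.

Lemma slide_det X Y Z W :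
  det3 (slide Y - slide X) (slide W - slide Z) (axis M) = det3 (Y - X) (W - Z) (axis M).
Proof. by rewrite -!pcr_project // !projectB !slide_project. Qed.

Lemma crossing_det X Y Z W : X \in V -> Y \in V -> Z \in V -> W \in V ->
  uniq [:: X; Y; Z; W] -> crossing4 X Y Z W -> det3 (Y - X) (W - Z) (axis M) != 0.
Proof.
move=> hX hY hZ hW u [T [[a [_ ea]] [b [_ eb]]]].
have : orient (project M X) (project M Y) (project M Z) != 0.
  apply: (project_orient gp) => //.
  by move: u; rewrite /= !inE !negb_or => /and4P[/and3P[-> -> _] /andP[-> _] _ _].
apply: contraNneq => D0; rewrite orientE -pcr_project // !projectB in D0 *.
have e : project M Z - project M X = a *: (project M Y - project M X) - b *: (project M W - project M Z).
  have /rowP h : (1 - a) *: project M X + a *: project M Y = (1 - b) *: project M Z + b *: project M W by rewrite -ea.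
  by apply/rowP => i; have := h i; rewrite !mxE => h'; lra.
rewrite e; apply/eqP; rewrite -[RHS](mulr0 (- b)) -D0 /pcr !mxE; ring.
Qed.

Lemma E_inj1 (e f : space * space) : e \in E -> f \in E -> e.1 = f.1 -> e = f.
Proof.
have uE : uniq (map fst E) by rewrite map_cat !edges1.
exact: uniq_map_inj.
Qed.

Lemma E_inj2 (e f : space * space) : e \in E -> f \in E -> e.2 = f.2 -> e = f.
Proof.
have uE : uniq (map snd E).
  by rewrite map_cat !edges2; rewrite (perm_uniq (s2 := V)) // /V perm_cat // perm_rot.
exact: uniq_map_inj.
Qed.

Lemma E_flip (p q : space * space) : p \in E -> q \in E -> p.1 = q.2 -> p.2 = q.1 -> False.
Proof.
move=> hp hq h1 h2; have Ep : p = (p.1, p.2) by case: (p).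
have Eq : q = (p.2, p.1) by rewrite h1 h2; case: (q).
move: hp hq; rewrite {1}Ep Eq /E !mem_cat => /orP[] hp /orP[] hq.
- by have := edges_flip us (proj1 sz) hp; rewrite hq.
- have [a1 _] := mem_edges hp; have [_ a2] := mem_edges hq.
  by move: uV; rewrite /V cat_uniq => /and3P[_ /hasPn/(_ _ a2) + _]; rewrite /= a1.
- have [a1 _] := mem_edges hp; have [_ a2] := mem_edges hq.
  by move: uV; rewrite /V cat_uniq => /and3P[_ /hasPn/(_ _ a1) + _]; rewrite /= a2.
- by have := edges_flip uo (proj2 sz) hp; rewrite hq.
Qed.

Lemma crossing_edges p q : p \in E -> q \in E -> crossing4 p.1 p.2 q.1 q.2 ->
  p != q -> [/\ uniq [:: p.1; p.2; q.1; q.2], p.1 \in V, p.2 \in V, q.1 \in V & q.2 \in V].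
Proof.
move=> hp hq [T [hT1 hT2]] pq.
have [p1 p2 pn] := mem_edges_cat us uo gp hp; have [q1 q2 qn] := mem_edges_cat us uo gp hq.
have m P : P \in V -> project M P \in map (project M) (C :: r) ++ map (project M) o.
  by move=> h; rewrite -map_cat map_f.
have pin := @project_inj M (C :: r) o gp.
have share X Y Z : X \in V -> Y \in V -> Z \in V -> X != Y -> X != Z -> Y != Z ->
    open_segment (project M X) (project M Y) T -> open_segment (project M X) (project M Z) T -> False.
  move=> hX hY hZ XY XZ YZ; apply/open_share/(project_orient gp) => //.
  by rewrite /= !inE negb_or XY XZ YZ.
have [e12 e21] := conj (open_segmentC (project M p.1) (project M p.2)) (open_segmentC (project M q.1) (project M q.2)).
split=> //; rewrite /= !inE !negb_or pn qn /= !andbT.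
have flip : ~ (p.1 = q.2 /\ p.2 = q.1) by case; exact: E_flip.
have n11 : p.1 != q.1 by apply: contraNneq pq => /(E_inj1 hp hq) ->.
have n22 : p.2 != q.2 by apply: contraNneq pq => /(E_inj2 hp hq) ->.
rewrite n11 n22 /= andbT; apply/andP; split; apply/eqP => h.
- apply: (share p.1 p.2 q.1); rewrite // ?[p.1 == _]eq_sym //; last by rewrite h -e21.
  by apply/eqP => h'; apply: flip.
- apply: (share p.2 p.1 q.2); rewrite // 1?eq_sym // -?e12 //; last by rewrite h.
  by apply/eqP => h'; apply: flip; rewrite h h'.
Qed.

Let L1 := map (project M) (C :: r).
Let L2 := map (project M) o.

Lemma edges_L : edges L1 ++ edges L2 = map (pedge M) E.
Proof. by rewrite /L1 /L2 !edges_map -map_cat. Qed.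

Lemma slide_mem x : x \in V -> slide x \in (C' :: r) ++ o.
Proof.
move=> h; have -> : (C' :: r) ++ o = map slide V.
  by rewrite /V map_cat (proj1 slide_map) (proj2 slide_map).
exact: map_f.
Qed.

Lemma slide_uniq X Y Z W : X \in V -> Y \in V -> Z \in V -> W \in V ->
  uniq [:: X; Y; Z; W] -> uniq [:: slide X; slide Y; slide Z; slide W].
Proof.
have sin : {in V &, injective slide}.
  apply: uniq_map_inj; rewrite /V map_cat (proj1 slide_map) (proj2 slide_map); exact: uV'.
move=> hX hY hZ hW u; rewrite -[[:: _; _; _; _]]/(map slide [:: X; Y; Z; W]) map_inj_in_uniq //.
by move=> x y; rewrite !inE => /or4P[]/eqP-> /or4P[]/eqP->; apply: sin.
Qed.

Lemma over_signs p q : p \in E -> q \in E -> p != q -> crossing4 p.1 p.2 q.1 q.2 ->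
  let d := det3 (p.2 - p.1) (q.2 - q.1) (axis M) in
  let v := vol p.1 p.2 q.1 q.2 in
  let v' := vol (slide p.1) (slide p.2) (slide q.1) (slide q.2) in
  [/\ d != 0, v != 0, v' != 0,
    (pass_above M E (pedge M p) (pedge M q) <-> 0 < v * d) &
    (pass_above M E' (pedge M p) (pedge M q) <-> 0 < v' * d)].
Proof.
move=> hp hq pq c /=; have [u m1 m2 m3 m4] := crossing_edges hp hq c pq.
have d0 := crossing_det m1 m2 m3 m4 u c.
have [_ _ h1] := g1; have [_ _ h2] := g2; have [T [T1 T2]] := c.
split=> //; first exact: h1.
- by apply: h2; rewrite ?slide_mem // slide_uniq.
- exact: (pass_vol hM us uo gp hp hq T1 T2 d0).
- have hp' : (slide p.1, slide p.2) \in E' by rewrite slide_edges (map_f (fun e => (slide e.1, slide e.2))).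
  have hq' : (slide q.1, slide q.2) \in E' by rewrite slide_edges (map_f (fun e => (slide e.1, slide e.2))).
  have := @pass_vol M (C' :: r) o hM us' uo gp' _ _ T hp' hq'.
  rewrite /pedge /= !slide_project slide_det => h; exact: h.
Qed.

Lemma E_crossing_sym p q : crossing4 p.1 p.2 q.1 q.2 -> crossing4 q.1 q.2 p.1 p.2.
Proof. by case=> T [h1 h2]; exists T. Qed.

(* Among the three ways of pairing four points, only one yields a crossing. *)
Lemma pair_unique p q p' q' : p \in E -> q \in E -> p != q -> crossing4 p.1 p.2 q.1 q.2 ->
  p' \in E -> q' \in E -> p' != q' -> crossing4 p'.1 p'.2 q'.1 q'.2 ->
  {subset [:: p'.1; p'.2; q'.1; q'.2] <= [:: p.1; p.2; q.1; q.2]} ->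
  (p', q') = (p, q) \/ (p', q') = (q, p).
Proof.
move=> hp hq pq c hp' hq' pq' c' S.
have [u m1 m2 m3 m4] := crossing_edges hp hq c pq.
have [u' _ _ _ _] := crossing_edges hp' hq' c' pq'.
have pin := @project_inj M (C :: r) o gp.
have o1 : orient (project M p.1) (project M p.2) (project M q.2) != 0.
  apply: (project_orient gp) => //.
  by move: u; rewrite /= !inE !negb_or => /and4P[/and3P[-> _ ->] /andP[_ ->]].
move: u u'; rewrite /= !inE !negb_or => /and4P[/and3P[n12 n13 n14] /andP[n23 n24] n34 _].
move=> /and4P[/and3P[k12 k13 k14] /andP[k23 k24] k34 _].
have opt (e : space * space) : e \in E -> e.1 \in [:: p.1; p.2; q.1; q.2] -> e.2 \in [:: p.1; p.2; q.1; q.2] ->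
    [\/ e = p, e = q, e = (p.2, q.1) | e = (q.2, p.1)].
  move=> he; rewrite !inE => /or4P[] /eqP h1; [by move=> _; apply: Or41; exact: E_inj1| |by move=> _; apply: Or42; exact: E_inj1|].
  - move=> /or4P[] /eqP h2.
    + by case: (E_flip he hp h1 h2).
    + by apply: Or41; exact: E_inj2.
    + by apply: Or43; rewrite -h1 -h2; case: (e).
    + by apply: Or42; exact: E_inj2.
  - move=> /or4P[] /eqP h2.
    + by apply: Or44; rewrite -h1 -h2; case: (e).
    + by apply: Or41; exact: E_inj2.
    + by case: (E_flip he hq h1 h2).
    + by apply: Or42; exact: E_inj2.
have [T [T1 T2]] := c; have [T' [T1' T2']] := c'.
have bad : forall Y : plane, open_segment (project M p.2) (project M q.1) Y ->
    open_segment (project M q.2) (project M p.1) Y -> False.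
  move=> Y; rewrite (open_segmentC (project M q.2)) => h1 h2.
  by apply: (no_double_cross o1 T1 _ h2 h1); rewrite open_segmentC; exact: T2.
have [] := opt p' hp' (S _ _) (S _ _); rewrite ?inE ?eqxx ?orbT //= => ep;
have [] := opt q' hq' (S _ _) (S _ _); rewrite ?inE ?eqxx ?orbT //= => eq_; subst p' q'.
all: rewrite ?eqxx /= in pq' k12 k13 k14 k23 k24 k34 T1' T2' *; try done.
all: try by [left|right].
all: try by case: (bad T').
Qed.

Definition diag1 : diagram R := Diagram L1 L2 (fun e f => `[< pass_above M E e f >]).
Definition diag2 : diagram R := Diagram L1 L2 (fun e f => `[< pass_above M E' e f >]).

Lemma mklinkE s t (h : valid s t) : comp1 (mklink h) = s /\ comp2 (mklink h) = t.
Proof. by case: h. Qed.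

Lemma diag1_of : diagram_of (mklink valid1) diag1.
Proof.
have [e1 e2] := mklinkE valid1.
split; first exact: gp; exists M; split=> //; rewrite ?e1 ?e2; try exact: subdivides_refl.
by move=> e f _; rewrite /passes_over e1 e2 /=; split=> /asboolP.
Qed.

Lemma diag2_of : diagram_of (mklink valid2) diag2.
Proof.
have [e1 e2] := mklinkE valid2.
split; first exact: gp; exists M; split=> //; rewrite ?e1 ?e2 /= ?pC; try exact: subdivides_refl.
by move=> e f _; rewrite /passes_over e1 e2 /=; split=> /asboolP.
Qed.

Lemma diag_crossing (D : diagram R) e f : line1 D = L1 -> line2 D = L2 -> crossing D e f ->
  exists p q, [/\ p \in E, q \in E, p != q, crossing4 p.1 p.2 q.1 q.2 & e = pedge M p /\ f = pedge M q].
Proof.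
move=> l1 l2 []; rewrite /diagram_edges l1 l2 edges_L => /mapP[p hp ->] /mapP[q hq ->] ne [T [h1 h2]].
exists p, q; split=> //; first by apply: contraNneq ne => ->.
by exists T.
Qed.

(** All changes of orientation concern one set of four vertices, so by [pair_unique] at most one
    crossing is affected. *)
Hypothesis one_flip : forall X Y Z W X' Y' Z' W',
  X \in V -> Y \in V -> Z \in V -> W \in V -> uniq [:: X; Y; Z; W] ->
  X' \in V -> Y' \in V -> Z' \in V -> W' \in V -> uniq [:: X'; Y'; Z'; W'] ->
  flips X Y Z W -> flips X' Y' Z' W' -> {subset [:: X'; Y'; Z'; W'] <= [:: X; Y; Z; W]}.

(** The move keeps the projection, hence the planar determinant in [pass_vol]; only the sign of the
    volume can vary. *)
Lemma over_flip p q : p \in E -> q \in E -> p != q -> crossing4 p.1 p.2 q.1 q.2 ->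
  (over diag2 (pedge M p) (pedge M q) != over diag1 (pedge M p) (pedge M q)) =
  (vol p.1 p.2 q.1 q.2 * vol (slide p.1) (slide p.2) (slide q.1) (slide q.2) < 0).
Proof.
move=> hp hq pq c; have [/=] := over_signs hp hq pq c.
set d := det3 _ _ _; set v := vol _ _ _ _; set v' := vol _ _ _ _ => d0 v0 v0' h1 h2.
have -> : `[< pass_above M E (pedge M p) (pedge M q) >] = (0 < v * d).
  by apply/asboolP/idP; move/h1.
have -> : `[< pass_above M E' (pedge M p) (pedge M q) >] = (0 < v' * d).
  by apply/asboolP/idP; move/h2.
case: (ltgtP d 0) d0 => // hd _; case: (ltgtP v 0) v0 => // hv _; case: (ltgtP v' 0) v0' => // hv' _.
all: rewrite ?(nmulr_rgt0 _ hv) ?(nmulr_rgt0 _ hv') ?(pmulr_rgt0 _ hv) ?(pmulr_rgt0 _ hv')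
  ?(nmulr_rlt0 _ hv) ?(pmulr_rlt0 _ hv) ?hd ?hv' ?(lt_gtF hd) ?(lt_gtF hv') //.
Qed.

Lemma over_transpose p q : p \in E -> q \in E -> p != q -> crossing4 p.1 p.2 q.1 q.2 ->
  over diag1 (pedge M q) (pedge M p) = ~~ over diag1 (pedge M p) (pedge M q) /\
  over diag2 (pedge M q) (pedge M p) = ~~ over diag2 (pedge M p) (pedge M q).
Proof.
move=> hp hq pq c; have [/= d0 v0 v0' h1 h2] := over_signs hp hq pq c.
have qp : q != p by rewrite eq_sym.
have [/= _ _ _ k1 k2] := over_signs hq hp qp (E_crossing_sym c).
have eV X Y Z W : vol Z W X Y = vol X Y Z W by rewrite /vol /det3 !mxE; ring.
have ed : det3 (q.2 - q.1) (p.2 - p.1) (axis M) = - det3 (p.2 - p.1) (q.2 - q.1) (axis M).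
  by rewrite /det3; ring.
rewrite eV ed in k1; rewrite eV ed in k2.
split; apply/asboolP/negP.
- move=> /k1 a /asboolP/h1 b; rewrite mulrN oppr_gt0 in a; by have := lt_trans a b; rewrite ltxx.
- move=> h; apply/k1; rewrite mulrN oppr_gt0 lt_neqAle mulf_neq0 //= leNgt.
  by apply/negP => /h1 k; apply: h; apply/asboolP.
- move=> /k2 a /asboolP/h2 b; rewrite mulrN oppr_gt0 in a; by have := lt_trans a b; rewrite ltxx.
- move=> h; apply/k2; rewrite mulrN oppr_gt0 lt_neqAle mulf_neq0 //= leNgt.
  by apply/negP => /h2 k; apply: h; apply/asboolP.
Qed.

Variable g : link2 R -> int.
Hypothesis hg : null_invariant g.

Lemma value_flip p q : p \in E -> q \in E -> p != q -> crossing4 p.1 p.2 q.1 q.2 ->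
  flips p.1 p.2 q.1 q.2 -> value g (C :: r) o = value g (C' :: r) o.
Proof.
move=> hp hq pq c fl; pose e := pedge M p; pose f := pedge M q.
have pin := @project_inj M (C :: r) o gp.
have [u m1 m2 m3 m4] := crossing_edges hp hq c pq.
have cr (D : diagram R) : line1 D = L1 -> line2 D = L2 -> crossing D e f.
  move=> l1 l2; split; rewrite /diagram_edges ?l1 ?l2 ?edges_L ?map_f //.
  by apply: contraNneq pq => -[/(pin _ _ m1 m3) h _]; apply/eqP; exact: (E_inj1 hp hq h).
have o12 : over diag2 e f = ~~ over diag1 e f.
  have := over_flip hp hq pq c; rewrite -/e -/f -/(flips _ _ _ _) fl.
  by case: (over diag2 e f); case: (over diag1 e f).
have [t1 t2] := over_transpose hp hq pq c.
have o21 : over diag2 f e = ~~ over diag1 f e by rewrite /f /e t1 t2 -/e -/f o12.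
have rest h k : crossing diag1 h k -> (h, k) != (e, f) -> (h, k) != (f, e) ->
    over diag2 h k = over diag1 h k.
  move=> /(diag_crossing (D := diag1) erefl erefl)[p' [q' [hp' hq' pq' c' [-> ->]]]] n1 n2.
  apply/eqP; apply: contraT => ne; rewrite over_flip // in ne.
  have [u' m1' m2' m3' m4'] := crossing_edges hp' hq' c' pq'.
  have S := one_flip m1 m2 m3 m4 u m1' m2' m3' m4' u' fl ne.
  by case: (pair_unique hp hq pq c hp' hq' pq' c' S) => -[E1 E2]; move: n1 n2; rewrite E1 E2 eqxx.
have cc : crossing_change diag1 diag2 e f by split=> //; exact: cr.
have cc' : crossing_change diag2 diag1 e f.
  split=> //; [exact: cr|by rewrite o12 o21 !negbK|by move=> h k ch n1 n2; rewrite rest].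
have [_ _ [T [T1 T2]]] : [/\ True, True & crossing4 p.1 p.2 q.1 q.2] by [].
have D0 : det_edges e f != 0.
  rewrite /det_edges /= -!projectB pcr_project //.
  have -> : det3 (q.2 - q.1) (p.2 - p.1) (axis M) = - det3 (p.2 - p.1) (q.2 - q.1) (axis M).
    by rewrite /det3; ring.
  by rewrite oppr_eq0; apply: crossing_det.
(* Either of the two diagrams may be the one with the positive crossing, hence the two crossing
   changes [cc] and [cc']. *)
have s12 : [\/ crossing_sign diag1 e f = 1 /\ crossing_sign diag2 e f = -1 |
             crossing_sign diag2 e f = 1 /\ crossing_sign diag1 e f = -1].
  rewrite /crossing_sign o12; case: (over diag1 e f) => /=;
  rewrite (orient_det (e := e) (f := f) T1 T2) (orient_det (e := f) (f := e) T2 T1) (det_edges_sym e f) oppr_lt0;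
  by case: ltgtP D0 => // _ _; [left|right].
rewrite (valueE g valid1) (valueE g valid2); case: hg => _ _ h3.
case: s12 => -[s1 s2].
  exact: (h3 _ _ _ _ _ _ diag1_of diag2_of cc).
by apply/esym; exact: (h3 _ _ _ _ _ _ diag2_of diag1_of cc').
Qed.

Lemma slide_axis : exists2 k, k != 0 & C' - C = k *: axis M.
Proof.
have h := project_axis hM pC; exists (height M C' - height M C) => //.
by apply: contraNneq CC' => k0; rewrite eq_sym -subr_eq0 h k0 scale0r.
Qed.

Lemma vol_slide X Y : X \in r ++ o -> Y \in r ++ o -> X != Y -> vol C C' X Y != 0.
Proof.
move=> hX hY XY; have [k k0 ek] := slide_axis.
have -> : vol C C' X Y = k * det3 (X - C) (Y - C) (axis M).
  by rewrite /vol ek /det3 !mxE; ring.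
rewrite mulf_neq0 // -orient_project //.
have [CX CY] : C != X /\ C != Y.
  by move: uV; rewrite /V /= => /andP[h _]; split; apply: contraNneq h => ->.
have mV P : P \in r ++ o -> P \in (C :: r) ++ o by rewrite /= inE => ->; rewrite orbT.
have mC : C \in (C :: r) ++ o by rewrite mem_head.
apply: (project_orient gp mC (mV _ hX) (mV _ hY)).
by rewrite /= !inE negb_or CX CY XY.
Qed.

(* A segment swept by the edge NC in its move to NC' would change the sign of  *)
(* a crossing. *)
Lemma sweep_flip N e x : N \in r -> ((N, C) \in E) || ((C, N) \in E) -> e \in E ->
  e.1 \notin [:: C; N] -> e.2 \notin [:: C; N] ->
  triangle N C C' x -> segment e.1 e.2 x ->
  exists p q, [/\ p \in E, q \in E, p != q, crossing4 p.1 p.2 q.1 q.2 & flips p.1 p.2 q.1 q.2].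
Proof.
move=> Nr hN he e1 e2 hx ex.
have [m1 m2 mn] := mem_edges_cat us uo gp he.
have NV : N \in V by rewrite /V /= inE mem_cat Nr orbT.
have CV : C \in V by rewrite /V mem_head.
have CN : C != N by move: us; rewrite /= => /andP[h _]; apply: contraNneq h => ->.
have NC : N != C by rewrite eq_sym.
rewrite !inE !negb_or in e1 e2; have [[a1 a2] [b1 b2]] := (andP e1, andP e2).
have pco := @project_collinear M (C :: r) o gp.
have hT1 : segment (project M N) (project M C) (project M x).
  case: hx => a [b [c [a0 b0 c0 s1 ->]]]; exists (b + c); split; first by apply/andP; split; lra.
  have -> : 1 - (b + c) = a by lra.
  have -> : a *: N + b *: C + c *: C' = 1 *: (a *: N + b *: C) + c *: C' by rewrite scale1r.
  by rewrite !project_lin scale1r pC scalerDl addrA.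
have hT2 : segment (project M e.1) (project M e.2) (project M x).
  by rewrite -project_segment; exists x.
have T1 : open_segment (project M N) (project M C) (project M x).
  have [E1|E1|//] := segment_cases hT1; rewrite E1 in hT2.
    by case: (pco _ _ _ m1 m2 NV mn hT2) => F; [rewrite F eqxx in a2|rewrite F eqxx in b2].
  by case: (pco _ _ _ m1 m2 CV mn hT2) => F; [rewrite F eqxx in a1|rewrite F eqxx in b1].
have T2 : open_segment (project M e.1) (project M e.2) (project M x).
  have [E1|E1|//] := segment_cases hT2; rewrite E1 in hT1.
    by case: (pco _ _ _ NV CV m1 NC hT1) => F; [rewrite F eqxx in a2|rewrite F eqxx in a1].
  by case: (pco _ _ _ NV CV m2 NC hT1) => F; [rewrite F eqxx in b2|rewrite F eqxx in b1].
have u : uniq [:: C; N; e.1; e.2].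
  by rewrite /= !inE !negb_or CN (eq_sym C) a1 (eq_sym C) b1 (eq_sym N) a2 (eq_sym N) b2 mn.
have rest y : y \in V -> y != C -> y \in r ++ o.
  by rewrite /V /= inE => /orP[->|].
have sid y : y \in V -> y != C -> slide y = y by move=> h1 h2; apply/slide_id/rest.
have sC : slide C = C' by rewrite /slide eqxx.
have fl : vol C N e.1 e.2 * vol C' N e.1 e.2 < 0.
  have [_ _ g14] := g1; have [_ _ g24] := g2.
  have v0 := g14 _ _ _ _ CV NV m1 m2 u.
  have v0' : vol C' N e.1 e.2 != 0.
    have h := g24 _ _ _ _ (slide_mem CV) (slide_mem NV) (slide_mem m1) (slide_mem m2) (slide_uniq CV NV m1 m2 u).
    by rewrite sC (sid N NV NC) (sid _ m1 a1) (sid _ m2 b1) in h.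
  case: hx => a [b [c [a0 b0 c0 s1 eX]]]; case: ex => t [_ eX'].
  (* [x] lies in the plane of [N] and [e], so the volumes before and after the move, weighted by the
     coordinates of [x], cancel. They have opposite signs unless [x = N], which would make four
     vertices coplanar. *)
  have z : b * vol C N e.1 e.2 + c * vol C' N e.1 e.2 = 0.
    have : vol x N e.1 e.2 = 0 by rewrite eX' /vol /det3 !mxE; ring.
    rewrite eX vol_affine // => <-.
    by rewrite (_ : vol N N _ _ = 0) ?mulr0 ?add0r // /vol /det3 !mxE; ring.
  rewrite ltNge; apply/negP => h.
  have [b00 c00] : b = 0 /\ c = 0.
    have hp : 0 < vol C N e.1 e.2 * vol C' N e.1 e.2 by rewrite lt_neqAle eq_sym mulf_neq0.
    have hp' : 0 < vol C' N e.1 e.2 * vol C' N e.1 e.2 by rewrite -expr2 exprn_even_gt0.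
    have /eqP : b * (vol C N e.1 e.2 * vol C' N e.1 e.2) +
        c * (vol C' N e.1 e.2 * vol C' N e.1 e.2) = 0.
      by rewrite !mulrA -mulrDl z mul0r.
    have k1 := mulr_ge0 b0 (ltW hp); have k2 := mulr_ge0 c0 (ltW hp').
    rewrite paddr_eq0 //.
    rewrite (mulf_eq0 b) (mulf_eq0 c) (gt_eqF hp) (gt_eqF hp') !orbF.
    by move=> /andP[/eqP-> /eqP->].
  have xN : x = N.
    by rewrite eX b00 c00 !scale0r !addr0 (_ : a = 1) ?scale1r //; lra.
  move: v0; rewrite -xN {1}eX'; rewrite (_ : vol _ _ _ _ = 0) ?eqxx //.
  by rewrite /vol /det3 !mxE; ring.
case/orP: hN => hN; [exists (N, C), e|exists (C, N), e]; split=> //=.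
- by apply: contraNneq a2 => <-.
- by exists (project M x).
- by rewrite /flips sC (sid N NV NC) (sid _ m1 a1) (sid _ m2 b1) (vol_swap C) (vol_swap C') mulrNN.
- by apply: contraNneq a1 => <-.
- by exists (project M x); rewrite open_segmentC.
- by rewrite /flips sC (sid N NV NC) (sid _ m1 a1) (sid _ m2 b1).
Qed.

(** Either some crossing changes, and then it is the only one, or by [sweep_flip] no edge is swept
    and the move is an isotopy. *)
Lemma value_vertical : value g (C :: r) o = value g (C' :: r) o.
Proof.
have [[p [q [hp hq pq c fl]]]|no] := pselect (exists p q, [/\ p \in E, q \in E, p != q,
    crossing4 p.1 p.2 q.1 q.2 & flips p.1 p.2 q.1 q.2]).
  exact: value_flip hp hq pq c fl.
have [B [t [A er]]] : exists B t A, r = B :: rcons t A.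
  case: (r) (proj1 sz) => [|B [|x t]] //= _; exists B.
  by case/lastP: t => [|t A]; [exists [::], x|exists (x :: t), A].
have rE D : rot 1 [:: A, D, B & t] = D :: r by rewrite rot1_cons er.
have rE' D : rot (size t).+2 (D :: r) = [:: A, D, B & t].
  have -> : D :: r = [:: D, B & t] ++ [:: A] by rewrite er /= cats1.
  exact: (rot_size_cat [:: D, B & t] [:: A]).
have v : valid [:: A, C, B & t] o by rewrite -rE'; exact/valid_rot/valid1.
have AB : A != B.
  by move: us; rewrite er /= mem_rcons inE negb_or => /andP[_ /andP[/andP[]]]; rewrite eq_sym.
have Ar : A \in r by rewrite er inE mem_rcons mem_head orbT.
have Br : B \in r by rewrite er mem_head.
have mr P : P \in r -> P \in r ++ o by rewrite mem_cat => ->.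
have nc X Y Z W : vol X Y Z W != 0 -> noncollinear X Y Z.
  by apply: contraNneq => h; rewrite /vol -dot_cross h dotC dot0r.
have vAB := vol_slide (mr _ Ar) (mr _ Br) AB.
have edgesE e : (e \in E) = [|| e == (A, C), e == (C, B), e \in arcs B t A | e \in edges o].
  by rewrite /E mem_cat -(mem_edges_rot (size t).+2) rE' edges_cons !arcs_cons !inE -!orbA.
have [||||v' ev] := @value_sweep R g hg A B C C' t o v.
- by apply: (nc _ _ _ B); rewrite vol_neq12 vol_neq23.
- by apply: (nc _ _ _ A); rewrite vol_neq23 vol_neq12 vol_neq34.
- move=> X Y hX hY; apply: vol_slide; apply: mr; rewrite er.
    by move: hX; rewrite !inE mem_rcons inE orbCA.
  by move: hY; rewrite !inE mem_rcons inE orbCA.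
- move=> N e x hN he e1 e2 xT ex; apply: no.
  have heE : e \in E by rewrite edgesE; case/orP: he => ->; rewrite ?orbT.
  have notC : e.1 != C /\ e.2 != C.
    have [m1 m2 _] := mem_edges_cat us uo gp heE.
    case/orP: he => he.
      have [k1 k2] := mem_arcs he; move: us; rewrite er /= => /andP[hC _]; split.
        apply: contraNneq hC => <-; rewrite inE mem_rcons inE.
        by move: k1; rewrite inE => /orP[] ->; rewrite ?orbT.
      by apply: contraNneq hC => <-; rewrite inE k2 orbT.
    have [k1 k2] := mem_edges he; move: uV; rewrite /V cat_uniq => /and3P[_ /hasPn h _].
    by split; apply/eqP => F; [have := h _ k1|have := h _ k2]; rewrite F /= mem_head.
  have [n1 n2] := notC; move: hN; rewrite !inE => /orP[] /eqP EN; rewrite {}EN in e1 e2 xT.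
  + apply: (@sweep_flip A e x Ar _ heE _ _ xT ex); rewrite ?inE ?negb_or ?n1 ?n2 //.
    by rewrite !edgesE eqxx.
  + apply: (@sweep_flip B e x Br _ heE _ _ xT ex); rewrite ?inE ?negb_or ?n1 ?n2 //.
    by rewrite !edgesE eqxx !orbT.
have e1 := value_rot hg 1 v; have e2 := value_rot hg 1 v'; rewrite rE in e1; rewrite rE in e2.
by rewrite e1 e2; exact: ev.
Qed.

End Base.

End VerticalMove.

(** * Generic vertex moves *)

Section Dense.
Variable R : realType.
Notation space := 'rV[R]_3.
Implicit Types (A B C D X Y Z W P Q N x y w : space) (f g : space -> R).

(* Polynomial functions, described by their restrictions to lines. *)
Definition line_poly f : Prop :=
  forall x w, exists p : {poly R}, forall t : R, f (x + t *: w) = p.[t].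

Lemma line_poly_cst (c : R) : line_poly (fun=> c).
Proof. by move=> x w; exists c%:P => t; rewrite hornerC. Qed.

Lemma line_poly_coord i : line_poly (fun x => x 0 i).
Proof.
move=> x w; exists ((x 0 i)%:P + (w 0 i)%:P * 'X) => t.
by rewrite hornerD hornerM hornerX !hornerC !mxE mulrC.
Qed.

Lemma line_polyD f g : line_poly f -> line_poly g -> line_poly (fun x => f x + g x).
Proof.
move=> hf hg x w; have [p hp] := hf x w; have [q hq] := hg x w.
by exists (p + q) => t; rewrite hornerD hp hq.
Qed.

Lemma line_polyM f g : line_poly f -> line_poly g -> line_poly (fun x => f x * g x).
Proof.
move=> hf hg x w; have [p hp] := hf x w; have [q hq] := hg x w.
by exists (p * q) => t; rewrite hornerM hp hq.
Qed.

Lemma line_polyN f : line_poly f -> line_poly (fun x => - f x).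
Proof.
by move=> hf x w; have [p hp] := hf x w; exists (- p) => t; rewrite hornerN hp.
Qed.

Lemma line_polyB f g : line_poly f -> line_poly g -> line_poly (fun x => f x - g x).
Proof. by move=> hf hg; apply: line_polyD => //; exact: line_polyN. Qed.

Lemma eq_line_poly f g : f =1 g -> line_poly f -> line_poly g.
Proof. by move=> fg hf x w; have [p hp] := hf x w; exists p => t; rewrite -fg. Qed.

(* A sufficient condition for being satisfied by a generic point. *)
Definition dense (P : space -> Prop) : Prop :=
  exists f, [/\ line_poly f, exists x, f x != 0 & forall x, f x != 0 -> P x].

Lemma poly_small (p : {poly R}) : p != 0 ->
  exists2 e0 : R, 0 < e0 & forall e, 0 < e < e0 -> p.[e] != 0.
Proof.
have [n] := ubnP (size p); elim: n p => // n IH p sp p0.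
have [[a ra]|no] := pselect (exists a, root p a); last first.
  by exists 1 => // e _; apply/negP => h; apply: no; exists e.
move: ra => /factor_theorem[q pq]; rewrite pq in sp p0.
move: p0; rewrite mulf_eq0 negb_or => /andP[q0 X0].
have [|e0 e00 he] := IH q _ q0.
  by move: sp; rewrite size_mul // size_XsubC addn2.
have [a0|a0] := ltP 0 a.
  exists (Num.min e0 a); first by rewrite lt_min e00.
  move=> e /andP[ep]; rewrite lt_min => /andP[ee ea].
  by rewrite pq hornerM hornerXsubC mulf_neq0 ?he ?ep // subr_eq0 lt_eqF.
exists e0 => // e /andP[ep ee].
by rewrite pq hornerM hornerXsubC mulf_neq0 ?he ?ep // subr_eq0 gt_eqF // (le_lt_trans a0).
Qed.

(** [x] itself need not satisfy [P]: on the line from [x] to a point where [f] does not vanish, [f]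
    is a nonzero polynomial, with finitely many roots. *)
Lemma dense_near (P : space -> Prop) x : dense P ->
  exists w e0, 0 < e0 /\ forall e : R, 0 < e < e0 -> P (x + e *: w).
Proof.
move=> [f [hf [y fy] h]]; exists (y - x); have [p hp] := hf x (y - x).
have p0 : p != 0.
  apply: contraNneq fy => p0; have := hp 1; rewrite p0 horner0 scale1r addrC subrK.
  by move=> ->.
have [e0 e00 he] := poly_small p0; exists e0; split=> // e /he pe.
by apply: h; rewrite hp.
Qed.

Lemma dense_and (P Q : space -> Prop) : dense P -> dense Q -> dense (fun x => P x /\ Q x).
Proof.
move=> [f [hf [x fx] hP]] [g [hg [y gy] hQ]].
exists (fun x => f x * g x); split; first exact: line_polyM.
  have [p hp] := hf x (y - x); have [q hq] := hg x (y - x).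
  have p0 : p != 0.
    by apply: contraNneq fx => p0; have := hp 0; rewrite p0 horner0 scale0r addr0 => ->.
  have q0 : q != 0.
    by apply: contraNneq gy => q0; have := hq 1; rewrite q0 horner0 scale1r addrC subrK => ->.
  have [|e0 e00 he] := @poly_small (p * q); first by rewrite mulf_neq0.
  exists (x + (e0 / 2) *: (y - x)); rewrite hp hq -hornerM he //; lra.
by move=> z; rewrite mulf_eq0 negb_or => /andP[/hP ? /hQ ?].
Qed.

Lemma dense_true : dense (fun=> True).
Proof.
by exists (fun=> 1); split=> //; [exact: line_poly_cst|exists 0; exact: oner_neq0].
Qed.

Lemma dense_sub (P Q : space -> Prop) : (forall x, P x -> Q x) -> dense P -> dense Q.
Proof. by move=> PQ [f [hf fx h]]; exists f; split=> // x /h /PQ. Qed.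

Lemma dense_all (T : eqType) (l : seq T) (P : T -> space -> Prop) :
  (forall a, a \in l -> dense (P a)) -> dense (fun x => forall a, a \in l -> P a x).
Proof.
elim: l => [|a l IH] h; first by apply: dense_sub dense_true.
have /dense_and/(_ (IH _)) : dense (P a) by apply: h; rewrite mem_head.
move=> /(_ (fun b hb => h b (mem_behead (s := a :: l) hb))).
by apply: dense_sub => x [h1 h2] b; rewrite inE => /orP[/eqP->|/h2].
Qed.

Lemma dense_imp (H : Prop) (P : space -> Prop) :
  (H -> dense P) -> dense (fun x => H -> P x).
Proof.
have [h /(_ h)|h _] := pselect H; first by apply: dense_sub.
by apply: dense_sub dense_true.
Qed.

Lemma dense_neq0 f x : line_poly f -> f x != 0 -> dense (fun y => f y != 0).
Proof. by move=> hf fx; exists f; split=> //; exists x. Qed.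

Lemma line_poly_det3 A B : line_poly (fun x => det3 x A B).
Proof.
by rewrite /det3; do ![apply: line_polyB|apply: line_polyD|apply: line_polyM|
  exact: line_poly_coord|exact: line_poly_cst].
Qed.

Lemma line_poly_det3B A B C : line_poly (fun x => det3 (x - C) A B).
Proof.
apply: (@eq_line_poly (fun x => det3 x A B - det3 C A B)).
  by move=> x; rewrite /det3 !mxE; ring.
by apply: line_polyB; [exact: line_poly_det3|exact: line_poly_cst].
Qed.

Lemma line_poly_vol A B C : line_poly (fun x => vol x A B C).
Proof.
apply: (@eq_line_poly (fun x => - det3 (x - A) (B - A) (C - A))).
  by move=> x; rewrite /vol /det3 !mxE; ring.
by apply: line_polyN; exact: line_poly_det3B.
Qed.

End Dense.

(** * Frames with a prescribed line of sight *)

Section FrameAlong.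
Variable R : realType.
Notation space := 'rV[R]_3.
Implicit Types (u v d X Y : space).

Lemma frame_along d : d != 0 -> exists M (k : R), [/\ is_frame M, k != 0 & axis M = k *: d].
Proof.
move=> d0.
have unit (x : space) : x != 0 -> exists2 k : R, k != 0 & dot (k *: x) (k *: x) = 1.
  move=> x0; have xx := dot_gt0 x0; have sq := sqr_sqrtr (ltW xx).
  have s0 : Num.sqrt (dot x x) != 0 by rewrite gt_eqF // sqrtr_gt0.
  exists (Num.sqrt (dot x x))^-1; first by rewrite invr_eq0.
  by rewrite dotZl dotZr -{3}sq; field.
have [k k0 uu] := unit _ d0; set u := k *: d in uu.
have u0 : u != 0 by rewrite scaler_eq0 negb_or k0.
have [a _ c0] := cross_basis u0.
have [l l0 vv] := unit _ c0; set v := l *: cross u a in vv.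
have uv : dot u v = 0 by rewrite /v dotZr dotC dot_cross /det3; ring.
(* In the order [v], [cross u v], [u] the columns have determinant 1 rather than -1. *)
pose M : 'M[R]_3 := \matrix_(i, j) (if j == 0 then v 0 i else if j == 1 then cross u v 0 i else u 0 i).
have ax : axis M = u by apply/rowP => i; rewrite !mxE.
exists M, k; split=> //.
have cc : dot (cross u v) (cross u v) = 1.
  have -> : dot (cross u v) (cross u v) = dot u u * dot v v - dot u v * dot u v.
    by rewrite !dotE !mxE /=; ring.
  by rewrite uu vv uv mulr0 subr0 mulr1.
have cu : dot (cross u v) u = 0 by rewrite dot_cross /det3; ring.
have cv : dot (cross u v) v = 0 by rewrite dot_cross /det3; ring.
split.
  apply/matrixP => i j; rewrite !mxE.
  pose c (j : 'I_3) : space := if j == 0 then v else if j == 1 then cross u v else u.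
  have -> : \sum_k0 M^T i k0 * M k0 j = dot (c i) (c j).
    rewrite /dot; apply: eq_bigr => h _; rewrite [M^T _ _]mxE [M h i]mxE [M h j]mxE /c.
    by case: (i == 0); case: (i == 1); case: (j == 0); case: (j == 1).
  move: i j; apply: ord3P; apply: ord3P; rewrite /c /= ?vv ?uu ?cc ?cu ?cv ?uv //;
  by rewrite dotC ?cu ?cv ?uv.
have -> : \det M = dot v v * dot u u - dot u v * dot u v.
  by rewrite det33 !mxE /= !dotE !mxE /=; ring.
by rewrite uu vv uv mulr0 subr0 mulr1.
Qed.

End FrameAlong.

(** * Generic projections of generic vertex sets *)

Section GenericProjection.
Variable R : realType.
Notation space := 'rV[R]_3.
Notation plane := 'rV[R]_2.
Implicit Types (A B C D X Y Z W P Q N d : space) (s o t V : seq space).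

(* Vanishes when the projections along [d] of three lines are concurrent. *)
Definition concur d X1 Y1 X2 Y2 X3 Y3 : R :=
  det3 d (Y2 - X2) (Y3 - X3) * det3 d (Y1 - X1) X1
  + det3 d (Y3 - X3) (Y1 - X1) * det3 d (Y2 - X2) X2
  + det3 d (Y1 - X1) (Y2 - X2) * det3 d (Y3 - X3) X3.

(** In each determinant the point [X] may be changed by multiples of [d] and of the direction of its
    line, hence replaced by one common point; a determinant identity then remains. *)
Lemma concur_lines d X1 Y1 X2 Y2 X3 Y3 (t1 t2 t3 k2 k3 : R) :
  (1 - t2) *: X2 + t2 *: Y2 = (1 - t1) *: X1 + t1 *: Y1 + k2 *: d ->
  (1 - t3) *: X3 + t3 *: Y3 = (1 - t1) *: X1 + t1 *: Y1 + k3 *: d ->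
  concur d X1 Y1 X2 Y2 X3 Y3 = 0.
Proof.
move=> h2 h3; pose P := (1 - t1) *: X1 + t1 *: Y1.
have e1 : det3 d (Y1 - X1) X1 = det3 d (Y1 - X1) P by rewrite /P /det3 !mxE; ring.
have e2 : det3 d (Y2 - X2) X2 = det3 d (Y2 - X2) P.
  transitivity (det3 d (Y2 - X2) ((1 - t2) *: X2 + t2 *: Y2)).
    by rewrite /det3 !mxE; ring.
  by rewrite h2 -/P /det3 !mxE; ring.
have e3 : det3 d (Y3 - X3) X3 = det3 d (Y3 - X3) P.
  transitivity (det3 d (Y3 - X3) ((1 - t3) *: X3 + t3 *: Y3)).
    by rewrite /det3 !mxE; ring.
  by rewrite h3 -/P /det3 !mxE; ring.
by rewrite /concur e1 e2 e3 /det3; ring.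
Qed.

(** A direction at which [concur] is visibly nonzero for vertices in general position; it witnesses
    that [concur] does not vanish identically. *)
Lemma concur_transversal X1 Y1 X2 Y2 X3 Y3 :
  concur (X2 - X1) X1 Y1 X2 Y2 X3 Y3 = - (vol X1 X2 Y1 Y2 * vol X1 X2 X3 Y3).
Proof. by rewrite /concur /vol /det3 !mxE; ring. Qed.

Lemma concur_scale (k : R) d X1 Y1 X2 Y2 X3 Y3 :
  concur (k *: d) X1 Y1 X2 Y2 X3 Y3 = k * k * concur d X1 Y1 X2 Y2 X3 Y3.
Proof. by rewrite /concur /det3 !mxE; ring. Qed.

(** By the condition on triples, two different projected segments with a common end share no
    interior point. So [concur] is only needed for six different vertices. *)
Lemma gp_along M s o : is_frame M -> uniq (s ++ o) -> (2 < size s)%N -> (2 < size o)%N ->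
  (forall X Y Z, X \in s ++ o -> Y \in s ++ o -> Z \in s ++ o -> uniq [:: X; Y; Z] ->
     det3 (Y - X) (Z - X) (axis M) != 0) ->
  (forall X1 Y1 X2 Y2 X3 Y3, {subset [:: X1; Y1; X2; Y2; X3; Y3] <= s ++ o} ->
     uniq [:: X1; Y1; X2; Y2; X3; Y3] -> concur (axis M) X1 Y1 X2 Y2 X3 Y3 != 0) ->
  general_position (map (project M) s) (map (project M) o).
Proof.
move=> hM u s2 o2 h1 h2; set V := s ++ o in u h1 h2.
have fourth X Y : X \in V -> Y \in V -> X != Y -> exists2 Z, Z \in V & uniq [:: X; Y; Z].
  move=> hX hY XY; apply: contrapT => no.
  have : (size V <= size [:: X; Y])%N.
    apply: uniq_leq_size => // Z hZ; apply: contrapT => /negP nZ; apply: no; exists Z => //.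
    by move: nZ; rewrite /= !inE !negb_or XY => /andP[a b]; rewrite (eq_sym X) a (eq_sym Y) b.
  by rewrite size_cat leqNgt ltn_addr.
have inj : {in V &, injective (project M)}.
  move=> X Y hX hY e; apply/eqP; apply: contraT => XY.
  have [Z hZ uZ] := fourth X Y hX hY XY.
  have := h1 X Y Z hX hY hZ uZ; rewrite -orient_project // e.
  by rewrite /orient !subrr !mul0r subrr eqxx.
have orn X Y Z : X \in V -> Y \in V -> Z \in V -> uniq [:: X; Y; Z] ->
    orient (project M X) (project M Y) (project M Z) != 0.
  by move=> *; rewrite orient_project // h1.
split; rewrite ?size_map -?map_cat //.
- by rewrite map_inj_in_uniq.
- move=> _ _ _ /mapP[X hX ->] /mapP[Y hY ->] /mapP[Z hZ ->] uXYZ; apply: orn => //.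
  by apply: (@map_uniq _ _ (project M)).
move=> A1 B1 A2 B2 A3 B3 S.
have mem i (hi : i \in [:: A1; B1; A2; B2; A3; B3]) : exists2 X, X \in V & i = project M X.
  by have /mapP[X hX ->] := S _ hi; exists X.
have [X1 hX1 eA1] := mem A1 ltac:(by rewrite !inE eqxx ?orbT).
have [Y1 hY1 eB1] := mem B1 ltac:(by rewrite !inE eqxx ?orbT).
have [X2 hX2 eA2] := mem A2 ltac:(by rewrite !inE eqxx ?orbT).
have [Y2 hY2 eB2] := mem B2 ltac:(by rewrite !inE eqxx ?orbT).
have [X3 hX3 eA3] := mem A3 ltac:(by rewrite !inE eqxx ?orbT).
have [Y3 hY3 eB3] := mem B3 ltac:(by rewrite !inE eqxx ?orbT).
rewrite eA1 eA2 eA3 eB1 eB2 eB3 => n1 n2 n3 d12 d13 d23.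
apply/seteqP; split=> // T [[T1 T2] T3]; exfalso.
have pneq X Y : project M X != project M Y -> X != Y by apply: contraNneq => ->.
have {}n1 := pneq _ _ n1; have {}n2 := pneq _ _ n2; have {}n3 := pneq _ _ n3.
have apart2 X Y X' Y' : X \in V -> Y \in V -> X' \in V -> Y' \in V -> X != Y -> X' != Y' ->
    segment (project M X) (project M Y) <> segment (project M X') (project M Y') ->
    open_segment (project M X) (project M Y) T -> open_segment (project M X') (project M Y') T ->
    [/\ X != X', X != Y', Y != X' & Y != Y'].
  move=> hX hY hX' hY' XY XY' ds t t'.
  have key P Q Q' : P \in V -> Q \in V -> Q' \in V -> P != Q -> P != Q' ->
      segment (project M P) (project M Q) <> segment (project M P) (project M Q') ->
      open_segment (project M P) (project M Q) T -> open_segment (project M P) (project M Q') T -> False.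
    move=> hP hQ hQ' PQ PQ' dsP tP tQ; have [E|QQ'] := eqVneq Q Q'; first by apply: dsP; rewrite E.
    apply: (open_share _ tP tQ); apply: orn => //.
    by rewrite /= !inE negb_or PQ PQ' QQ'.
  split; apply/eqP => E.
  - by subst X'; exact: (key X Y Y').
  - subst Y'; rewrite eq_sym in XY'.
    move: ds t'; rewrite (segmentC (project M X')) (open_segmentC (project M X')) => ds t'.
    exact: (key X Y X').
  - subst X'; rewrite eq_sym in XY.
    move: ds t; rewrite (segmentC (project M X)) (open_segmentC (project M X)) => ds t.
    exact: (key Y X Y').
  - subst Y'; rewrite eq_sym in XY; rewrite eq_sym in XY'.
    move: ds t t'; rewrite (segmentC (project M X)) (open_segmentC (project M X)).
    rewrite (segmentC (project M X')) (open_segmentC (project M X')) => ds t t'.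
    exact: (key Y X X').
have [a1 a2 a3 a4] := apart2 _ _ _ _ hX1 hY1 hX2 hY2 n1 n2 d12 T1 T2.
have [b1 b2 b3 b4] := apart2 _ _ _ _ hX1 hY1 hX3 hY3 n1 n3 d13 T1 T3.
have [c1 c2 c3 c4] := apart2 _ _ _ _ hX2 hY2 hX3 hY3 n2 n3 d23 T2 T3.
have u6 : uniq [:: X1; Y1; X2; Y2; X3; Y3].
  by rewrite /= !inE !negb_or n1 a1 a2 b1 b2 a3 a4 b3 b4 n2 c1 c2 c3 c4 n3.
case: T1 => t1 [_ e1]; case: T2 => t2 [_ e2]; case: T3 => t3 [_ e3].
have S6 : {subset [:: X1; Y1; X2; Y2; X3; Y3] <= V}.
  by move=> x; rewrite !inE => /or4P[|||/or3P[]] /eqP->.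
have /eqP := h2 _ _ _ _ _ _ S6 u6; apply.
have lift X Y (t : R) : T = (1 - t) *: project M X + t *: project M Y ->
    exists k : R, (1 - t) *: X + t *: Y = (1 - t1) *: X1 + t1 *: Y1 + k *: axis M.
  move=> e; have := @project_axis R M ((1 - t) *: X + t *: Y) ((1 - t1) *: X1 + t1 *: Y1) hM.
  rewrite !project_lin -e -e1 => /(_ erefl); set k := height M _ - _ => h; exists k.
  by rewrite -h [RHS]addrC subrK.
have [k2 h2'] := lift _ _ _ e2; have [k3 h3'] := lift _ _ _ e3.
exact: (concur_lines h2' h3').
Qed.

Lemma line_poly_concur C X1 Y1 X2 Y2 X3 Y3 :
  line_poly (fun x => concur (x - C) X1 Y1 X2 Y2 X3 Y3).
Proof.
by rewrite /concur; apply: line_polyD; [apply: line_polyD|]; apply: line_polyM; exact: line_poly_det3B.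
Qed.

End GenericProjection.

(** * Long vertical moves, cut between coplanarities *)

Section Chain.
Variable R : realType.
Notation space := 'rV[R]_3.
Implicit Types (A B C D X Y Z W P Q N d : space) (s o V : seq space) (t : space * space * space).

Definition tverts t : seq space := [:: t.1.1; t.1.2; t.2].

Definition triples V : seq (space * space * space) :=
  [seq t <- [seq (p, z) | p <- [seq (x, y) | x <- V, y <- V], z <- V] | uniq (tverts t)].

Lemma triplesP V t : t \in triples V <-> {subset tverts t <= V} /\ uniq (tverts t).
Proof.
rewrite mem_filter; split=> [/andP[u /allpairsP[[p z] /= [/allpairsP[[x y] /= [xV yV ->]] zV et]]]|[S u]].
  split=> //; rewrite et => w.
  by rewrite !inE => /or3P[] /eqP->.
case: t S u => -[x y] z S u; rewrite u; apply: (allpairs_f (fun p z => (p, z))).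
  by apply: (allpairs_f (fun x y => (x, y))); apply: S; rewrite !inE eqxx ?orbT.
by apply: S; rewrite !inE eqxx ?orbT.
Qed.

Definition tvol P t : R := vol P t.1.1 t.1.2 t.2.

Lemma fourth_vertex V X Y Z : uniq V -> (3 < size V)%N -> uniq [:: X; Y; Z] ->
  exists2 F, F \in V & uniq [:: X; Y; Z; F].
Proof.
move=> u s3 u3; apply: contrapT => no.
have : (size V <= size [:: X; Y; Z])%N.
  apply: uniq_leq_size => // F hF; apply: contrapT => /negP nF; apply: no; exists F => //.
  move: nF u3; rewrite /= !inE !negb_or => /and3P[a b c] /and3P[/andP[-> ->] -> _].
  by rewrite (eq_sym X) a (eq_sym Y) b (eq_sym Z) c.
by rewrite leqNgt s3.
Qed.

Lemma vol_noncollinear X Y Z W : vol X Y Z W != 0 -> noncollinear X Y Z.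
Proof. by apply: contraNneq => h; rewrite /vol -dot_cross h dotC dot0r. Qed.

(** Coincident or collinear points can be completed to four vertices of volume zero, as [V] is large
    enough. *)
Lemma gen_cons P V : gen V -> (3 < size V)%N -> (forall t, t \in triples V -> tvol P t != 0) ->
  gen (P :: V).
Proof.
move=> [u _ h4] s3 ht.
have PV : P \notin V.
  apply/negP => PV.
  have [X XV PX] : exists2 X, X \in V & P != X.
    apply: contrapT => no; have : (size V <= size [:: P])%N.
      apply: uniq_leq_size => // F hF; rewrite inE; apply/negPn/negP => h; apply: no; exists F => //.
      by rewrite eq_sym.
    by rewrite leqNgt (leq_ltn_trans _ s3).
  have [Y YV uPXY] : exists2 Y, Y \in V & uniq [:: P; X; Y].
    apply: contrapT => no; have : (size V <= size [:: P; X])%N.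
      apply: uniq_leq_size => // F hF; apply: contrapT => /negP nF; apply: no; exists F => //.
      by move: nF; rewrite /= !inE !negb_or PX => /andP[a b]; rewrite (eq_sym P) a (eq_sym X) b.
    by rewrite leqNgt (leq_ltn_trans _ s3).
  have : tvol P (P, X, Y) != 0.
    apply: ht; apply/triplesP; split=> //= w; rewrite !inE => /or3P[]/eqP-> //.
  by rewrite /tvol /vol /det3 !mxE /= !subrr !mul0r subrr addr0 eqxx.
have h3 X Y Z : X \in V -> Y \in V -> Z \in V -> uniq [:: X; Y; Z] -> vol P X Y Z != 0.
  move=> hX hY hZ uXYZ; apply: (ht (X, Y, Z)); apply/triplesP; split=> //= w.
  by rewrite !inE => /or3P[]/eqP->.
have h4' X Y Z W : X \in P :: V -> Y \in P :: V -> Z \in P :: V -> W \in P :: V ->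
    uniq [:: X; Y; Z; W] -> vol X Y Z W != 0.
  have inV Q : Q \in P :: V -> Q != P -> Q \in V by rewrite inE => /orP[->|].
  move=> hX hY hZ hW uq; move: (uq); rewrite /= !inE !negb_or => /and4P[/and3P[n1 n2 n3] /andP[n4 n5] n6 _].
  have [EX|nX] := eqVneq X P.
    rewrite EX; rewrite EX ![P == _]eq_sym in n1 n2 n3.
    apply: h3 (inV _ hY n1) (inV _ hZ n2) (inV _ hW n3) _.
    by rewrite /= !inE negb_or n4 n5 n6.
  have [EY|nY] := eqVneq Y P.
    rewrite vol_neq12 EY; rewrite EY ![P == _]eq_sym in n4 n5.
    apply: h3 (inV _ hX nX) (inV _ hZ n4) (inV _ hW n5) _.
    by rewrite /= !inE negb_or n2 n3 n6.
  have [EZ|nZ] := eqVneq Z P.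
    rewrite vol_neq23 vol_neq12 EZ; rewrite EZ ![P == _]eq_sym in n6.
    apply: h3 (inV _ hX nX) (inV _ hY nY) (inV _ hW n6) _.
    by rewrite /= !inE negb_or n1 n3 n5.
  have [EW|nW] := eqVneq W P.
    rewrite vol_neq34 vol_neq23 vol_neq12 EW.
    apply: h3 (inV _ hX nX) (inV _ hY nY) (inV _ hZ nZ) _.
    by rewrite /= !inE negb_or n1 n2 n4.
  move: hX hY hZ hW; rewrite !inE (negPf nX) (negPf nY) (negPf nZ) (negPf nW) /=.
  by move=> *; apply: h4.
have uPV : uniq (P :: V) by rewrite /= PV.
split=> // X Y Z hX hY hZ u3.
have [|F hF u4] := @fourth_vertex (P :: V) X Y Z uPV _ u3; first exact: ltnW.
exact: (@vol_noncollinear _ _ _ F (h4' _ _ _ _ hX hY hZ hF u4)).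
Qed.

Lemma count_lt (T : eqType) (a b : pred T) (l : seq T) x :
  (forall y, y \in l -> a y -> b y) -> x \in l -> b x -> ~ a x ->
  (count a l < count b l)%N.
Proof.
move=> ab xl bx /negP nax.
have le r' : {subset r' <= l} -> (count a r' <= count b r')%N.
  elim: r' => //= y r' IH S; apply: leq_add.
    by case: (boolP (a y)) => // ay; rewrite ab // S // mem_head.
  by apply: IH => z hz; apply: S; rewrite inE hz orbT.
rewrite -!sum1_count (big_rem x) //= [X in (_ < X)%N](big_rem x) //= bx (negPf nax) add0n add1n ltnS.
by rewrite !sum1_count; apply: le => y; exact: mem_rem.
Qed.

Lemma affine_root (a b h0 h1 : R) : h0 < h1 -> (a + b * h0) * (a + b * h1) < 0 ->
  exists r, [/\ h0 < r < h1, b != 0 & forall h, a + b * h = b * (h - r)].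
Proof.
move=> h01 lt0; have b0 : b != 0.
  by apply: contraTneq lt0 => ->; rewrite !mul0r !addr0 -leNgt -expr2 sqr_ge0.
exists (- a / b); have E h : a + b * h = b * (h - - a / b) by field.
split=> //; move: lt0; rewrite !E mulrACA pmulr_rlt0; last by rewrite -expr2 exprn_even_gt0.
move: (- a / b) => r; case: (ltgtP h0 r) => [h0r|h0r|->]; last by rewrite subrr mul0r ltxx.
- by rewrite nmulr_rlt0 ?subr_lt0 // subr_gt0.
- by rewrite pmulr_rlt0 ?subr_gt0 // subr_lt0 // => hr; have := lt_trans hr h0r; rewrite ltNge ltW.
Qed.

Variables (g : link2 R -> int) (M : 'M[R]_3) (C d : space) (r o : seq space).
Hypotheses (hg : null_invariant g) (hM : is_frame M) (d0 : d != 0) (Md : project M d = 0)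
  (gp : general_position (map (project M) (C :: r)) (map (project M) o))
  (genW : gen (r ++ o)) (sW : (3 < size (r ++ o))%N).

Let pt (h : R) := C + h *: d.

(** At each height the moving vertex meets at most one of the planes. Triples are ordered, so each
    plane is listed six times and vertex sets have to be compared. *)
Hypothesis simple : forall t t' h, t \in triples (r ++ o) -> t' \in triples (r ++ o) ->
  tvol (pt h) t = 0 -> tvol (pt h) t' = 0 -> {subset tverts t' <= tverts t}.

Let good (h : R) := forall t, t \in triples (r ++ o) -> tvol (pt h) t != 0.

Lemma tvol_affine t : exists a b, forall h, tvol (pt h) t = a + b * h.
Proof.
exists (vol C t.1.1 t.1.2 t.2), (vol (C + d) t.1.1 t.1.2 t.2 - vol C t.1.1 t.1.2 t.2) => h.
by rewrite /tvol /pt /vol /det3 !mxE; ring.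
Qed.

Lemma good_gen h : good h -> gen ((pt h :: r) ++ o).
Proof. by move=> hh; apply: gen_cons. Qed.

Lemma pt_project h : project M (pt h) = project M C.
Proof.
have -> : pt h = 1 *: C + h *: d by rewrite scale1r.
by rewrite project_lin Md scale1r scaler0 addr0.
Qed.

Lemma gp_pt h : general_position (map (project M) (pt h :: r)) (map (project M) o).
Proof. by rewrite /= pt_project. Qed.

Definition tflip (h0 h1 : R) t := tvol (pt h0) t * tvol (pt h1) t < 0.

(** Four points that change orientation include the moving vertex; the other three form the
    triple. *)
Lemma flips_triple h0 h1 X Y Z W : good h0 -> good h1 ->
  uniq [:: X; Y; Z; W] -> {subset [:: X; Y; Z; W] <= (pt h0 :: r) ++ o} ->
  flips (pt h0) (pt h1) X Y Z W ->
  exists2 t, t \in triples (r ++ o) & tflip h0 h1 t /\ [:: X; Y; Z; W] =i pt h0 :: tverts t.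
Proof.
move=> g0 g1 uq S; rewrite /flips.
have [uV _ _] := good_gen g0.
have hP : pt h0 \notin r ++ o by move: uV; rewrite /= => /andP[].
have sl0 : slide (pt h0) (pt h1) (pt h0) = pt h1 by rewrite /slide eqxx.
have sl x : x != pt h0 -> slide (pt h0) (pt h1) x = x by rewrite /slide => /negPf->.
have key x y z : uniq [:: pt h0; x; y; z] -> {subset [:: x; y; z] <= (pt h0 :: r) ++ o} ->
    (x, y, z) \in triples (r ++ o).
  move=> u4 S3; apply/triplesP; split; last by case/andP: u4.
  move=> w hw; have := S3 w hw; rewrite inE => /orP[/eqP E|//].
  by move: u4; rewrite -E cons_uniq hw.
move: (uq); rewrite /= !inE !negb_or => /and4P[/and3P[n1 n2 n3] /andP[n4 n5] n6 _].
have [EX|nX] := eqVneq X (pt h0).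
  have e1 : Y != pt h0 by rewrite -EX eq_sym. have e2 : Z != pt h0 by rewrite -EX eq_sym.
  have e3 : W != pt h0 by rewrite -EX eq_sym.
  rewrite EX sl0 (sl _ e1) (sl _ e2) (sl _ e3) => f; exists (Y, Z, W); last by split.
  by apply: key; [rewrite -EX|move=> w hw; apply: S; rewrite inE hw orbT].
have [EY|nY] := eqVneq Y (pt h0).
  have e2 : Z != pt h0 by rewrite -EY eq_sym. have e3 : W != pt h0 by rewrite -EY eq_sym.
  rewrite EY sl0 (sl _ nX) (sl _ e2) (sl _ e3) (vol_swap (pt h0)) (vol_swap (pt h1)) mulrNN => f.
  exists (X, Z, W); last by split=> // w; rewrite !inE orbCA.
  apply: key; first by rewrite -EY /= !inE !negb_or n4 n5 (eq_sym Y) n1 n2 n3 n6.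
  by move=> w hw; apply: S; move: hw; rewrite !inE => /or3P[]->; rewrite ?orbT.
have [EZ|nZ] := eqVneq Z (pt h0).
  have e3 : W != pt h0 by rewrite -EZ eq_sym.
  rewrite EZ sl0 (sl _ nX) (sl _ nY) (sl _ e3).
  rewrite (vol_swap23 X (pt h0) Y) (vol_swap23 X (pt h1) Y) mulrNN.
  rewrite (vol_swap (pt h0)) (vol_swap (pt h1)) mulrNN => f.
  exists (X, Y, W); last by split=> // w; rewrite !inE [(w == Y) || _]orbCA orbCA.
  apply: key; first by rewrite -EZ /= !inE !negb_or n6 (eq_sym Z) n2 (eq_sym Z) n4 n1 n3 n5.
  by move=> w hw; apply: S; move: hw; rewrite !inE => /or3P[]->; rewrite ?orbT.
have [EW|nW] := eqVneq W (pt h0).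
  rewrite EW sl0 (sl _ nX) (sl _ nY) (sl _ nZ).
  rewrite (vol_swap34 X Y (pt h0) Z) (vol_swap34 X Y (pt h1) Z) mulrNN.
  rewrite (vol_swap23 X (pt h0) Y) (vol_swap23 X (pt h1) Y) mulrNN (vol_swap (pt h0)) (vol_swap (pt h1)) mulrNN => f.
  exists (X, Y, Z); last first.
    split=> // w; rewrite !inE; do 4 case: eqP => //=.
  apply: key; first by rewrite -EW /= !inE !negb_or (eq_sym W) n3 (eq_sym W) n5 (eq_sym W) n6 n1 n2 n4.
  by move=> w hw; apply: S; move: hw; rewrite !inE => /or3P[]->; rewrite ?orbT.
by rewrite !sl // -expr2 ltNge sqr_ge0.
Qed.

(** Induction on the number of ordered triples whose plane is crossed. If they all have the same
    vertices, one vertical move suffices; otherwise the move is cut between the heights of two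
    crossed planes, and each part misses one of them. *)
Lemma value_chain h0 h1 : h0 < h1 -> good h0 -> good h1 ->
  value g (pt h0 :: r) o = value g (pt h1 :: r) o.
Proof.
have [n] := ubnP (count (tflip h0 h1) (triples (r ++ o))).
elim: n h0 h1 => // n IH h0 h1 cn h01 g0 g1.
have [[t [t' [ht ht' ft [ft' ns]]]]|one] := pselect (exists t t', [/\ t \in triples (r ++ o),
   t' \in triples (r ++ o), tflip h0 h1 t & tflip h0 h1 t' /\ ~ {subset tverts t' <= tverts t}]); last first.
  apply: (@value_vertical R M (pt h0) (pt h1) r o hM); rewrite ?pt_project //.
  - apply: contraTneq h01 => /addrI/eqP; rewrite -subr_eq0 -scalerBl scaler_eq0 (negPf d0) orbF subr_eq0.
    by move=> /eqP->; rewrite ltxx.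
  - exact: gp_pt.
  - exact: good_gen.
  - exact: good_gen.
  move=> X Y Z W X' Y' Z' W' hX hY hZ hW u hX' hY' hZ' hW' u' f f'.
  have S : {subset [:: X; Y; Z; W] <= (pt h0 :: r) ++ o} by move=> w; rewrite !inE => /or4P[] /eqP->.
  have S' : {subset [:: X'; Y'; Z'; W'] <= (pt h0 :: r) ++ o} by move=> w; rewrite !inE => /or4P[] /eqP->.
  have [t ht [ft et]] := flips_triple g0 g1 u S f; have [t' ht' [ft' et']] := flips_triple g0 g1 u' S' f'.
  move=> w; rewrite et et' !(in_cons (pt h0)) => /orP[->//|hw]; apply/orP; right.
  have : {subset tverts t' <= tverts t} by apply: contrapT => ns; apply: one; exists t, t'.
  by apply.
have root (s : space * space * space) : tflip h0 h1 s -> exists a b, [/\ h0 < a < h1, b != 0 & forall h, tvol (pt h) s = b * (h - a)].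
  have [a [b E]] := tvol_affine s; rewrite /tflip !E => /(affine_root h01)[x [hx b0 Ex]].
  by exists x, b; split=> // h; rewrite E Ex.
have [a [b [ha b0 Ea]]] := root t ft; have [a' [b' [ha' b0' Ea']]] := root t' ft'.
have aa' : a != a'.
  apply/eqP => E; apply: ns; apply: (simple (h := a)) => //; first by rewrite Ea subrr mulr0.
  by rewrite Ea' E subrr mulr0.
(* split between the heights of two distinct sign changes *)
have main (s s' : space * space * space) (x y p q : R) : s \in triples (r ++ o) -> s' \in triples (r ++ o) ->
    tflip h0 h1 s -> tflip h0 h1 s' ->
    (forall h, tvol (pt h) s = y * (h - x)) -> y != 0 -> h0 < x < h1 ->
    (forall h, tvol (pt h) s' = q * (h - p)) -> q != 0 -> h0 < p < h1 -> x < p ->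
    value g (pt h0 :: r) o = value g (pt h1 :: r) o.
  move=> hs hs' fs fs' Es y0 /andP[hx hx'] Es' q0 /andP[hp hp'] xp.
  have [e0 e00 he] : exists2 e0 : R, 0 < e0 & forall e, 0 < e < e0 ->
      forall u, u \in triples (r ++ o) -> tvol (pt (x + e)) u != 0.
    apply: eps_all => u hu; have [al [be E]] := tvol_affine u.
    have [z|z] := eqVneq (al + be * x) 0.
      exists 1 => // e /andP[e_gt0 _]; rewrite E mulrDr addrA z add0r.
      apply: mulf_neq0; last by rewrite gt_eqF.
      have := g0 u hu; rewrite E; apply: contraNneq => be0; rewrite be0 !mul0r addr0 in z *.
      by rewrite z.
    have [|e0 e00 he] := @small_pos R _ [:: 0 : R] (fun=> (al + be * x) * (al + be * x)) (fun=> be * (al + be * x)).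
      by move=> _ _; rewrite -expr2 exprn_even_gt0.
    exists e0 => // e /andP[e_gt0 ee0]; rewrite E.
    have := he e 0; rewrite (ltW e_gt0) ee0 mem_head => /(_ isT isT).
    apply: contraTneq => k; rewrite -leNgt.
    rewrite [X in X <= _](_ : _ = (al + be * (x + e)) * (al + be * x)); last by ring.
    by rewrite k mul0r.
  (* By the choice of [e0] no plane is met strictly between [x] and [x + e0], so [h] is a good
     height; it also stays below [p]. *)
  pose h := x + Num.min e0 (p - x) / 2.
  have m0 : 0 < Num.min e0 (p - x) by rewrite lt_min e00 subr_gt0.
  have [m1 m2] : Num.min e0 (p - x) <= e0 /\ Num.min e0 (p - x) <= p - x.
    by rewrite !ge_min !lexx orbT.
  have xh : x < h by rewrite /h; lra.
  have hp1 : h < p by rewrite /h; lra.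
  have gh : good h by move=> u hu; apply: he hu; lra.
  have h0h : h0 < h by lra.
  have hh1 : h < h1 by lra.
  (* Volumes are affine in the height: a sign change on a part of the interval is one on the
     whole. *)
  have mono k l u : h0 <= k -> k < l -> l <= h1 -> u \in triples (r ++ o) -> tflip k l u -> tflip h0 h1 u.
    move=> hk kl hl hu; have [al [be E]] := tvol_affine u; rewrite /tflip !E => /(affine_root kl)[z [/andP[z1 z2] be0 Ez]].
    rewrite !Ez mulrACA pmulr_rlt0; last by rewrite -expr2 exprn_even_gt0.
    by rewrite nmulr_rlt0 ?subr_gt0 ?subr_lt0; lra.
  have lt_count k l u : h0 <= k -> k < l -> l <= h1 -> u \in triples (r ++ o) -> tflip h0 h1 u -> ~ tflip k l u ->
      (count (tflip k l) (triples (r ++ o)) < n)%N.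
    move=> hk kl hl hu f nf; rewrite ltnS in cn; apply: leq_trans cn.
    apply: (count_lt _ hu f nf) => v hv; exact: (mono k l v).
  transitivity (value g (pt h :: r) o).
    apply: IH => //; apply: (lt_count h0 h s') => //; [exact: ltW|].
    rewrite /tflip !Es' mulrACA pmulr_rlt0; last by rewrite -expr2 exprn_even_gt0.
    by rewrite nmulr_rlt0 ?subr_lt0 // subr_gt0 ltNge ltW.
  apply: IH => //; apply: (lt_count h h1 s) => //; [exact: ltW|].
  rewrite /tflip !Es mulrACA pmulr_rlt0; last by rewrite -expr2 exprn_even_gt0.
  by rewrite pmulr_rlt0 ?subr_gt0 // subr_lt0 ltNge ltW.
case: (ltgtP a a') aa' => // lt _.
  exact: (main t t' a b a' b').
exact: (main t' t a' b' a b).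
Qed.

End Chain.

(** * Density of the admissible vertex moves *)

Section GenericMove.
Variable R : realType.
Notation space := 'rV[R]_3.
Implicit Types (A B C D X Y Z W P Q N d : space) (s o r V : seq space) (t : space * space * space).

Lemma triples_vol P V t : gen (P :: V) -> t \in triples V -> tvol P t != 0.
Proof.
case=> u _ h4 /triplesP[]; case: t => -[X Y] Z S ut.
have m W : W \in tverts (X, Y, Z) -> W \in P :: V by move=> h; rewrite inE (S W h) orbT.
apply: h4; rewrite ?mem_head ?m ?inE ?eqxx ?orbT // cons_uniq ut andbT.
by move: u => /= /andP[+ _]; apply: contra; exact: S.
Qed.

Variables (g : link2 R -> int) (C : space) (r o : seq space).
Hypotheses (hg : null_invariant g) (hgen : gen ((C :: r) ++ o))
  (sr : (2 < size (C :: r))%N) (so : (2 < size o)%N).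

Let W := r ++ o.
Let V := C :: W.

Let genW : gen W.
Proof.
apply: gen_sub hgen; first by case: hgen => /= /andP[].
by move=> x; rewrite /= inE orbC => ->.
Qed.

Let sW : (3 < size W)%N.
Proof. by rewrite size_cat; move: sr so => /=; lia. Qed.

(** The triples run over [V], with [C] included, because the projection of the moving vertex has to
    be in general position too. *)
Lemma dense_transverse : dense (fun C' => forall t, t \in triples V ->
  det3 (C' - C) (t.1.2 - t.1.1) (t.2 - t.1.1) != 0).
Proof.
apply: dense_all => -[[X Y] Z] /triplesP[S u] /=.
apply: (@dense_neq0 _ _ (C + cross (Y - X) (Z - X))); first exact: line_poly_det3B.
have h : cross (Y - X) (Z - X) != 0.
  by case: hgen => _ h3 _; apply: h3 => //; apply: S; rewrite !inE eqxx ?orbT.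
rewrite addrAC subrr add0r.
rewrite (_ : det3 _ _ _ = dot (cross (Y - X) (Z - X)) (cross (Y - X) (Z - X))); last first.
  by rewrite dotE /det3 !mxE /=; ring.
by rewrite gt_eqF // dot_gt0.
Qed.

Lemma dense_nonconcurrent : dense (fun C' => forall t, t \in triples V -> forall t', t' \in triples V ->
  uniq (tverts t ++ tverts t') -> concur (C' - C) t.1.1 t.1.2 t.2 t'.1.1 t'.1.2 t'.2 != 0).
Proof.
apply: dense_all => -[[X1 Y1] X2] /triplesP[S u]; apply: dense_all => -[[Y2 X3] Y3] /triplesP[S' u'] /=.
apply: dense_imp => u6.
apply: (@dense_neq0 _ _ (C + (X2 - X1))); first exact: line_poly_concur.
rewrite addrAC subrr add0r concur_transversal oppr_eq0.
have [h1 h2 h3] : [/\ X1 \in V, Y1 \in V & X2 \in V] by split; apply: S; rewrite !inE eqxx ?orbT.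
have [h4 h5 h6] : [/\ Y2 \in V, X3 \in V & Y3 \in V] by split; apply: S'; rewrite !inE eqxx ?orbT.
case: hgen => _ _ hv; move: u6; rewrite !inE !negb_or.
move=> /and5P[/and5P[n12 n13 n14 n15 n16] /and4P[n23 n24 n25 n26] /and3P[n34 n35 n36] /andP[n45 n46] /andP[n56 _]].
apply: mulf_neq0; apply: hv => //=; rewrite !inE !negb_or ?n13 ?n12 ?n14 ?n15 ?n16 ?n35 ?n36 ?n34 ?n24 ?n56 //.
by rewrite eq_sym n23.
Qed.

(** The expression vanishes if the line from [C] to [C'] meets the planes of [t] and [t'] at one
    point. It is nonzero when [C'] is a vertex of [t'] outside [t]: the first product is then zero
    and the second is not. *)
Lemma dense_simple : dense (fun C' => forall t, t \in triples W -> forall t', t' \in triples W ->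
  ~ {subset tverts t' <= tverts t} -> tvol C t * tvol C' t' - tvol C t' * tvol C' t != 0).
Proof.
apply: dense_all => t ht; apply: dense_all => t' ht'.
apply: dense_imp => ns.
have [Z hZ nZ] : exists2 Z, Z \in tverts t' & Z \notin tverts t.
  apply: contrapT => no; apply: ns => Z hZ; apply: contrapT => /negP nZ; apply: no; by exists Z.
have [[S u] [S' u']] := (proj1 (triplesP W t) ht, proj1 (triplesP W t') ht').
apply: (@dense_neq0 _ (fun x => tvol C t * tvol x t' - tvol C t' * tvol x t) Z).
  by apply: line_polyB; apply: line_polyM; first [exact: line_poly_cst|exact: line_poly_vol].
have -> : tvol Z t' = 0.
  by move: hZ; rewrite !inE /tvol => /or3P[]/eqP->; rewrite /vol /det3 !mxE; ring.
rewrite mulr0 sub0r oppr_eq0 mulf_neq0 ?(triples_vol hgen) //.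
apply: (@triples_vol _ (tverts t)); last by apply/triplesP; split.
apply: gen_sub hgen; first by rewrite cons_uniq nZ.
have sub x : x \in W -> x \in (C :: r) ++ o by move=> h; rewrite /= in_cons h orbT.
by move=> x; rewrite in_cons => /orP[/eqP->|/S h]; apply: sub => //; exact: S'.
Qed.

Lemma generic_move :
  dense (fun C' => value g (C :: r) o = value g (C' :: r) o /\ gen ((C' :: r) ++ o)).
Proof.
have d1 : dense (fun C' => forall t, t \in triples W -> tvol C' t != 0).
  apply: dense_all => t ht; apply: (@dense_neq0 _ _ C); first exact: line_poly_vol.
  exact: (triples_vol hgen).
apply: dense_sub (dense_and d1 (dense_and dense_transverse (dense_and dense_nonconcurrent dense_simple))).
move=> C' [h1 [h2 [h3 h4]]].
have d0 : C' - C != 0.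
  have [X [Y [hX hY u]]] : exists X Y, [/\ X \in r, Y \in r & uniq [:: C; X; Y]].
    case: (r) (hgen) sr => [|X [|Y r']] // [/= u _ _] _; exists X, Y; rewrite !inE !eqxx orbT; split=> //.
    by move: u; rewrite /= !inE !negb_or => /and3P[/and3P[-> -> _] /andP[-> _] _].
  have : (C, X, Y) \in triples V.
    apply/triplesP; split=> // w; rewrite 3!inE /V in_cons /W mem_cat.
    by move=> /or3P[]/eqP->; rewrite ?eqxx ?hX ?hY ?orbT.
  by move=> /h2; apply: contraNneq => ->; rewrite /det3 !mxE; apply/eqP; ring.
have [M [k [hM k0 ax]]] := frame_along d0.
have Md : project M (C' - C) = 0.
  have -> : C' - C = k^-1 *: axis M by rewrite ax scalerA mulVf // scale1r.
  apply/rowP; apply: ord2P; rewrite ?project0 ?project1 -scalemxAl axis_mul // !mxE /= mulr0 //.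
split; last by apply: gen_cons.
pose e := C' - C.
have E0 : C = C + 0 *: e by rewrite scale0r addr0.
have E1 : C' = C + 1 *: e by rewrite scale1r /e addrC subrK.
rewrite {1}E0 {1}E1; apply: (@value_chain R g M C e r o) => //.
- have [u _ _] := hgen; apply: gp_along => //.
  + move=> X Y Z hX hY hZ u3; rewrite ax.
    have /h2 /= : (X, Y, Z) \in triples V.
      by apply/triplesP; split=> // w; rewrite !inE => /or3P[]/eqP->.
    move=> h; rewrite (_ : det3 _ _ _ = k * det3 (C' - C) (Y - X) (Z - X)) ?mulf_neq0 //.
    by rewrite /det3 !mxE; ring.
  + move=> X1 Y1 X2 Y2 X3 Y3 S u6; rewrite ax concur_scale !mulf_neq0 //.
    have t1 : (X1, Y1, X2) \in triples V.
      apply/triplesP; split; last by move: u6; rewrite -[[:: _; _; _; _; _; _]]/(tverts (X1, Y1, X2) ++ _) cat_uniq => /and3P[].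
      by move=> w hw; apply: S; move: hw; rewrite !inE => /or3P[]->; rewrite ?orbT.
    have t2 : (Y2, X3, Y3) \in triples V.
      apply/triplesP; split; last by move: u6; rewrite -[[:: _; _; _; _; _; _]]/(tverts (X1, Y1, X2) ++ tverts (Y2, X3, Y3)) cat_uniq => /and3P[].
      by move=> w hw; apply: S; move: hw; rewrite !inE => /or3P[]->; rewrite ?orbT.
    exact: (h3 _ t1 _ t2 u6).
- move=> t t' h ht ht' z z'; apply: contrapT => ns; have /eqP := h4 t ht t' ht' ns; apply.
  have E (s : space * space * space) : tvol (C + h *: e) s = (1 - h) * tvol C s + h * tvol C' s.
    by rewrite /tvol -vol_segment; congr vol; rewrite /e; apply/rowP => i; rewrite !mxE; ring.
  rewrite !E in z z'.
  (* Two affine functions of [h] with a common zero have a vanishing determinant. *)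
  transitivity ((tvol C' t' - tvol C t') * ((1 - h) * tvol C t + h * tvol C' t)
    - (tvol C' t - tvol C t) * ((1 - h) * tvol C t' + h * tvol C' t')); first by ring.
  by rewrite z z'; ring.
- by move=> t ht; rewrite -E0; exact: (triples_vol hgen).
- by move=> t ht; rewrite -E1; exact: h1.
Qed.

End GenericMove.

(** * Small vertex moves and comparison of links *)

Section Nudge.
Variable R : realType.
Notation space := 'rV[R]_3.
Implicit Types (A B C D X Y Z W P Q N w x y : space) (s o r t V : seq space).

(** A point of a closed edge lies on its half-open edge or is the start of the next edge; the
    half-open edges are disjoint. *)
Lemma knot_meet s e f x : is_knot s -> e \in edges s -> f \in edges s -> e != f ->
  segment e.1 e.2 x -> segment f.1 f.2 x ->
  (x = e.2 /\ e.2 = f.1) \/ (x = e.1 /\ e.1 = f.2).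
Proof.
move=> [_ us hs] he hf ef ex fx.
have ends A B y : segment A B y -> half_open_segment A B y \/ y = B.
  move=> [t [/andP[t0]]]; rewrite le_eqVlt => /orP[/eqP->|t1] ->.
    by right; rewrite subrr scale0r scale1r add0r.
  by left; exists t; rewrite t0.
have next p : p \in edges s -> exists2 q, q \in edges s & q.1 = p.2.
  move=> hp; have [_ h] := mem_edges hp.
  have /mapP[q hq e2] : p.2 \in map fst (edges s) by rewrite edges1.
  by exists q.
case: (ends _ _ _ ex) => hx; case: (ends _ _ _ fx) => hx'.
- by case/eqP: ef; apply: hs => //; exists x.
- have [q hq e2] := next f hf; right; rewrite -e2 in hx' *.
  suff <- : q = e by [].
  by apply: hs => //; exists x; split=> //; rewrite hx'; exact: halfopen_start.
- have [q hq e2] := next e he; left; rewrite -e2 in hx *.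
  suff <- : q = f by [].
  by apply: hs => //; exists x; split=> //; rewrite hx; exact: halfopen_start.
- by case/eqP: ef; apply: (edges_inj2 us he hf); rewrite -hx.
Qed.

Lemma collinear_scale A C Z : A != C -> ~ noncollinear A C Z -> exists k : R, Z - A = k *: (C - A).
Proof.
move=> AC /negP/negPn/eqP/(cross_eq0 (C - A)) h.
have /dot_gt0 uu : C - A != 0 by rewrite subr_eq0 eq_sym.
exists (dot (C - A) (Z - A) / dot (C - A) (C - A)).
apply: (scalerI (lt0r_neq0 uu)).
by rewrite scalerA mulrC divfK ?gt_eqF.
Qed.

Lemma opposite A C Z : A != C -> A != Z -> ~ noncollinear A C Z ->
  (forall y, segment A C y -> segment A Z y -> y = A) ->
  exists2 k : R, k < 0 & Z - A = k *: (C - A).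
Proof.
move=> AC AZ nc meet; have [k E] := collinear_scale AC nc; exists k => //.
rewrite ltNge; apply/negP => k0; have k0' : k != 0.
  by apply: contraNneq AZ => z; move/eqP: E; rewrite z scale0r subr_eq0 eq_sym.
have kp : 0 < k by rewrite lt0r k0'.
pose l := Num.min 1 k; have l0 : 0 < l by rewrite lt_min ltr01.
have [l1 lk] : l <= 1 /\ l <= k by rewrite !ge_min !lexx orbT.
have : A + l *: (C - A) = A.
  apply: meet.
    by exists l; split; [rewrite ltW|apply/rowP => i; rewrite !mxE; ring].
  exists (l / k); split; first by rewrite (divr_ge0 (ltW l0) (ltW kp)) ler_pdivrMr // mul1r.
  have -> : Z = A + k *: (C - A) by rewrite -E addrC subrK.
  by apply/rowP => i; rewrite !mxE; field.
move/eqP; rewrite -[X in _ == X]addr0 (inj_eq (addrI _)) scaler_eq0 gt_eqF //= subr_eq0 eq_sym.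
by rewrite (negPf AC).
Qed.

(** The link to be nudged may be in bad position, so the edge AZ attached at [A] may be aligned with
    AC; it then leaves [A] in the opposite direction. *)
Lemma corner A C C' Z x : A != C -> A != Z ->
  (forall y, segment A C y -> segment A Z y -> y = A) ->
  noncollinear A C C' -> (noncollinear A C Z -> vol A C C' Z != 0) ->
  triangle A C C' x -> segment A Z x -> x = A.
Proof.
move=> AC AZ meet nc hv xT xZ; have [nZ|nZ] := pselect (noncollinear A C Z).
  exact: triangle_segment_vertex (hv nZ) xT xZ.
have [k k0 E] := opposite AC AZ nZ meet.
case: xT => a [b [c [a0 b0 c0 s1 e1]]]; case: xZ => t [/andP[t0 t1] e2].
have [|h1 h2] := @noncollinear_comb _ A C C' (b - t * k) c nc.
  have EZ : Z = A + k *: (C - A) by rewrite -E addrC subrK.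
  apply: subr0_eq; rewrite subr0; have /rowP := e1; rewrite e2 EZ => h.
  have ea : a = 1 - b - c by lra.
  by subst a; apply/rowP => i; have := h i; rewrite !mxE; clear; lra.
have t0' : t = 0.
  apply/eqP; rewrite eq_le t0 andbT -(@ler_nM2r _ k) // mul0r; lra.
by rewrite e2 t0' subr0 scale1r scale0r addr0.
Qed.

(** The same dichotomy for the second triangle of a vertex move, when the edge from [A] already ends
    at [C']. *)
Lemma tip A B C C' x : C != B -> C != A ->
  (forall y, segment C B y -> segment C A y -> y = C) ->
  noncollinear C B C' -> (noncollinear C B A -> vol C B C' A != 0) ->
  triangle C' B C x -> segment A C' x -> x = C'.
Proof.
move=> CB CA meet nc hv xT xA; have [nA|nA] := pselect (noncollinear C B A).
  rewrite segmentC in xA; apply: triangle_segment_vertex xT xA.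
  by rewrite vol_neq12 vol_neq23 vol_neq12; move: (hv nA); rewrite vol_neq12 vol_neq23 vol_neq12 vol_neq23.
have [k k0 E] := opposite CB CA nA meet.
case: xT => a [b [c [a0 b0 c0 s1 e1]]]; case: xA => t [/andP[t0 t1] e2].
have [|h1 h2] := @noncollinear_comb _ C B C' (b - (1 - t) * k) (a - t) nc.
  have EA : A = C + k *: (B - C) by rewrite -E addrC subrK.
  apply: subr0_eq; rewrite subr0; have /rowP := e1; rewrite e2 EA => h.
  have ea : a = 1 - b - c by lra.
  by subst a; apply/rowP => i; have := h i; rewrite !mxE; clear; lra.
have t1' : 1 - t = 0.
  apply/eqP; rewrite eq_le subr_ge0 t1 andbT -(@ler_nM2r _ k) // mul0r; lra.
have t1'' : t = 1 by lra.
by rewrite e2 t1'' subrr scale1r scale0r add0r.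
Qed.

Lemma convex_gt0 (a b c p q r : R) : 0 <= a -> 0 <= b -> 0 <= c -> a + b + c = 1 ->
  0 < p -> 0 < q -> 0 < r -> 0 < a * p + b * q + c * r.
Proof.
move=> a0 b0 c0 s1 p0 q0 r0; pose m := Num.min p (Num.min q r).
have m0 : 0 < m by rewrite !lt_min p0 q0.
have [m1 m2 m3] : [/\ 0 <= p - m, 0 <= q - m & 0 <= r - m].
  by rewrite !subr_ge0 !ge_min !lexx !orbT.
have := mulr_ge0 a0 m1; have := mulr_ge0 b0 m2; have := mulr_ge0 c0 m3.
have -> : a = 1 - b - c by lra.
lra.
Qed.

(** Instead of compactness, the separating normal of [sep_triangle], which still works after a small
    displacement of [C]. *)
Lemma separated_near A B C w P Q : triangle A B C `&` segment P Q = set0 ->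
  exists2 e0 : R, 0 < e0 & forall e, 0 < e < e0 ->
    triangle A B (C + e *: w) `&` segment P Q = set0.
Proof.
move=> /sep_triangle[n hn].
have [|e0 e00 he] := @small_pos R _ [:: P; Q] (fun X => dot n (C - X)) (fun=> dot n w).
  by move=> X; rewrite !inE => /orP[]/eqP->; apply: hn; rewrite !inE eqxx ?orbT.
exists e0 => // e ee0; apply/seteqP; split=> // x [[a [b [c [a0 b0 c0 s1 e1]]]] [t [/andP[t0 t1] e2]]].
have hP : 0 < dot n (C - P) + e * dot n w by apply: he; rewrite ?mem_head //; lra.
have hQ : 0 < dot n (C - Q) + e * dot n w by apply: he; rewrite ?inE ?eqxx ?orbT //; lra.
have pos X Y (p q : R) : 0 <= p -> 0 < q -> 0 <= p * q by move=> ? ?; rewrite mulr_ge0 // ltW.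
have d X : 0 < dot n (A - X) -> 0 < dot n (B - X) -> 0 < dot n (C - X) + e * dot n w -> 0 < dot n (x - X).
  move=> p q r; have := convex_gt0 a0 b0 c0 s1 p q r; congr (_ < _).
  have ea : a = 1 - b - c by lra.
  by subst a; rewrite e1 !dotE !mxE; ring.
have dP : 0 < dot n (x - P) by apply: d => //; apply: hn; rewrite !inE eqxx ?orbT.
have dQ : 0 < dot n (x - Q) by apply: d => //; apply: hn; rewrite !inE eqxx ?orbT.
have t2 : 0 <= 1 - t by lra.
have := @convex_gt0 (1 - t) t 0 _ _ 1 t2 t0 (lexx 0) _ dP dQ ltr01; rewrite addr0 subrK => /(_ erefl).
have -> : (1 - t) * dot n (x - P) + t * dot n (x - Q) = 0 by rewrite e2 !dotE !mxE; ring.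
by rewrite mul0r addr0 ltxx.
Qed.

Lemma dense_vol X Y Z : noncollinear X Y Z -> dense (fun P => vol X Y P Z != 0).
Proof.
move=> nc; apply: (@dense_sub _ (fun P => vol P X Y Z != 0)) => [P|].
  by rewrite (vol_neq23 X P) (vol_neq12 P).
apply: (@dense_neq0 _ _ (X + cross (Y - X) (Z - X))); first exact: line_poly_vol.
rewrite (_ : vol _ _ _ _ = - dot (cross (Y - X) (Z - X)) (cross (Y - X) (Z - X))).
  by rewrite oppr_eq0 gt_eqF // dot_gt0.
by rewrite /vol dotE /det3 !mxE /=; ring.
Qed.

Lemma dense_noncollinear X Y : X != Y -> dense (noncollinear X Y).
Proof.
move=> XY; have [|a _ h] := @cross_basis _ (Y - X); first by rewrite subr_eq0 eq_sym.
have /dense_vol : noncollinear X Y (X + a) by rewrite /noncollinear addrAC subrr add0r.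
by apply: dense_sub => P; exact: vol_noncollinear.
Qed.

Lemma noncollinear12 A B C : noncollinear A B C -> noncollinear B A C.
Proof.
rewrite /noncollinear; apply: contraNneq => /rowP h; apply/eqP/rowP.
by apply: ord3P; [have := h 0|have := h 1|have := h ord_max]; rewrite !mxE /=; lra.
Qed.

Lemma noncollinear23 A B C : noncollinear A B C -> noncollinear A C B.
Proof.
rewrite /noncollinear; apply: contraNneq => /rowP h; apply/eqP/rowP.
by apply: ord3P; [have := h 0|have := h 1|have := h ord_max]; rewrite !mxE /=; lra.
Qed.

Lemma clear_edge A B C t o : valid [:: A, B & t] o -> noncollinear A B C ->
  (forall Z, Z \in t -> noncollinear A B Z -> vol A B C Z != 0) ->
  (forall e, e \in arcs B t A ++ edges o -> segment A B `&` segment e.1 e.2 = set0 ->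
     triangle A B C `&` segment e.1 e.2 = set0) ->
  clear A B C t o.
Proof.
move=> [ks _ dis] nc hv hs; have [sz us _] := ks.
have ABe : (A, B) \in edges [:: A, B & t] by rewrite edges_cons arcs_cons mem_head.
have Pe e : e \in arcs B t A -> e \in edges [:: A, B & t].
  by rewrite edges_cons arcs_cons inE => ->; rewrite orbT.
have us' := us; rewrite /= inE negb_or in us'; case/andP: us' => /andP[AB At] /andP[Bt ut].
split.
  move=> e x he ex xT; have [e1 e2] := mem_arcs he.
  have ne : (A, B) != e.
    apply/eqP => E; have : uniq (edges [:: A, B & t]) by exact: uniq_edges.
    by rewrite edges_cons arcs_cons /= E he.
  have meet y := @knot_meet _ (A, B) e y ks ABe (Pe _ he) ne.
  have nA : e.1 != A by apply: contraTneq e1 => ->; rewrite inE negb_or AB.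
  have nB : e.2 != B by apply: contraTneq e2 => ->; rewrite mem_rcons inE negb_or eq_sym AB.
  have nn : ~ (e.1 = B /\ e.2 = A).
    case=> E1 E2; have := @edges_flip _ _ _ A B us sz ABe.
    by have := Pe _ he; rewrite (surjective_pairing e) E1 E2 => ->.
  have [E1|n1] := eqVneq e.1 B.
    have n2 : e.2 != A by apply/eqP => E2; apply: nn.
    right; rewrite E1 in ex; rewrite triangleC -triangleC in xT.
    have xT' : triangle B A C x by rewrite triangleC.
    apply: corner xT' ex; rewrite ?(eq_sym B) //.
    - move=> y; rewrite segmentC => h1 h2; case: (meet y) => //=; rewrite ?E1 //; case=> // _ F.
      by rewrite F eqxx in n2.
    - exact: noncollinear12.
    - move=> h; rewrite vol_neq12; apply: hv.
        by move: e2; rewrite mem_rcons inE (negPf n2).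
      exact: noncollinear12.
  have [E2|n2] := eqVneq e.2 A.
    left; rewrite E2 segmentC in ex; apply: corner xT ex => //; first by rewrite eq_sym.
    - move=> y h1 h2; case: (meet y) => //=; rewrite ?E2 1?segmentC //; case=> // _ F.
      by rewrite -F eqxx in n1.
    - by apply: hv; move: e1; rewrite inE (negPf n1).
  have : (triangle A B C `&` segment e.1 e.2) x by [].
  rewrite hs ?mem_cat ?he //.
  apply/seteqP; split=> // y [h1 h2]; have [[_ F]|[_ F]] := meet y h1 h2.
    by rewrite -F eqxx in n1.
  by rewrite -F eqxx in n2.
move=> x xT [e he ex].
have : (triangle A B C `&` segment e.1 e.2) x by [].
rewrite hs ?mem_cat ?he ?orbT //; apply/seteqP; split=> // y [h1 h2].
by rewrite -dis; split; [exists (A, B)|exists e].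
Qed.

(** The triangle on [A], [B], [x] is the edge itself, so edges that do not meet it stay clear of
    nearby triangles; those attached at [A] or [B] are handled by the generic condition [Q]. The
    point [x] is the midpoint in [grow] and an end of the edge in [nudge]. *)
Lemma clear_near A B t o x : valid [:: A, B & t] o -> segment A B x ->
  exists Q : space -> Prop, dense Q /\ forall w, exists2 e0 : R, 0 < e0 & forall e, 0 < e < e0 ->
    Q (x + e *: w) -> noncollinear A B (x + e *: w) /\ clear A B (x + e *: w) t o.
Proof.
move=> v [l [/andP[l0 l1] ex]].
have AB : A != B by case: v => -[_ /=]; rewrite inE negb_or => /andP[/andP[]].
exists (fun C => noncollinear A B C /\ forall Z, Z \in t -> noncollinear A B Z -> vol A B C Z != 0).
split.
  apply: dense_and; first exact: dense_noncollinear.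
  by apply: dense_all => Z _; apply: dense_imp; exact: dense_vol.
move=> w; have [|e0 e00 he] := @eps_all R _ (arcs B t A ++ edges o) (fun e ε =>
    segment A B `&` segment e.1 e.2 = set0 -> triangle A B (x + ε *: w) `&` segment e.1 e.2 = set0); last first.
  exists e0 => // e ee [q1 q2]; split=> //; apply: clear_edge => // p hp; exact: he.
move=> e _; have [E|nE] := pselect (segment A B `&` segment e.1 e.2 = set0); last first.
  by exists 1.
have [|e1 e10 h] := @separated_near A B x w e.1 e.2; last by exists e1 => // ε hε _; exact: h.
apply/seteqP; split=> // y [[a [b [c [a0 b0 c0 s1 ey]]]] hy]; rewrite -E; split=> //.
exists (b + c * l); split.
  have c1 := mulr_ge0 c0 l0; have c2 : 0 <= c * (1 - l) by rewrite mulr_ge0 // subr_ge0.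
  by apply/andP; split; first lra; have <- : a + b + c = 1 by []; lra.
have ea : a = 1 - b - c by lra.
by subst a; rewrite ey ex; apply/rowP => i; rewrite !mxE; ring.
Qed.

Variable g : link2 R -> int.
Hypothesis hg : null_invariant g.

Lemma grow A B t o : valid [:: A, B & t] o -> t != [::] ->
  exists C, valid [:: A, C, B & t] o /\ value g [:: A, C, B & t] o = value g [:: A, B & t] o.
Proof.
move=> v t0; have m : segment A B (2^-1 *: A + 2^-1 *: B).
  by exists 2^-1; split; [lra|congr (_ *: _ + _); lra].
have [Q [dQ near]] := clear_near v m.
have [w [e0 [e00 he]]] := dense_near (2^-1 *: A + 2^-1 *: B) dQ; have [e1 e10 he1] := near w.
pose e := Num.min e0 e1 / 2.
have e_gt0 : 0 < Num.min e0 e1 by rewrite lt_min e00.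
have [m1 m2] : Num.min e0 e1 <= e0 /\ Num.min e0 e1 <= e1 by rewrite !ge_min !lexx orbT.
have ee0 : 0 < e < e0 by rewrite /e; lra.
have ee1 : 0 < e < e1 by rewrite /e; lra.
have [nc cl] := he1 e ee1 (he e ee0).
have v' := valid_insert v nc cl; exists (2^-1 *: A + 2^-1 *: B + e *: w); split=> //.
exact: value_tri.
Qed.

Lemma nudge C r o (P : space -> Prop) : valid (C :: r) o -> dense P ->
  exists C', [/\ P C', valid (C' :: r) o & value g (C :: r) o = value g (C' :: r) o].
Proof.
move=> v dP; have [[sz us hs] ho dis] := v.
case: r sz us v {hs dis} => [|B r] //; case/lastP: r => [|t A] // _ _ v.
pose n := (size t).+2.
have rE X : rot n [:: X, B & rcons t A] = [:: A, X, B & t].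
  have -> : [:: X, B & rcons t A] = [:: X, B & t] ++ [:: A] by rewrite /= cats1.
  exact: (rot_size_cat [:: X, B & t] [:: A]).
have v1 : valid [:: A, C, B & t] o by rewrite -rE; exact: valid_rot.
have [ks _ _] := v1; have [sz us _] := ks.
have us' := us; rewrite /= !inE !negb_or in us'.
case/and3P: us' => /and3P[AC AB At] /andP[CB Ct] /andP[Bt ut].
have [Q1 [dQ1 near1]] := clear_near v1 (proj2 (segment_ends A C)).
have [Q2 [dQ2 near2]] := clear_near v (proj1 (segment_ends C B)).
have dQ3 : dense (fun x => noncollinear C B A -> vol C B x A != 0).
  by apply: dense_imp; exact: dense_vol.
have [w [e0 [e00 he]]] := dense_near C (dense_and dP (dense_and dQ1 (dense_and dQ2 dQ3))).
have [e1 e10 he1] := near1 w; have [e2 e20 he2] := near2 w.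
pose m := Num.min e0 (Num.min e1 e2); pose e := m / 2.
have m_gt0 : 0 < m by rewrite !lt_min e00 e10.
have [m1 m2 m3] : [/\ m <= e0, m <= e1 & m <= e2] by rewrite !ge_min !lexx !orbT.
have [hP [q1 [q2 q3]]] : P (C + e *: w) /\ Q1 (C + e *: w) /\ Q2 (C + e *: w) /\
    (noncollinear C B A -> vol C B (C + e *: w) A != 0) by apply: he; rewrite /e; lra.
have ee1 : 0 < e < e1 by rewrite /e; lra.
have ee2 : 0 < e < e2 by rewrite /e; lra.
have [nc1 cl1] := he1 e ee1 q1; have [nc2 [cl2 cl2']] := he2 e ee2 q2.
move: (C + e *: w) hP q1 q2 q3 nc1 cl1 nc2 cl2 cl2' => C' hP q1 q2 q3 nc1 cl1 nc2 cl2 cl2'.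
have tri x : triangle C' B C x -> triangle C B C' x.
  by rewrite triangleAC triangleC triangleAC.
have edge p : p \in [:: (A, C); (C, B)] -> p \in edges [:: A, C, B & t].
  by rewrite edges_cons !arcs_cons !inE orbA => ->.
have meetAC y : segment C B y -> segment C A y -> y = C.
  rewrite (segmentC C A) => h1 h2.
  have ne : (A, C) != (C, B) by apply/eqP; case=> F _; rewrite F eqxx in AC.
  have eA := edge (A, C) (mem_head _ _); have eB := edge (C, B) ltac:(by rewrite !inE eqxx orbT).
  have [[-> //]|[_ F]] := knot_meet ks eA eB ne h2 h1.
  by move/eqP: AB; case.
(* [cl2] concerns the old link, with the edge from [A] to [C]. After the first triangle move this
   edge ends at [C'] and meets the second triangle only at its tip. *)
have cl3 : clear C' B C (rcons t A) o.
  split=> [p x|x /tri]; last exact: cl2'.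
  rewrite arcs_rcons mem_rcons inE => /orP[/eqP->|hp] px xT /=.
    by left; apply: (tip CB _ meetAC nc2 q3 xT px); rewrite eq_sym.
  have hp' : p \in arcs B (rcons t A) C by rewrite arcs_rcons mem_rcons inE hp orbT.
  have [Ex|] := cl2 p x hp' px (tri _ xT); last by right.
  exfalso; have [p1 p2] := mem_arcs hp.
  have pe : p \in edges [:: A, C, B & t] by rewrite edges_cons !arcs_cons !inE hp !orbT.
  have ne : p != (C, B).
    by apply: contraTneq p1 => ->; rewrite inE negb_or CB.
  have [[_ F]|[F _]] := knot_meet ks pe (edge (C, B) ltac:(by rewrite !inE eqxx orbT)) ne px (eq_ind_r (segment C B) (proj1 (segment_ends C B)) Ex).
    by move: p2; rewrite F mem_rcons inE eq_sym (negPf AC) (negPf Ct).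
  by move: p1; rewrite -F Ex inE (negPf CB) (negPf Ct).
have nc3 : noncollinear C' B C by exact/noncollinear12/noncollinear23/noncollinear12.
have [v2 E] := value_vertex hg v1 nc1 nc3 cl1 cl3; have v3 := valid_rot 1 v2; rewrite rot1_cons /= in v3.
exists C'; split; [exact: hP|exact: v3|].
rewrite -(value_rot hg n v) -(value_rot hg n v3) !rE; exact: E.
Qed.

End Nudge.

(** * Exchange of the two components *)

Section Swap.
Variable R : realType.
Notation space := 'rV[R]_3.
Implicit Types (K : link2 R) (s o : seq space) (D : diagram R).

(** Vertex moves are stated for the first component; the exchange transfers them to the second. *)
Definition swap_link K : link2 R :=
  Link2 (comp2_knot K) (comp1_knot K) (etrans (setIC _ _) (comp_disjoint K)).

Lemma swap_isotopic K K' : isotopic K K' -> isotopic (swap_link K) (swap_link K').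
Proof.
elim=> [L L' h|L|L L' _|L L' L'' _ h1 _ h2].
- apply: Relation_Operators.rst_step; case: h => [[m [n [h1 h2]]]|[h|h]].
  + by left; exists n, m.
  + by right; right.
  + by right; left.
- exact: Relation_Operators.rst_refl.
- exact: Relation_Operators.rst_sym.
- exact: Relation_Operators.rst_trans h1 h2.
Qed.

Lemma swap_trivial K : trivial_link K -> trivial_link (swap_link K).
Proof.
case=> h1 h2 [n [a [b [n0 ab ha hb]]]]; split=> //; exists n, b, a.
by split=> //; rewrite eq_sym.
Qed.

Definition swap_diagram D : diagram R := Diagram (line2 D) (line1 D) (@over R D).

Lemma swap_edges D : diagram_edges (swap_diagram D) =i diagram_edges D.
Proof. by move=> e; rewrite !mem_cat orbC. Qed.

Lemma swap_crossing D e f : crossing (swap_diagram D) e f <-> crossing D e f.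
Proof. by split=> -[]; rewrite ?swap_edges => h1 h2 h3 h4; split; rewrite ?swap_edges. Qed.

Lemma swap_passes M K e f : passes_over M K e f -> passes_over M (swap_link K) e f.
Proof.
move=> [p [q [P [Q [h1 h2 h3 h4 h5]]]]]; exists p, q, P, Q; split=> //.
  by move: h1; rewrite !mem_cat orbC.
by move: h2; rewrite !mem_cat orbC.
Qed.

Lemma swap_linkK K : swap_link (swap_link K) = K.
Proof. by case: K => s o h1 h2 h3; rewrite /swap_link /=; congr Link2; exact: Prop_irrelevance. Qed.

Lemma swap_diagram_of K D : diagram_of K D -> diagram_of (swap_link K) (swap_diagram D).
Proof.
move=> [gp [M [hM h1 h2 ho]]]; split; first exact: gp_sym.
exists M; split=> // e f /swap_crossing /ho h; rewrite h; split; first exact: swap_passes.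
by move/swap_passes; rewrite swap_linkK.
Qed.

Lemma swap_null (g : link2 R -> int) : null_invariant g -> null_invariant (g \o swap_link).
Proof.
move=> [h1 h2 h3]; split=> [K K' /swap_isotopic|K /swap_trivial|Kp Km Dp Dm e f hp hm [c l1 l2 o1 o2] s1 s2].
- exact: h1.
- exact: h2.
apply: (h3 _ _ _ _ e f (swap_diagram_of hp) (swap_diagram_of hm) _ s1 s2).
split=> //; first exact/swap_crossing.
by move=> p q /swap_crossing; exact: o2.
Qed.

Lemma value_swap (g : link2 R -> int) s o : valid s o -> value (g \o swap_link) s o = value g o s.
Proof.
move=> v; rewrite (valueE _ v) (valueE g (valid_sym v)) /=; congr g.
move: (valid_sym v); case: v => h1 h2 h3 [k1 k2 k3].
by rewrite /swap_link /=; congr Link2; exact: Prop_irrelevance.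
Qed.

End Swap.

(** * Comparison with a generic link *)

Section Comparison.
Variable R : realType.
Notation space := 'rV[R]_3.
Implicit Types (A B C D X Y Z W P Q : space) (s o u d t S O : seq space).

(* Each vertex of the generic link is sent, by a generic move, to a point close *)
(* to the corresponding vertex of the other link, which is nudged there too.    *)
Lemma value_match1 (g : link2 R -> int) u u' d o O : null_invariant g -> size u = size u' ->
  gen ((u ++ d) ++ o) -> valid (u' ++ d) O -> (2 < size (u ++ d))%N -> (2 < size o)%N ->
  exists s, [/\ size s = size (u ++ d), gen (s ++ o), valid s O,
    value g (u ++ d) o = value g s o & value g (u' ++ d) O = value g s O].
Proof.
move=> hg; elim: u u' d => [|C u IH] [|X u'] d //= su hgen v s2 o2.
  by exists d.
(* [d] holds the vertices already common to both links. The targets of generic moves of [C] are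
   dense, so [X] can be nudged onto one of them. *)
have [C' [[e1 gC'] vC' e2]] := nudge hg v (generic_move hg hgen s2 o2).
have rE (w : seq space) : rot 1 (C' :: w ++ d) = w ++ rcons d C' by rewrite rot1_cons rcons_cat.
have [||||s [s1 h1 h2 h3 h4]] := IH u' (rcons d C') _ _ _ _ o2.
- by case: su.
- rewrite -rE; apply: gen_perm gC'.
  by rewrite -cat_cons perm_cat2r perm_sym perm_rot.
- by rewrite -rE; exact: valid_rot.
- by rewrite -rE size_rot.
exists s; split=> //; first by rewrite s1 -rE size_rot.
  rewrite -h3 -rE e1 value_rot //; exact: gen_valid.
by rewrite -h4 -rE e2 value_rot.
Qed.

Lemma value_match (g : link2 R -> int) s o S O : null_invariant g -> size s = size S -> size o = size O ->
  gen (s ++ o) -> valid S O -> (2 < size s)%N -> (2 < size o)%N -> value g s o = value g S O.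
Proof.
move=> hg sS oO hgen v s2 o2.
have [||||s' []] := @value_match1 g s S [::] o O hg sS; rewrite ?cats0 // => sz g1 v1 e1 e2.
have v1' := valid_sym v1; have s2' : (2 < size s')%N by rewrite sz.
have g1' : gen (o ++ s') by apply: gen_perm g1; rewrite perm_catC.
(* The first components are now both [s']; with the components exchanged, the second ones are
   matched in the same way. *)
have [||||o' []] := @value_match1 _ o O [::] s' s' (swap_null hg) oO; rewrite ?cats0 // => sz' g2 v2 e3 e4.
rewrite e1 e2 -(value_swap g v1') e4 -e3 value_swap //; exact: gen_valid.
Qed.

(** The moment curve, on which volumes are Vandermonde determinants: points with different
    parameters are in general position. *)
Definition moment (a : R) : space := \row_i a ^+ i.+1.

Lemma moment_vol (a b c e : R) : vol (moment a) (moment b) (moment c) (moment e) =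
  (b - a) * (c - a) * (e - a) * (c - b) * (e - b) * (e - c).
Proof. by rewrite /vol /det3 !mxE /=; ring. Qed.

Lemma moment_inj : injective moment.
Proof. by move=> a b /rowP/(_ 0); rewrite !mxE. Qed.

Lemma moment_gen (l : seq R) : uniq l -> gen (map moment l).
Proof.
move=> ul; split=> [|_ _ _ /mapP[a _ ->] /mapP[b _ ->] /mapP[c _ ->]|
  _ _ _ _ /mapP[a _ ->] /mapP[b _ ->] /mapP[c _ ->] /mapP[d _ ->]].
- by rewrite map_inj_uniq //; exact: moment_inj.
- rewrite -[[:: _; _; _]]/(map moment [:: a; b; c]) (map_inj_uniq moment_inj) /= !inE !negb_or.
  move=> /and3P[/andP[ab ac] bc _]; apply/eqP => /rowP/(_ ord_max)/eqP; rewrite !mxE /=.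
  rewrite (_ : _ - _ = (b - a) * (c - a) * (c - b)); last by rewrite !expr1; ring.
  by rewrite !mulf_eq0 !subr_eq0 ![_ == a]eq_sym (eq_sym c) (negPf ab) (negPf ac) (negPf bc).
rewrite -[[:: _; _; _; _]]/(map moment [:: a; b; c; d]) (map_inj_uniq moment_inj) /= !inE !negb_or.
move=> /and4P[/and3P[ab ac ad] /andP[bc bd] cd _].
by rewrite moment_vol !mulf_neq0 // subr_eq0 eq_sym.
Qed.

Lemma gen_exists m n : exists s o, [/\ size s = m, size o = n & gen (s ++ o)].
Proof.
pose l := [seq (i%:R : R) | i <- iota 0 (m + n)].
exists (take m (map moment l)), (drop m (map moment l)).
have sz : size (map moment l) = (m + n)%N by rewrite !size_map size_iota.
split; rewrite ?size_takel ?size_drop ?sz ?leq_addr ?addKn // cat_take_drop.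
apply: moment_gen; rewrite map_inj_uniq ?iota_uniq // => i j /eqP.
by rewrite eqr_nat => /eqP.
Qed.

Lemma grow_to (g : link2 R -> int) s o n : null_invariant g -> valid s o -> (size s <= n)%N ->
  exists s', [/\ size s' = n, valid s' o & value g s' o = value g s o].
Proof.
move=> hg v; elim: n => [|n IH]; first by rewrite leqn0 => /eqP h; exists s.
rewrite leq_eqVlt => /orP[/eqP h|/IH[s' [h1 h2 h3]]]; first by exists s.
case: s' h1 h2 h3 => [|A [|B [|D t]]] h1 h2 h3; [by case: h2 => -[]..|].
by have [C [v' e]] := grow hg h2 isT; exists [:: A, C, B, D & t]; split; rewrite ?e //= -h1.
Qed.

End Comparison.

(** * Vanishing of null invariants *)

Section Vanishing.
Variable R : realType.
Notation space := 'rV[R]_3.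
Implicit Types (X Y Z x : space) (s o V : seq space).

Lemma triangle_knot (A B C : space) : noncollinear A B C -> is_knot [:: A; B; C].
Proof.
move=> nc; have [AB AC BC] := noncollinear_neq nc.
have u : uniq [:: A; B; C] by rewrite /= !inE negb_or AB AC BC.
apply: (@gen_knot R [:: A; B; C]) => //; split=> // [X Y Z|X Y Z W hX hY hZ hW u4].
  have n1 := noncollinear12 nc; have n2 := noncollinear23 nc.
  have dup U W1 W2 : (U == W1) || (U == W2) || (W1 == W2) -> uniq [:: U; W1; W2] -> noncollinear U W1 W2.
    by move=> h; rewrite /= !inE negb_or andbT => /andP[/andP[/negPf h1 /negPf h2] /negPf h3]; rewrite h1 h2 h3 in h.
  by rewrite !inE => /or3P[]/eqP-> /or3P[]/eqP-> /or3P[]/eqP->;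
    first [apply: dup; rewrite eqxx ?orbT; exact: isT | move=> _; exact: nc | move=> _; exact: n1 | move=> _; exact: n2 |
      move=> _; exact: (noncollinear23 n1) | move=> _; exact: (noncollinear12 n2) |
      move=> _; exact: (noncollinear12 (noncollinear23 n1))].
have : (size [:: X; Y; Z; W] <= size [:: A; B; C])%N.
  by apply: uniq_leq_size => // w; rewrite mem_seq4 => /or4P[]/eqP->.
by [].
Qed.

(** A parabola in the horizontal plane of height [h]: three of its points are never collinear. *)
Definition flat (h a : R) : space := \row_i (if i == 0 then a else if i == 1 then a ^+ 2 else h).

Definition flat_triangle h : seq space := [:: flat h 0; flat h 1; flat h 2].

Lemma flat_knot h : is_knot (flat_triangle h).
Proof.
apply: triangle_knot; apply/eqP => /rowP/(_ ord_max)/eqP; rewrite !mxE /=.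
by rewrite (_ : _ - _ = 2) ?pnatr_eq0 //; ring.
Qed.

Lemma flat_level h X : X \in flat_triangle h -> X 0 ord_max = h.
Proof. by rewrite !inE => /or3P[]/eqP->; rewrite mxE. Qed.

Lemma flat_carrier h x : carrier (flat_triangle h) x -> x 0 ord_max = h.
Proof.
case=> e /mem_edges[/flat_level e1 /flat_level e2] [t [_ ->]].
by rewrite !mxE e1 e2; ring.
Qed.

Lemma flat_valid : valid (flat_triangle 0) (flat_triangle 1).
Proof.
split; try exact: flat_knot.
apply/seteqP; split=> // x [/flat_carrier h0 /flat_carrier h1].
by move: (oner_neq0 R); rewrite -h1 h0 eqxx.
Qed.

Variable g : link2 R -> int.
Hypothesis hg : null_invariant g.

Lemma value_flat : value g (flat_triangle 0) (flat_triangle 1) = 0.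
Proof.
rewrite (valueE g flat_valid); case: hg => _ triv _; apply: triv.
have E (n := delta_mx 0 ord_max : space) X : dot n X = X 0 ord_max.
  by rewrite dotE !mxE /=; ring.
case: flat_valid => h1 h2 h3; split=> //=; exists (delta_mx 0 ord_max), 0, 1; split=> //.
- by apply/eqP => /rowP/(_ ord_max)/eqP; rewrite !mxE /= oner_eq0.
- by rewrite eq_sym oner_eq0.
- by move=> X /flat_level; rewrite E.
- by move=> X /flat_level; rewrite E.
Qed.

Lemma null_invariant0 K : g K = 0.
Proof.
have v : valid (comp1 K) (comp2 K) by case: K.
have [[s2 _ _] [o2 _ _] _] := v; rewrite valueK.
have [s [ss vs es]] := grow_to hg flat_valid s2.
have [o [so vo eo]] := grow_to (swap_null hg) (valid_sym vs) o2.
have [s' [o' [ss' so' hgen]]] := gen_exists R (size (comp1 K)) (size (comp2 K)).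
have e1 : value g s' o' = value g (comp1 K) (comp2 K).
  by apply: value_match; rewrite ?ss' ?so'.
have e2 : value g s' o' = value g s o.
  by apply: value_match; rewrite ?ss' ?so' //; exact: valid_sym.
rewrite -e1 e2 -(value_swap g vo) eo (value_swap g (valid_sym vs)) es; exact: value_flat.
Qed.

End Vanishing.

Theorem theorem8p4 (R : realType) :
  exists! lk : link2 R -> int,
    [/\ (forall K K' : link2 R, isotopic K K' -> lk K = lk K'),
        (forall K : link2 R, trivial_link K -> lk K = 0) &
        (forall (Kp Km : link2 R) (Dp Dm : diagram R) (e f : edge R),
           diagram_of Kp Dp -> diagram_of Km Dm ->
           crossing_change Dp Dm e f ->
           crossing_sign Dp e f = 1 -> crossing_sign Dm e f = -1 ->
           lk Kp - lk Km = if different_components Dp e f then 1 else 0)].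
Proof.
exists (@lk R); split.
  split=> [K K'|K|Kp Km Dp Dm e f h1 h2 h3 h4 _]; first exact: lk_isotopic.
    exact: lk_trivial.
  exact: (lk_crossing h1 h2 h3 h4).
move=> lk' [iso triv cross]; apply/funext => K; apply/eqP; rewrite -subr_eq0; apply/eqP.
apply: (@null_invariant0 R (fun K => lk K - lk' K)); split.
- by move=> K1 K2 h; rewrite (lk_isotopic h) (iso _ _ h).
- by move=> K1 h; rewrite lk_trivial // triv // subrr.
- move=> Kp Km Dp Dm e f h1 h2 h3 h4 h5.
  have := lk_crossing h1 h2 h3 h4; rewrite -(cross _ _ _ _ _ _ h1 h2 h3 h4 h5) => E.
  by apply/eqP; rewrite subr_eq addrAC -[X in _ == X]addrA -subr_eq0; apply/eqP; move: E; lia.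
Qed.
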